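(* Let $\lambda_1,\dots,\lambda_6\in\mathbb{R}$ satisfy $$\lambda_1+\lambda_3=0,\qquad2\lambda_1+\lambda_4=0,\qquad\lambda_2=2\lambda_6,\qquad \lambda_2\ne\lambda_6 .$$ Let $s>\tfrac32$ and $u_0\in H^s(\mathbb{R})$. Set $$C_1=\frac12\Big(|\lambda_3|+|\lambda_5|+\Big|\frac{\lambda_1\lambda_3}{\lambda_6-\lambda_2}\Big|+\Big|\frac{\lambda_1\lambda_5}{\lambda_6-\lambda_2}\Big|\Big),\qquad C_2=\frac12\Big(|\lambda_4|+|\lambda_6|+\Big|\frac{\lambda_1\lambda_4}{\lambda_6-\lambda_2}\Big|+\Big|\frac{\lambda_1\lambda_6}{\lambda_6-\lambda_2}\Big|\Big),$$ $$K_0=\Big(\frac{|\lambda_5|}{2}+\max\{C_1,C_2\}\Big)\|u_0\|_{H^1}^2,\qquad w_0(x)=u_{0x}(x)-\frac{\lambda_1}{\lambda_6-\lambda_2}u_0(x).$$ Suppose that there is a point $x_0\in\mathbb{R}$ such that $$w_0(x_0)<-\sqrt{\frac{K_0}{\lambda_2-\lambda_6}}\ \text{ if }\lambda_6<\lambda_2,\qquad w_0(x_0)>\sqrt{\frac{K_0}{\lambda_6-\lambda_2}}\ \text{ if }\lambda_6>\lambda_2 .$$ Then the solution $u(x,t)$ of the Cauchy problem $$u_t+\lambda_1u^2+\lambda_2uu_x+G\ast(\lambda_3u^2+\lambda_4u_x^2)+\partial_x\big(G\ast(\lambda_5u^2+\lambda_6u_x^2)\big)=0,\quad x\in\mathbb{R},\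 t>0,\qquad u(x,0)=u_0(x),$$ blows up in finite time, and its blow-up time $T^*$ satisfies $$T^*\le\frac{1}{2\sqrt{(\lambda_2-\lambda_6)K_0}}\,\log\left(\frac{w_0(x_0)-\sqrt{\frac{K_0}{\lambda_2-\lambda_6}}}{w_0(x_0)+\sqrt{\frac{K_0}{\lambda_2-\lambda_6}}}\right)\quad\text{if }\lambda_6<\lambda_2,$$ $$T^*\le\frac{1}{2\sqrt{(\lambda_6-\lambda_2)K_0}}\,\log\left(\frac{w_0(x_0)+\sqrt{\frac{K_0}{\lambda_6-\lambda_2}}}{w_0(x_0)-\sqrt{\frac{K_0}{\lambda_6-\lambda_2}}}\right)\quad\text{if }\lambda_6>\lambda_2 .$$
   Context: $G(x)=\tfrac12e^{-|x|}$ is the Helmholtz kernel on $\mathbb{R}$, $\ast$ is convolution in $x$, and $\|u\|_{H^1}^2=\|u\|_{L^2}^2+\|u_x\|_{L^2}^2$. ''The solution'' is the unique maximal solution $u\in C([0,T);H^s(\mathbb{R}))\cap C^1([0,T);H^{s-1}(\mathbb{R}))$ (the Cauchy problem is locally well posed in $H^s(\mathbb{R})$ for $s>\tfrac32$); it blows up in finite time if its maximal existence time is finite, and this maximal time is the blow-up time $T^*$. *)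

(* Defs.v *)
(* MathComp-Analysis *)
From HB Require Import structures.
From mathcomp Require Import all_boot all_order all_algebra.
From mathcomp Require Import all_classical all_reals all_analysis.

Set Implicit Arguments.
Unset Strict Implicit.
Unset Printing Implicit Defensive.
Import Order.TTheory GRing.Theory Num.Theory.
Import numFieldNormedType.Exports.

Local Open Scope classical_set_scope.
Local Open Scope ring_scope.

(* Real and imaginary parts of the unitary Fourier transform
   (2 pi)^(-1/2) \int f(x) exp(-i x xi) dx of f restricted to [-N, N]. *)
Definition fourier_trunc_re (R : realType) (f : R -> R) (N : nat) (xi : R) : R :=
  (Num.sqrt (2 * pi))^-1 *
  \int[lebesgue_measure]_(x in `[- N%:R, N%:R]) (f x * cos (x * xi)).

Definition fourier_trunc_im (R : realType) (f : R -> R) (N : nat) (xi : R) : R :=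
  - ((Num.sqrt (2 * pi))^-1 *
     \int[lebesgue_measure]_(x in `[- N%:R, N%:R]) (f x * sin (x * xi))).

(* The Fourier-Plancherel transform of f in L^2: a + i b is the limit in L^2 of
   the transforms of the truncations of f.  It is unique up to null sets. *)
Definition is_fourier (R : realType) (f a b : R -> R) : Prop :=
  [/\ f \in Lfun lebesgue_measure 2%:E,
      measurable_fun [set: R] a,
      measurable_fun [set: R] b &
      (\int[lebesgue_measure]_xi
         ((fourier_trunc_re f N xi - a xi) ^+ 2 +
          (fourier_trunc_im f N xi - b xi) ^+ 2)%:E)%E @[N --> \oo] --> 0%E].

(* Square of the H^s norm, s >= 0.  The infimum is over a single value, as the
   transform of f is unique up to null sets, or over the empty set when f is
   not in L^2, in which case it is +oo. *)
Definition sobolev_normsq (R : realType) (s : R) (f : R -> R) : \bar R :=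
  ereal_inf [set r : \bar R | exists a b : R -> R, is_fourier f a b /\
    r = (\int[lebesgue_measure]_xi
           ((1 + xi ^+ 2) `^ s * (a xi ^+ 2 + b xi ^+ 2))%:E)%E].

(* H^s for s > 1/2: a class of functions modulo null sets is identified with
   its continuous representative. *)
Definition sobolev (R : realType) (s : R) : set (R -> R) :=
  [set f | continuous f /\ (sobolev_normsq s f < +oo)%E].

Definition H1_normsq (R : realType) (f : R -> R) : R :=
  fine ('N[lebesgue_measure]_2%:E [EFin \o f])%E ^+ 2 +
  fine ('N[lebesgue_measure]_2%:E [EFin \o derive1 f])%E ^+ 2.

(* [0, T), with T possibly infinite *)
Definition time_interval (R : realType) (T : \bar R) : set R :=
  [set t : R | 0 <= t /\ (t%:E < T)%E].

(* Functions of (t, x) are seen as curves t |-> u t; this is C([0, T); H^s). *)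
Definition C0_sobolev (R : realType) (T : \bar R) (s : R) (u : R -> R -> R) : Prop :=
  forall t, time_interval T t ->
    sobolev s (u t) /\
    sobolev_normsq s (fun x => u t' x - u t x)
      @[t' --> within (time_interval T) (nbhs t)] --> 0%E.

(* u is in C^1([0, T); H^s) with derivative ut, one-sided at t = 0. *)
Definition C1_sobolev (R : realType) (T : \bar R) (s : R) (u ut : R -> R -> R) : Prop :=
  [/\ C0_sobolev T s u,
      C0_sobolev T s ut &
      forall t, time_interval T t ->
        sobolev_normsq s (fun x => (u t' x - u t x) / (t' - t) - ut t x)
          @[t' --> within (time_interval T) t^'] --> 0%E].

Definition helmholtz (R : realType) (x : R) : R := 2^-1 * expR (- `|x|).

Definition convolution (R : realType) (f g : R -> R) (x : R) : R :=
  \int[lebesgue_measure]_y (f (x - y) * g y).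

Definition is_solution (R : realType) (l1 l2 l3 l4 l5 l6 s : R) (u0 : R -> R)
    (T : \bar R) (u : R -> R -> R) : Prop :=
  [/\ (0 < T)%E,
      C0_sobolev T s u,
      u 0 = u0 &
      exists2 ut : R -> R -> R, C1_sobolev T (s - 1) u ut &
        forall t x : R, 0 < t -> (t%:E < T)%E ->
          ut t x + l1 * u t x ^+ 2 + l2 * u t x * derive1 (u t) x
          + convolution (@helmholtz R)
              (fun y => l3 * u t y ^+ 2 + l4 * derive1 (u t) y ^+ 2) x
          + derive1 (convolution (@helmholtz R)
              (fun y => l5 * u t y ^+ 2 + l6 * derive1 (u t) y ^+ 2)) x
          = 0].

(* u is a solution on [0, T) with no extension to a longer interval, so that
   T is its maximal existence time. *)
Definition is_maximal_solution (R : realType) (l1 l2 l3 l4 l5 l6 s : R)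
    (u0 : R -> R) (T : \bar R) (u : R -> R -> R) : Prop :=
  is_solution l1 l2 l3 l4 l5 l6 s u0 T u /\
  forall (T' : \bar R) (u' : R -> R -> R),
    is_solution l1 l2 l3 l4 l5 l6 s u0 T' u' ->
    (forall t, time_interval T t -> u' t = u t) -> ~ (T < T')%E.

(* Main.v *)
(* With [b = l1 / (l6 - l2)], the function [v = u_x - b u] satisfies, at a
   minimum in [x], a Riccati inequality [v_t <= - (l2 - l6) v^2 + K0] when
   [l6 < l2]: there [u_xx = b u_x], the terms of second order disappear, and the
   local and nonlocal remainders are bounded by the H^1 energy, which the
   conditions on the coefficients make nonincreasing.  Comparison with the
   explicit solution of [y' = - (l2 - l6) y^2 + K0] gives the lifespan; the case
   [l2 < l6] follows by changing the signs of [u] and of the coefficients.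

   As [u_xx] need not be a function when [s < 2], [u_x] is replaced by the
   difference quotient [D_h u] both in [v] and in the energy
   [int u^2 + (D_h u)^2].  The errors are controlled, locally uniformly in time,
   by [h] and by the modulus of continuity of [u_x] given by the Sobolev
   embedding, and vanish as [h] tends to 0.  The embedding comes from Fourier
   inversion, proved by damping the transform with [exp (- e |xi|)], which turns
   it into a Poisson kernel. *)

Require Import Defs.
From HB Require Import structures.
From mathcomp Require Import all_boot all_order all_algebra.
From mathcomp Require Import all_classical all_reals all_analysis.
From mathcomp Require Import measurable_realfun ring lra.

Set Implicit Arguments.
Unset Strict Implicit.
Unset Printing Implicit Defensive.
Import Order.TTheory GRing.Theory Num.Theory.
Import numFieldNormedType.Exports.

Local Open Scope classical_set_scope.
Local Open Scope ring_scope.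

(** * Lebesgue integrable real functions *)

(** Formally, testing the equation with [m = u - u_xx], for which [G * m = u], gives [dE/dt / 2 = -
    ((l1 + l3) int u^3 + (2 l1 + l4) int u u_x^2 + (l2 / 2 - l6) int u_x^3)]: the conditions on the
    coefficients make all three terms vanish. The value [b = l1 / (l6 - l2)] is the one for which
    the quadratic terms of [v_t] at a critical point of [v] complete to [(l6 - l2) v^2]. What is
    left is [l5 u^2], where [u^2 <= E / 2], and four nonlocal terms, each at most half an L^1 norm
    because [G] and [|G'|] are at most 1/2; sorting them by [int u^2] and [int u_x^2] yields [C1]
    and [C2]. The obstacle is regularity: for [3/2 < s < 2], [u_t] lies only in [H^(s-1)], so it is
    continuous and square integrable, but [u_tx] need not be a function. With the step [h] fixed,
    the discrete energy and the discrete [v] involve values of [u] only, hence can be differentiated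
    in time, and a minimum of the discrete [v] gives an exact relation between [D_h u_x] and [u_x].
    The equation is given for [t > 0] only, so both arguments start at a small positive time and use
    continuity at 0. *)

Definition L1 (R : realType) (f : R -> R) : Prop :=
  (@lebesgue_measure R).-integrable setT (EFin \o f).

Section integrable_functions.
Context {R : realType}.
Notation mu := (@lebesgue_measure R).
Implicit Types f g : R -> R.

Lemma measurable_EFin f : measurable_fun setT f ->
  measurable_fun [set: measurableTypeR R] (EFin \o f).
Proof. by move=> mf; apply/measurable_EFinP; exact mf. Qed.

Lemma L1_measurable f : L1 f -> measurable_fun setT f.
Proof. by move=> /integrableP[/measurable_EFinP]. Qed.

Lemma L1_le f g : measurable_fun setT f -> L1 g -> (forall x, `|f x| <= g x) ->
  L1 f.
Proof.
move=> mf ig fg; apply: le_integrable ig => //; first exact (measurable_EFin mf).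
by move=> x _; rewrite /= lee_fin (le_trans (fg x))// ler_norm.
Qed.

Lemma L1D f g : L1 f -> L1 g -> L1 (fun x => f x + g x).
Proof. by move=> If Ig; have := integrableD measurableT If Ig. Qed.

Lemma L1N f : L1 f -> L1 (fun x => - f x).
Proof. by move=> If; have := integrableN If. Qed.

Lemma L1B f g : L1 f -> L1 g -> L1 (fun x => f x - g x).
Proof. by move=> If Ig; apply: L1D => //; apply: L1N. Qed.

Lemma L1Z k f : L1 f -> L1 (fun x => k * f x).
Proof. by move=> If; have := integrableZl measurableT k If. Qed.

Lemma L1_norm f : L1 f -> L1 (fun x => `|f x|).
Proof. by move=> If; apply: integrable_norm. Qed.

Lemma L1_eq f g : f =1 g -> L1 f -> L1 g.
Proof. by move=> /funext ->. Qed.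

Lemma int_scale k f : L1 f -> \int[mu]_x (k * f x) = k * \int[mu]_x f x.
Proof. by move=> If; rewrite RintegralZl. Qed.

Lemma int_neg f : L1 f -> \int[mu]_x (- f x) = - \int[mu]_x f x.
Proof.
move=> If; rewrite -mulN1r -int_scale//.
by apply: eq_Rintegral => x _; rewrite mulN1r.
Qed.

Lemma int_add f g : L1 f -> L1 g ->
  \int[mu]_x (f x + g x) = \int[mu]_x f x + \int[mu]_x g x.
Proof. by move=> If Ig; rewrite RintegralD. Qed.

Lemma int_sub f g : L1 f -> L1 g ->
  \int[mu]_x (f x - g x) = \int[mu]_x f x - \int[mu]_x g x.
Proof. by move=> If Ig; rewrite RintegralB. Qed.

Lemma eq_int f g : f =1 g -> \int[mu]_x f x = \int[mu]_x g x.
Proof. by move=> /funext ->. Qed.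

Lemma le_int f g : L1 f -> L1 g -> (forall x, f x <= g x) ->
  \int[mu]_x f x <= \int[mu]_x g x.
Proof. by move=> If Ig fg; apply: le_Rintegral. Qed.

Lemma int_ge0 f : (forall x, 0 <= f x) -> 0 <= \int[mu]_x f x.
Proof. by move=> f0; apply: Rintegral_ge0. Qed.

Lemma le_norm_int f : L1 f -> `|\int[mu]_x f x| <= \int[mu]_x `|f x|.
Proof. by move=> If; apply: le_normr_Rintegral. Qed.

Lemma norm_int_le f g : L1 f -> L1 g -> (forall x, `|f x| <= g x) ->
  `|\int[mu]_x f x| <= \int[mu]_x g x.
Proof.
move=> If Ig fg; apply: (le_trans (le_norm_int If)).
by apply: le_int => //; apply: L1_norm.
Qed.

Lemma EFin_int f : L1 f -> (\int[mu]_x f x)%:E = (\int[mu]_x (f x)%:E)%E.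
Proof. by move=> If; rewrite /Rintegral fineK//; apply: integrable_fin_num. Qed.

Lemma L1_lty f : measurable_fun setT f -> (forall x, 0 <= f x) ->
  (\int[mu]_x (f x)%:E < +oo)%E -> L1 f.
Proof.
move=> mf f0 h; apply/integrableP; split; first exact (measurable_EFin mf).
apply: le_lt_trans h; apply: ge0_le_integral => //.
- apply: measurableT_comp => //; exact (measurable_EFin mf).
- exact (measurable_EFin mf).
- by move=> x _; rewrite /= lee_fin ger0_norm.
Qed.

Lemma int_cvg (f_ : nat -> R -> R) f g :
  (forall n, measurable_fun setT (f_ n)) -> measurable_fun setT f ->
  (forall x, f_ n x @[n --> \oo] --> f x) -> L1 g ->
  (forall n x, `|f_ n x| <= g x) ->
  L1 f /\ \int[mu]_x f_ n x @[n --> \oo] --> \int[mu]_x f x.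
Proof.
move=> mf_ mf ff Lg fg.
have [|||||If _ h] := @dominated_convergence _ _ _ mu setT measurableT
  (fun n => EFin \o f_ n) (EFin \o f) (EFin \o g).
- by move=> n; exact (measurable_EFin (mf_ n)).
- exact (measurable_EFin mf).
- by apply: aeW => x _; apply: cvg_EFin; [exact: nearW|exact: ff].
- exact: Lg.
- by apply: aeW => x n _; rewrite /= lee_fin.
split=> //.
by apply: fine_cvg; rewrite -/(Rintegral _ _ _) EFin_int.
Qed.

(** Fatou's lemma: when a damping factor is removed, no dominating function is at hand, only a
    uniform bound on the integrals. *)
Lemma int_cvg_nneg (f_ : nat -> R -> R) f M :
  (forall n, measurable_fun setT (f_ n)) -> measurable_fun setT f ->
  (forall n x, 0 <= f_ n x) -> (forall n, L1 (f_ n)) ->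
  (forall x, f_ n x @[n --> \oo] --> f x) ->
  (forall n, \int[mu]_x f_ n x <= M) ->
  L1 f /\ \int[mu]_x f x <= M.
Proof.
move=> mf_ mf f0 Lf ff fM.
have f_ge0 x : 0 <= f x.
  by rewrite -(cvg_lim _ (ff x))//; apply: limr_ge;
    [apply/cvg_ex; exists (f x)|apply: nearW].
have H : (\int[mu]_x (f x)%:E <= M%:E)%E.
  have -> : (\int[mu]_x (f x)%:E = \int[mu]_x limn_einf (fun n => (f_ n x)%:E))%E.
    apply: eq_integral => x _; apply/esym.
    apply: (cvg_limn_einf_sup _).1.
    by apply: cvg_EFin; [exact: nearW|exact: ff].
  apply: (le_trans (fatou mu measurableT _ _)).
  - by move=> n; exact (measurable_EFin (mf_ n)).
  - by move=> n x _; rewrite lee_fin.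
  rewrite limn_einf_lim; apply: lime_le; first exact: is_cvg_einfs.
  apply: nearW => n; apply: le_trans (ereal_inf_lbound _) _.
    by exists n => /=; [|reflexivity].
  by rewrite -EFin_int// lee_fin.
have If : L1 f by apply: L1_lty => //; apply: le_lt_trans H (ltry _).
by split=> //; rewrite -lee_fin EFin_int.
Qed.

(** Integration against the image measure, which is [mu] itself; it serves both translations and the
    reflection. *)
Lemma L1_comp (phi : R -> R) f : measurable_fun setT phi ->
  (forall A, measurable A ->
     pushforward mu (phi : R -> measurableTypeR R) A = mu A) ->
  L1 f -> L1 (f \o phi) /\ \int[mu]_x f (phi x) = \int[mu]_x f x.
Proof.
move=> mphi inv Lf.
have mphi' : measurable_fun [set: measurableTypeR R]
    (phi : R -> measurableTypeR R) by exact mphi.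
have mf : measurable_fun [set: measurableTypeR R] (EFin \o f).
  by exact (measurable_EFin (L1_measurable Lf)).
have Lfp : L1 (f \o phi).
  apply/integrableP; split.
    exact (measurable_EFin (measurableT_comp (L1_measurable Lf) mphi)).
  have /integrableP[_] := Lf; apply: le_lt_trans.
  rewrite le_eqVlt; apply/orP; left; apply/eqP.
  transitivity (\int[pushforward mu (phi : R -> measurableTypeR R)]_x `|(f x)%:E|)%E.
    rewrite ge0_integral_pushforward//.
    exact (measurableT_comp (@abse_measurable R setT) mf).
  by apply: eq_measure_integral => //= A mA AS; apply: inv.
split => //; rewrite /Rintegral; congr fine.
transitivity (\int[pushforward mu (phi : R -> measurableTypeR R)]_x (f x)%:E)%E.
  by rewrite (integral_pushforward mphi' mf).
by apply: eq_measure_integral => //= A mA AS; apply: inv.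
Qed.

(** Lebesgue measure is determined by its values on half-open intervals, whose lengths a shift
    preserves. *)
Lemma lebesgue_measure_shift (h : R) (A : set R) : measurable A ->
  pushforward mu ((fun x => x + h) : R -> measurableTypeR R) A = mu A.
Proof.
move=> mA; apply/esym/lebesgue_measure_unique => //=.
  have m : measurable_fun [set: R] (fun x => x + h) by exact: measurable_funD.
  exact m.
move=> _ _ [[a b]] _ <-; rewrite /pushforward.
have -> : (fun x => x + h) @^-1` `]a, b]%classic = `]a - h, b - h]%classic.
  by apply/seteqP; split => x /=; rewrite !in_itv/= ltrBlDr lerBrDr.
rewrite !lebesgue_measure_itv/= !lte_fin ltrD2r; case: ifP => // _.
by rewrite -!EFinB; congr EFin; ring.
Qed.

Lemma L1_shift f h : L1 f -> L1 (fun x => f (x + h)).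
Proof.
move=> Lf; apply: (proj1 (@L1_comp (fun x => x + h) f _ _ Lf)).
  exact: measurable_funD.
by move=> A mA; apply: lebesgue_measure_shift.
Qed.

Lemma int_shift f h : L1 f -> \int[mu]_x f (x + h) = \int[mu]_x f x.
Proof.
move=> Lf; apply: (proj2 (@L1_comp (fun x => x + h) f _ _ Lf)).
  exact: measurable_funD.
by move=> A mA; apply: lebesgue_measure_shift.
Qed.

Lemma L1_opp f : L1 f -> L1 (fun x => f (- x)).
Proof.
move=> Lf; apply: (proj1 (@L1_comp (fun x => - x) f _ _ Lf)).
  exact: oppr_measurable.
by move=> A mA; apply: lebesgue_measureN.
Qed.

Lemma int_opp f : L1 f -> \int[mu]_x f (- x) = \int[mu]_x f x.
Proof.
move=> Lf; apply: (proj2 (@L1_comp (fun x => - x) f _ _ Lf)).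
  exact: oppr_measurable.
by move=> A mA; apply: lebesgue_measureN.
Qed.

(** The majorant [g] makes the iterated integral of [|F|] finite, so that [F] is integrable on the
    plane. Integrability of every section, rather than almost every one, lets the inner integrals be
    rewritten at each point. *)
Lemma Fubini_L1 (F : R * R -> R) (g : R -> R) :
  measurable_fun setT F -> (forall x, L1 (fun y => F (x, y))) ->
  (forall y, L1 (fun x => F (x, y))) ->
  L1 g -> (forall x, \int[mu]_y `|F (x, y)| <= g x) ->
  [/\ L1 (fun x => \int[mu]_y F (x, y)), L1 (fun y => \int[mu]_x F (x, y)) &
      \int[mu]_x \int[mu]_y F (x, y) = \int[mu]_y \int[mu]_x F (x, y)].
Proof.
move=> mF LF LF' Lg Fg.
have maF : measurable_fun [set: measurableTypeR R * measurableTypeR R]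
    (abse \o (EFin \o F)).
  exact (measurableT_comp (@abse_measurable R setT) (proj2 (measurable_EFinP _ _) mF)).
have iF : ((mu \x mu)%E).-integrable setT (EFin \o F).
  apply/integrable12ltyP; first exact (proj2 (measurable_EFinP _ _) mF).
  have /integrableP[_] := Lg; apply: le_lt_trans.
  apply: ge0_le_integral => //.
  - by move=> x _; apply: integral_ge0 => y _; apply: abse_ge0.
  - exact (measurable_fun_fubini_tonelli_F _ maF (fun z => abse_ge0 _)).
  - exact (measurableT_comp (@abse_measurable R setT) (measurable_EFin (L1_measurable Lg))).
  - move=> x _; rewrite -EFin_int; last exact/L1_norm/LF.
    by rewrite /= lee_fin (le_trans (Fg x))// ler_norm.
have e1 x : (\int[mu]_y (EFin \o F) (x, y))%E = (\int[mu]_y F (x, y))%:E.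
  by rewrite EFin_int.
have e2 y : (\int[mu]_x (EFin \o F) (x, y))%E = (\int[mu]_x F (x, y))%:E.
  by rewrite EFin_int.
have iF1 : L1 (fun x => \int[mu]_y F (x, y)).
  have := integrable_fubini_F iF.
  by apply: eq_integrable => // x _; rewrite /fubini_F e1.
have iF2 : L1 (fun y => \int[mu]_x F (x, y)).
  have mF2 : measurable_fun [set: measurableTypeR R * measurableTypeR R] (EFin \o F).
    exact (proj2 (measurable_EFinP _ _) mF).
  (* Integrability of the other inner integral is that of the first one for the swapped function. *)
  have iF' : ((mu \x mu)%E).-integrable setT (EFin \o F \o (fun z => (z.2, z.1))).
    apply/integrable12ltyP.
      exact (measurableT_comp mF2 (@measurable_swap _ _ _ _)).
    exact (proj1 (integrable21ltyP _ _ mF2) iF).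
  have := integrable_fubini_F iF'.
  by apply: eq_integrable => // x _; rewrite /fubini_F/= e2.
split=> //; apply: EFin_inj; rewrite !EFin_int//.
under eq_integral do rewrite -e1.
rewrite (Fubini iF).
by under eq_integral do rewrite e2.
Qed.

(** The form needed for trigonometric and Poisson kernels; the majorant is [M] times the L^1 norm of
    [A] times [|phi|]. *)
Lemma Fubini_kernel (phi A : R -> R) (k : R * R -> R) (M : R) :
  L1 phi -> L1 A -> measurable_fun setT k -> (forall z, `|k z| <= M) ->
  [/\ L1 (fun x => \int[mu]_y (phi x * A y * k (x, y))),
      L1 (fun y => \int[mu]_x (phi x * A y * k (x, y))) &
      \int[mu]_x \int[mu]_y (phi x * A y * k (x, y)) =
      \int[mu]_y \int[mu]_x (phi x * A y * k (x, y))].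
Proof.
move=> Lphi LA mk kM.
have M0 : 0 <= M by apply: le_trans (kM (0, 0)).
have mF : measurable_fun setT (fun z : R * R => phi z.1 * A z.2 * k z).
  apply: measurable_funM => //; apply: measurable_funM.
    by apply: (measurableT_comp (L1_measurable Lphi)).
  by apply: (measurableT_comp (L1_measurable LA)).
have b x y : `|phi x * A y * k (x, y)| <= M * (`|phi x| * `|A y|).
  by rewrite !normrM mulrC ler_wpM2r// mulr_ge0.
have L1x x : L1 (fun y => phi x * A y * k (x, y)).
  apply: (@L1_le _ (fun y => M * (`|phi x| * `|A y|))) => //.
    by exact (measurableT_comp mF (pair1_measurable x)).
  by apply/L1Z/L1Z/L1_norm.
have L1y y : L1 (fun x => phi x * A y * k (x, y)).
  apply: (@L1_le _ (fun x => (M * `|A y|) * `|phi x|)) => //.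
    by exact (measurableT_comp mF (pair2_measurable y)).
    by apply/L1Z/L1_norm.
  move=> x; rewrite (le_trans (b x y))// le_eqVlt; apply/orP; left.
  by apply/eqP; ring.
apply: (@Fubini_L1 (fun z => phi z.1 * A z.2 * k z)
   (fun x => (M * \int[mu]_y `|A y|) * `|phi x|)) => //.
  by apply/L1Z/L1_norm.
move=> x.
have -> : M * (\int[mu]_y `|A y|) * `|phi x| =
   \int[mu]_y (M * (`|phi x| * `|A y|)).
  rewrite !int_scale//; [by ring|exact: L1_norm|by apply/L1Z/L1_norm].
apply: le_int => //; first exact/L1_norm/L1x.
by apply/L1Z/L1Z/L1_norm.
Qed.

End integrable_functions.

(** * Continuity and derivatives *)

Section calculus.
Context {R : realType}.
Notation mu := (@lebesgue_measure R).
Implicit Types (f g : R -> R) (k h x : R).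

Lemma cont_cst (k : R) : continuous (fun _ : R => k).
Proof. by move=> x; exact: cvg_cst. Qed.

Lemma cont_id : continuous (fun x : R => x).
Proof. by move=> x; exact: cvg_id. Qed.

Lemma cont_add f g : continuous f -> continuous g ->
  continuous (fun x => f x + g x).
Proof. by move=> cf cg x; apply: cvgD; [exact: cf|exact: cg]. Qed.

Lemma cont_opp f : continuous f -> continuous (fun x => - f x).
Proof. by move=> cf x; apply: cvgN; exact: cf. Qed.

Lemma cont_sub f g : continuous f -> continuous g ->
  continuous (fun x => f x - g x).
Proof. by move=> cf cg x; apply: cvgB; [exact: cf|exact: cg]. Qed.

Lemma cont_mul f g : continuous f -> continuous g ->
  continuous (fun x => f x * g x).
Proof. by move=> cf cg x; apply: cvgM; [exact: cf|exact: cg]. Qed.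

Lemma cont_sqr f : continuous f -> continuous (fun x => f x ^+ 2).
Proof. by move=> cf; apply: cont_mul. Qed.

Lemma cont_comp f g : continuous f -> continuous g ->
  continuous (fun x => g (f x)).
Proof. by move=> cf cg x; apply: (cvg_comp f g (cf x)); exact: cg. Qed.

Lemma cont_inv f : continuous f -> (forall x, f x != 0) ->
  continuous (fun x => (f x)^-1).
Proof. by move=> cf f0 x; apply: cvgV => //; exact: cf. Qed.

Lemma cont_norm f : continuous f -> continuous (fun x => `|f x|).
Proof. by move=> cf x; apply: cvg_norm; exact: cf. Qed.

Lemma cont_shift f (h : R) : continuous f -> continuous (fun x => f (x + h)).
Proof.
by move=> cf; apply: cont_comp => //; apply: cont_add;
  [exact: cont_id|exact: cont_cst].
Qed.

Lemma cont_meas f : continuous f -> measurable_fun setT f.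
Proof. exact: continuous_measurable_fun. Qed.

Lemma is_deriveE f x (a b : R) : is_derive x (1 : R) f a -> a = b ->
  is_derive x (1 : R) f b.
Proof. by move=> ? <-. Qed.

Lemma is_derive_ext f g x (a : R) : f =1 g -> is_derive x (1 : R) f a ->
  is_derive x (1 : R) g a.
Proof. by move=> /funext ->. Qed.

Lemma is_derive_add f g x (a b : R) : is_derive x (1 : R) f a ->
  is_derive x (1 : R) g b -> is_derive x (1 : R) (fun y => f y + g y) (a + b).
Proof. by move=> *; apply: is_deriveD. Qed.

Lemma is_derive_opp f x (a : R) : is_derive x (1 : R) f a ->
  is_derive x (1 : R) (fun y => - f y) (- a).
Proof. by move=> *; apply: is_deriveN. Qed.

Lemma is_derive_sub f g x (a b : R) : is_derive x (1 : R) f a ->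
  is_derive x (1 : R) g b -> is_derive x (1 : R) (fun y => f y - g y) (a - b).
Proof. by move=> *; apply: is_deriveB. Qed.

Lemma is_derive_mul f g x (a b : R) : is_derive x (1 : R) f a ->
  is_derive x (1 : R) g b ->
  is_derive x (1 : R) (fun y => f y * g y) (a * g x + f x * b).
Proof.
move=> fa gb; have h := is_deriveM fa gb.
by apply: (is_deriveE h); rewrite /GRing.scale/= addrC [g x * a]mulrC.
Qed.

Lemma is_derive_sqr f x (a : R) : is_derive x (1 : R) f a ->
  is_derive x (1 : R) (fun y => f y ^+ 2) (2 * f x * a).
Proof.
move=> fa; apply: (@is_derive_ext (fun y => f y * f y)).
  by move=> y; rewrite expr2.
refine (is_deriveE (is_derive_mul fa fa) _).
by ring.
Qed.

Lemma is_derive_scale k f x (a : R) : is_derive x (1 : R) f a ->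
  is_derive x (1 : R) (fun y => k * f y) (k * a).
Proof.
move=> fa; have h := is_derive_mul (is_derive_cst k x 1) fa.
by apply: (is_deriveE h); rewrite /=; ring.
Qed.

Lemma is_derive_c k x : is_derive x (1 : R) (fun _ : R => k) 0.
Proof. exact: is_derive_cst. Qed.

Lemma is_derive_x x : is_derive x (1 : R) (fun y : R => y) 1.
Proof. exact: is_derive_id. Qed.

Lemma is_derive_comp f g x (a b : R) : is_derive (g x) (1 : R) f a ->
  is_derive x (1 : R) g b -> is_derive x (1 : R) (fun y => f (g y)) (a * b).
Proof. by move=> fa gb; exact: (is_derive1_comp fa gb). Qed.

Lemma is_derive_translate f h x (a : R) : is_derive (x + h) (1 : R) f a ->
  is_derive x (1 : R) (fun y => f (y + h)) a.
Proof.
move=> fa.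
have h1 : is_derive x (1 : R) (fun y => y + h) (1 + 0).
  exact (is_derive_add (is_derive_x x) (is_derive_c h x)).
refine (is_deriveE (@is_derive_comp f (fun y => y + h) x _ _ fa h1) _).
by rewrite addr0 mulr1.
Qed.

Lemma is_derive_reflect f x (a : R) : is_derive (- x) (1 : R) f a ->
  is_derive x (1 : R) (fun y => f (- y)) (- a).
Proof.
move=> fa; have h1 := is_derive_opp (is_derive_x x).
refine (is_deriveE (@is_derive_comp f (fun y => - y) x _ _ fa h1) _).
by rewrite mulrN1.
Qed.

Lemma is_derive_derivable f x (a : R) : is_derive x (1 : R) f a ->
  derivable f x 1.
Proof. by case. Qed.

Lemma is_derive_derive1 f x (a : R) : is_derive x (1 : R) f a -> derive1 f x = a.
Proof. by case=> _ <-; rewrite derive1E. Qed.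

Lemma derivable_is_derive f x : derivable f x 1 -> is_derive x (1 : R) f (derive1 f x).
Proof. by move=> df; split => //; rewrite derive1E. Qed.

Lemma is_derive_continuous f f' : (forall x, is_derive x (1 : R) f (f' x)) ->
  continuous f.
Proof.
by move=> df x; apply: differentiable_continuous; apply/derivable1_diffP; case: (df x).
Qed.

Lemma mean_value f f' (a b : R) : (forall x, is_derive x (1 : R) f (f' x)) ->
  a <= b -> exists2 c, a <= c <= b & f b - f a = f' c * (b - a).
Proof.
move=> df ab.
have [c] := @MVT_segment _ f f' a b ab (fun x _ => df x)
  (continuous_subspaceT (is_derive_continuous df)).
by rewrite in_itv/= => h e; exists c.
Qed.

Lemma lipschitz_of_derive f f' M : (forall x, is_derive x (1 : R) f (f' x)) ->
  (forall x, `|f' x| <= M) -> forall a b, `|f b - f a| <= M * `|b - a|.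
Proof.
move=> df fM a b; wlog ab : a b / a <= b => [H|].
  have [/H//|/ltW/H h] := leP a b.
  by rewrite distrC (distrC b).
have [c _ ->] := mean_value df ab.
by rewrite normrM ler_wpM2r.
Qed.

Lemma int_deriv f f' (a b : R) : (forall x, is_derive x (1 : R) f (f' x)) ->
  continuous f' -> a <= b ->
  \int[mu]_(x in `[a, b]) f' x = f b - f a.
Proof.
move=> df cf'; rewrite le_eqVlt => /predU1P[<-|ab].
  by rewrite set_itv1 Rintegral_set1 subrr.
have cf := is_derive_continuous df.
rewrite /Rintegral (@continuous_FTC2 _ f' f)//.
- exact: continuous_subspaceT.
- split.
  + by move=> x _; case: (df x).
  + by apply: cvg_at_right_filter; exact: cf.
  + by apply: cvg_at_left_filter; exact: cf.
- by move=> x _; exact: is_derive_derive1.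
Qed.

(** By evenness a primitive on the open half-line with a one-sided limit at 0 suffices, so [f] may
    depend on [|x|] although [|x|] has no derivative at 0. *)
Lemma L1_even f F l : continuous f -> (forall x, 0 <= f x) ->
  (forall x, f (- x) = f x) ->
  (forall x, 0 < x -> is_derive x (1 : R) F (f x)) ->
  F x @[x --> 0^'+] --> F 0 -> F x @[x --> +oo] --> l ->
  L1 f /\ \int[mu]_x f x = 2 * (l - F 0).
Proof.
move=> cf f0 fN dF cF Fl.
have E : (\int[mu]_x (f x)%:E = (2 * (l - F 0))%:E)%E.
  rewrite ge0_symfun_integralT//; last by move=> x /=; rewrite fN.
  have -> : [set x : R | 0 <= x] = `[0, +oo[%classic.
    by apply/seteqP; split => x /=; rewrite in_itv/= andbT.
  rewrite (@ge0_continuous_FTC2y _ f F 0 l)//.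
  - exact: continuous_subspaceT.
  - by move=> x x0; case: (dF x x0).
  - by move=> x; rewrite in_itv/= andbT => x0; apply: is_derive_derive1; exact: dF.
split; last by rewrite /Rintegral E.
by apply: L1_lty => //; [exact: cont_meas|rewrite E ltry].
Qed.

End calculus.

(** * Poisson kernel *)

Section kernels.
Context {R : realType}.
Notation mu := (@lebesgue_measure R).
Implicit Types (f g : R -> R) (k h x e z : R).

Lemma cvg_exp_bounded e f k : 0 < e -> (forall x, `|f x| <= k) ->
  (expR (- (e * x)) * f x) @[x --> +oo] --> (0 : R).
Proof.
move=> e0 fk; apply: norm_cvg0.
have h : (expR (- (e * x)) * k) @[x --> +oo] --> (0 : R).
  rewrite -[X in _ --> X](mul0r k); apply: cvgM; last exact: cvg_cst.
  apply: (cvg_comp (fun x => e * x) (fun x => expR (- x))); last exact: cvgr_expR.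
  by apply: gt0_cvgMry => //; exact: cvg_id.
apply: (squeeze_cvgr _ (cvg_cst 0) h); apply: nearW => x.
by rewrite normr_ge0/= normrM ger0_norm ?expR_ge0// ler_wpM2l// expR_ge0.
Qed.

Lemma cvg_at_right_cont f : continuous f -> f x @[x --> 0^'+] --> f 0.
Proof. by move=> cf; apply: cvg_at_right_filter; exact: cf. Qed.

Lemma cont_exp_abs e : continuous (fun x => expR (- (e * `|x|))).
Proof.
apply: cont_comp; last exact: continuous_expR.
by apply: cont_opp; apply: cont_mul; [exact: cont_cst|exact/cont_norm/cont_id].
Qed.

Lemma is_derive_exp_lin e x :
  is_derive x (1 : R) (fun y => expR (- (e * y))) (- e * expR (- (e * x))).
Proof.
have h := is_derive_comp (is_derive_expR _)
  (is_derive_opp (is_derive_scale e (is_derive_x x))).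
by refine (is_deriveE h _); ring.
Qed.

Lemma is_derive_cos_lin z x :
  is_derive x (1 : R) (fun y => cos (z * y)) (- z * sin (z * x)).
Proof.
have h := is_derive_comp (is_derive_cos _) (is_derive_scale z (is_derive_x x)).
by refine (is_deriveE h _); ring.
Qed.

Lemma is_derive_sin_lin z x :
  is_derive x (1 : R) (fun y => sin (z * y)) (z * cos (z * x)).
Proof.
have h := is_derive_comp (is_derive_sin _) (is_derive_scale z (is_derive_x x)).
by refine (is_deriveE h _); ring.
Qed.

Lemma int_exp_abs e : 0 < e ->
  L1 (fun x => expR (- (e * `|x|))) /\ \int[mu]_x expR (- (e * `|x|)) = 2 / e.
Proof.
move=> e0; pose F := fun x => expR (- (e * x)) * (- e^-1).
have dF x : is_derive x (1 : R) F (expR (- (e * x))).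
  have h := is_derive_mul (is_derive_exp_lin e x) (is_derive_c (- e^-1) x).
  by refine (is_deriveE h _); field; rewrite gt_eqF.
have [||||||Lf ->] := @L1_even _ (fun x => expR (- (e * `|x|))) F 0.
- exact: cont_exp_abs.
- by move=> x; exact: expR_ge0.
- by move=> x; rewrite normrN.
- by move=> x x0; rewrite gtr0_norm.
- by apply: cvg_at_right_cont; exact: is_derive_continuous dF.
- exact: (@cvg_exp_bounded e (fun _ => - e^-1) `|- e^-1|).
by split=> //; rewrite /F mulr0 oppr0 expR0; field; rewrite gt_eqF.
Qed.

Lemma int_exp_abs_cos e z : 0 < e ->
  L1 (fun x => expR (- (e * `|x|)) * cos (z * x)) /\
  \int[mu]_x (expR (- (e * `|x|)) * cos (z * x)) = 2 * e / (e ^+ 2 + z ^+ 2).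
Proof.
move=> e0.
have d0 : 0 < e ^+ 2 + z ^+ 2 by rewrite ltr_pwDl ?exprn_gt0 ?sqr_ge0.
(* [1 + cos] is integrated in place of [cos] to have the nonnegative integrand required by
   [L1_even]. The term [- e^-1] accounts for the added exponential, which is subtracted again at the
   end. *)
pose b := fun x => - e^-1 + (e ^+ 2 + z ^+ 2)^-1 * (z * sin (z * x) - e * cos (z * x)).
pose F := fun x => expR (- (e * x)) * b x.
have dF x : is_derive x (1 : R) F (expR (- (e * x)) * (1 + cos (z * x))).
  have h1 := is_derive_sub (is_derive_scale z (is_derive_sin_lin z x))
    (is_derive_scale e (is_derive_cos_lin z x)).
  have h := is_derive_mul (is_derive_exp_lin e x)
    (is_derive_add (is_derive_c (- e^-1) x) (is_derive_scale (e ^+ 2 + z ^+ 2)^-1 h1)).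
  by refine (is_deriveE h _); field; rewrite !gt_eqF.
have cc : continuous (fun x => cos (z * x)).
  exact: is_derive_continuous (is_derive_cos_lin z).
have [||||||Lf Ef] := @L1_even _ (fun x => expR (- (e * `|x|)) * (1 + cos (z * x))) F 0.
- by apply: cont_mul; [exact: cont_exp_abs|apply: cont_add => //; exact: cont_cst].
- by move=> x; rewrite mulr_ge0 ?expR_ge0// -lerBlDl sub0r cos_geN1.
- by move=> x; rewrite normrN mulrN cosN.
- by move=> x x0; rewrite gtr0_norm.
- by apply: cvg_at_right_cont; exact: is_derive_continuous dF.
- apply: (@cvg_exp_bounded e b (`|- e^-1| + `|(e ^+ 2 + z ^+ 2)^-1| * (`|z| + `|e|))) => // x.
  rewrite (le_trans (ler_normD _ _))// lerD2l normrM ler_wpM2l//.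
  rewrite (le_trans (ler_normB _ _))// lerD// normrM ler_piMr//.
    by rewrite ler_norml sin_geN1 sin_le1.
  by rewrite ler_norml cos_geN1 cos_le1.
have [Le Ee] := int_exp_abs e0.
have E x : expR (- (e * `|x|)) * cos (z * x) =
    expR (- (e * `|x|)) * (1 + cos (z * x)) - expR (- (e * `|x|)) by ring.
have -> : (fun x => expR (- (e * `|x|)) * cos (z * x)) =
  (fun x => expR (- (e * `|x|)) * (1 + cos (z * x)) - expR (- (e * `|x|))).
  exact/funext.
split; first exact: L1B.
rewrite int_sub// Ef Ee /F /b !mulr0 oppr0 sin0 cos0 expR0; field.
by rewrite !gt_eqF.
Qed.

Lemma int_exp_abs_sin e z : 0 < e ->
  L1 (fun x => expR (- (e * `|x|)) * sin (z * x)) /\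
  \int[mu]_x (expR (- (e * `|x|)) * sin (z * x)) = 0.
Proof.
move=> e0; have [Le _] := int_exp_abs e0.
have cs : continuous (fun x => sin (z * x)).
  exact: is_derive_continuous (is_derive_sin_lin z).
have L : L1 (fun x => expR (- (e * `|x|)) * sin (z * x)).
  apply: L1_le Le _; first by apply: cont_meas; apply: cont_mul; [exact: cont_exp_abs|exact: cs].
  move=> x; rewrite normrM ger0_norm ?expR_ge0// ler_piMr ?expR_ge0//.
  by rewrite ler_norml sin_geN1 sin_le1.
split => //.
have := int_opp L.
have -> : (fun x => expR (- (e * `|- x|)) * sin (z * - x)) =
  (fun x => - (expR (- (e * `|x|)) * sin (z * x))).
  by apply/funext => x; rewrite normrN mulrN sinN mulrN.
by rewrite int_neg//; set I := Rintegral _ _ _ => h; lra.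
Qed.

Lemma cont_poisson e : 0 < e -> continuous (fun z => e / (e ^+ 2 + z ^+ 2)).
Proof.
move=> e0; apply: cont_mul; first exact: cont_cst.
apply: cont_inv.
  by apply: cont_add; [exact: cont_cst|exact/cont_sqr/cont_id].
by move=> x; rewrite gt_eqF// ltr_pwDl ?exprn_gt0 ?sqr_ge0.
Qed.

Lemma int_poisson e : 0 < e ->
  L1 (fun z => e / (e ^+ 2 + z ^+ 2)) /\
  \int[mu]_z (e / (e ^+ 2 + z ^+ 2)) = pi.
Proof.
move=> e0.
have d0 z : 0 < e ^+ 2 + z ^+ 2 by rewrite ltr_pwDl ?exprn_gt0 ?sqr_ge0.
have dF x : is_derive x (1 : R) (fun z => atan (e^-1 * z)) (e / (e ^+ 2 + x ^+ 2)).
  have h := is_derive_comp (is_derive1_atan _) (is_derive_scale e^-1 (is_derive_x x)).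
  refine (is_deriveE h _); field.
  by rewrite !gt_eqF//= ltr_pwDr ?exprn_gt0 ?sqr_ge0.
have [||||Lf ->] := @L1_even _ _ (fun z => atan (e^-1 * z)) (pi / 2) (cont_poisson e0).
- by move=> x; rewrite divr_ge0// ltW.
- by move=> x; rewrite sqrrN.
- by apply: cvg_at_right_cont; exact: is_derive_continuous dF.
- apply: (cvg_comp (fun x => e^-1 * x) atan); last exact: cvgy_atan.
  by apply: gt0_cvgMry; [rewrite invr_gt0|exact: cvg_id].
by split=> //; rewrite mulr0 atan0; field.
Qed.

(** Comparison with [(1 + |x|) ^ (- 2 s)], written with [expR] and [ln]. Its primitive on the
    half-line is a multiple of [(1 + x) ^ (1 - 2 s)], which tends to 0 because [2 * s > 1]. *)
Lemma L1_weight (s : R) : 1 / 2 < s -> L1 (fun x : R => (1 + x ^+ 2) `^ (- s)).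
Proof.
move=> s2; pose r := 2 * s - 1; have r0 : 0 < r by rewrite /r; lra.
pose f := fun x : R => expR (- (2 * s * ln (1 + `|x|))).
pose F : R -> R := fun x : R => - r^-1 * expR (- (r * ln (1 + x))).
have p0 x : 0 < 1 + `|x| by rewrite ltr_pwDl.
have cl : continuous (fun x : R => ln (1 + `|x|)).
  have c1 : continuous (fun x : R => 1 + `|x|).
    by apply: cont_add; [exact: cont_cst|exact/cont_norm/cont_id].
  move=> x; exact (@continuous_comp _ _ _ (fun x : R => 1 + `|x|) (@ln R) x
    (c1 x) (continuous_ln (p0 x))).
have ce a : continuous (fun x : R => expR (- (a * ln (1 + `|x|)))).
  apply: cont_comp; last exact: continuous_expR.
  by apply: cont_opp; apply: cont_mul => //; exact: cont_cst.
have [||||||Lf _] := @L1_even _ f F 0.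
- exact: ce.
- by move=> x; exact: expR_ge0.
- by move=> x; rewrite /f normrN.
- move=> x x0; have x1 : 0 < 1 + x by lra.
  have h1 : is_derive x (1 : R) (fun y : R => ln (1 + y)) ((1 + x)^-1 * (0 + 1)).
    exact (@is_derive_comp _ (@ln R) (fun y => 1 + y) x _ _ (is_derive1_ln x1)
      (is_derive_add (is_derive_c 1 x) (is_derive_x x))).
  have h := is_derive_scale (- r^-1) (is_derive_comp (is_derive_expR _)
     (is_derive_opp (is_derive_scale r h1))).
  refine (is_deriveE h _); rewrite /f gtr0_norm//.
  have -> : - (2 * s * ln (1 + x)) = - (r * ln (1 + x)) + - ln (1 + x).
    by rewrite /r; ring.
  rewrite expRD [expR (- ln _)]expRN lnK ?posrE//; field.
  by rewrite !gt_eqF.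
- rewrite /F; apply: (@cvg_at_right_filter _ _ F).
  apply: cvgM; first exact: cvg_cst.
  have c1 : continuous (fun x : R => 1 + x).
    by apply: cont_add; [exact: cont_cst|exact: cont_id].
  have c2 : {for (0 : R), continuous (fun x : R => ln (1 + x))}.
    have h1 : (0 : R) < 1 + 0 by rewrite addr0.
    exact (@continuous_comp _ _ _ (fun x : R => 1 + x) (@ln R) 0 (c1 0)
      (continuous_ln h1)).
  have c3 : {for (0 : R), continuous (fun x : R => - (r * ln (1 + x)))}.
    by apply: cvgN; apply: cvgM; [exact: cvg_cst|exact: c2].
  exact (@continuous_comp _ _ _ (fun x : R => - (r * ln (1 + x))) (@expR R) 0 c3
      (@continuous_expR R _)).
- rewrite /F -[X in _ --> X](mulr0 (- r^-1)); apply: cvgM; first exact: cvg_cst.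
  apply: (cvg_comp (fun x : R => r * ln (1 + x)) (fun x => expR (- x)));
    last exact: cvgr_expR.
  apply: gt0_cvgMry => //.
  apply/cvgryPge => A; near=> x.
  rewrite -(expRK A) ler_ln ?posrE ?expR_gt0//.
    by rewrite -lerBlDl; near: x; apply: nbhs_pinfty_ge; rewrite num_real.
  by rewrite ltr_pwDl//; near: x; apply: nbhs_pinfty_ge; rewrite num_real.
have mw : measurable_fun [set: R] (fun x : R => (1 + x ^+ 2) `^ (- s)).
  apply: (measurableT_comp (measurable_powR (- s))).
  by apply: cont_meas; apply: cont_add; [exact: cont_cst|exact/cont_sqr/cont_id].
apply: (L1_le mw (L1Z (expR (s * ln 2)) Lf)) => x.
have q0 : 0 < 1 + x ^+ 2 by rewrite ltr_pwDl ?sqr_ge0.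
rewrite ger0_norm ?powR_ge0// /powR (gt_eqF q0) /f -expRD ler_expR.
(* The logarithm of [(1 + |x|)^2 <= 2 (1 + x^2)]; hence the factor [expR (s * ln 2)]. *)
have : 2 * ln (1 + `|x|) <= ln 2 + ln (1 + x ^+ 2).
  rewrite mulr_natl -lnXn// -lnM ?posrE// ler_ln ?posrE ?exprn_gt0 ?mulr_gt0//.
  by rewrite -[x ^+ 2]real_normK ?num_real//; have := sqr_ge0 (1 - `|x|); nra.
by move=> h; nra.
Unshelve. all: by end_near.
Qed.

End kernels.

(** * Integrability against trigonometric factors and the Poisson approximate identity *)

Section fourier.
Context {R : realType}.
Notation mu := (@lebesgue_measure R).
Implicit Types (f g A B a b : R -> R) (k h x e z : R).

Lemma meas_mul_comp (w : R -> R) : continuous w ->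
  measurable_fun setT (fun z : R * R => w (z.1 * z.2)).
Proof.
move=> cw; apply: (measurableT_comp (cont_meas cw)).
by apply: measurable_funM.
Qed.

Lemma meas_sub_comp (w : R -> R) : continuous w ->
  measurable_fun setT (fun z : R * R => w (z.1 - z.2)).
Proof.
move=> cw; apply: (measurableT_comp (cont_meas cw)).
by apply: measurable_funB.
Qed.

Lemma meas_add_comp (w : R -> R) : continuous w ->
  measurable_fun setT (fun z : R * R => w (z.1 + z.2)).
Proof.
move=> cw; apply: (measurableT_comp (cont_meas cw)).
by apply: measurable_funD.
Qed.

Lemma norm_cos_le1 x : `|cos x| <= 1.
Proof. by rewrite ler_norml cos_geN1 cos_le1. Qed.

Lemma norm_sin_le1 x : `|sin x| <= 1.
Proof. by rewrite ler_norml sin_geN1 sin_le1. Qed.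

Lemma L1_mul_bounded f g k : L1 f -> measurable_fun setT g ->
  (forall x, `|g x| <= k) -> L1 (fun x => f x * g x).
Proof.
move=> Lf mg gk; apply: (@L1_le _ _ (fun x => k * `|f x|)).
- by apply: measurable_funM => //; exact: L1_measurable.
- by apply/L1Z/L1_norm.
- by move=> x; rewrite normrM mulrC ler_wpM2r.
Qed.

Lemma cont_cos_lin k : continuous (fun x => cos (k * x)).
Proof. exact: is_derive_continuous (is_derive_cos_lin k). Qed.

Lemma cont_sin_lin k : continuous (fun x => sin (k * x)).
Proof. exact: is_derive_continuous (is_derive_sin_lin k). Qed.

Lemma L1_cos f k : L1 f -> L1 (fun x => f x * cos (k * x)).
Proof.
move=> Lf; apply: (@L1_mul_bounded f (fun x => cos (k * x)) 1) => //.
  exact: (cont_meas (@cont_cos_lin k)).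
by move=> x; exact: norm_cos_le1.
Qed.

Lemma L1_sin f k : L1 f -> L1 (fun x => f x * sin (k * x)).
Proof.
move=> Lf; apply: (@L1_mul_bounded f (fun x => sin (k * x)) 1) => //.
  exact: (cont_meas (@cont_sin_lin k)).
by move=> x; exact: norm_sin_le1.
Qed.

Lemma L1_mul_sqr f g : measurable_fun setT f -> measurable_fun setT g ->
  L1 (fun x => f x ^+ 2) -> L1 (fun x => g x ^+ 2) -> L1 (fun x => f x * g x).
Proof.
move=> mf mg Lf Lg; apply: L1_le (L1D Lf Lg) _; first exact: measurable_funM.
move=> x; rewrite normrM; have := sqr_ge0 (`|f x| - `|g x|).
rewrite -(real_normK (num_real (f x))) -(real_normK (num_real (g x))).
have := mulr_ge0 (normr_ge0 (f x)) (normr_ge0 (g x)).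
by nra.
Qed.

(** The kernel has mass [pi] and concentrates at 0. Near 0, continuity of [f] at [x] is used; for
    [|z| >= d] the kernel is at most [e (1 + d^-2) / (1 + z^2)], and [1 / (1 + z^2)] is square
    integrable, so the far part is of order [e] although [f] is not assumed bounded. *)
Lemma poisson_approx f x : continuous f -> L1 (fun y => f y ^+ 2) ->
  forall eta : R, 0 < eta -> exists2 e0 : R, 0 < e0 & forall e, 0 < e -> e < e0 ->
  L1 (fun z => f (z + x) * (e / (e ^+ 2 + z ^+ 2))) /\
  `|\int[mu]_z (f (z + x) * (e / (e ^+ 2 + z ^+ 2))) - pi * f x| <= eta.
Proof.
move=> cf Lf eta eta0.
have pi0 := @pi_gt0 R.
(* Against the mass [pi] of the kernel this contributes [eta / 2]. *)
pose eta' := eta / (2 * pi).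
have eta'0 : 0 < eta' by rewrite divr_gt0// mulr_gt0.
have /cvgrPdist_lt /(_ _ eta'0) := cf x.
move=> /nbhs_ballP[d /= d0 fd].
have p1 := int_poisson (@ltr01 R).
have c1 : continuous (fun z => (1 + z ^+ 2)^-1 : R).
  have -> : (fun z => (1 + z ^+ 2)^-1 : R) = (fun z => 1 / (1 ^+ 2 + z ^+ 2)).
    by apply/funext => z; rewrite expr1n mul1r.
  exact: cont_poisson.
have Lq : L1 (fun z => (1 + z ^+ 2)^-1 : R).
  apply: L1_eq (proj1 p1) => z.
  by rewrite expr1n mul1r.
have q0 (z : R) : 0 < (1 + z ^+ 2)^-1 by rewrite invr_gt0 ltr_pwDl ?sqr_ge0.
have q1 (z : R) : `|(1 + z ^+ 2)^-1| <= 1.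
  by rewrite gtr0_norm// invf_le1 ?ltr_pwDl ?sqr_ge0// lerDl sqr_ge0.
have Lq2 : L1 (fun z => (1 + z ^+ 2)^-1 ^+ 2 : R).
  have := @L1_mul_bounded _ _ 1 Lq (cont_meas c1) q1.
  by apply: L1_eq => z; rewrite expr2.
have cfx : continuous (fun z => f (z + x)) by exact: cont_shift.
pose K := fun z => (`|f (z + x)| + `|f x|) * (1 + z ^+ 2)^-1.
have LK : L1 K.
  apply: (@L1_eq _ (fun z => `|f (z + x)| * (1 + z ^+ 2)^-1 + `|f x| * (1 + z ^+ 2)^-1)).
    by move=> z; rewrite /K mulrDl.
  apply: L1D; last exact: L1Z.
  apply: L1_mul_sqr => //; [exact: (cont_meas (cont_norm cfx))|exact: cont_meas|].
  have := L1_shift x Lf; apply: L1_eq => z; rewrite real_normK//.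
  exact: num_real.
pose C := (1 + d ^- 2) * \int[mu]_z K z.
have C0 : 0 <= C.
  rewrite mulr_ge0 ?addr_ge0 ?invr_ge0 ?exprn_ge0//; first exact: ltW.
  by apply: int_ge0 => z; rewrite mulr_ge0 ?addr_ge0// ltW.
(* The far part is at most [e * C], hence at most [eta / 2]; [C + 1] avoids a division by 0. *)
exists (eta / (2 * (C + 1))); first by rewrite divr_gt0// mulr_gt0// ltr_wpDl.
move=> e e0 ee.
have [LP EP] := int_poisson e0.
have LfP : L1 (fun z => f (z + x) * (e / (e ^+ 2 + z ^+ 2))).
  (* A crude majorant of the kernel by [max e e^-1 / (1 + z^2)], valid for all [z]: it serves
     integrability only. *)
  apply: (L1_le _ (L1Z (Num.max e e^-1) LK)).
    by apply: cont_meas; apply: cont_mul => //; exact: cont_poisson.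
  move=> z.
  have P0 : 0 <= e / (e ^+ 2 + z ^+ 2).
    by rewrite divr_ge0 ?addr_ge0 ?sqr_ge0// ltW.
  rewrite normrM [X in _ * X]ger0_norm//.
  have a1 : e / (e ^+ 2 + z ^+ 2) <= Num.max e e^-1 * (1 + z ^+ 2)^-1.
    rewrite ler_pdivrMr ?ltr_pwDl ?exprn_gt0 ?sqr_ge0// mulrAC.
    rewrite ler_pdivlMr ?ltr_pwDl ?sqr_ge0//.
    have m1 : e <= Num.max e e^-1 by rewrite le_max lexx.
    have m2 : 1 <= Num.max e e^-1 * e.
      by rewrite -ler_pdivrMr// mul1r le_max lexx orbT.
    have := sqr_ge0 z; set m := Num.max e e^-1 in m1 m2 *.
    by nra.
  have -> : Num.max e e^-1 * K z =
      (`|f (z + x)| + `|f x|) * (Num.max e e^-1 * (1 + z ^+ 2)^-1).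
    by rewrite /K; ring.
  by apply: ler_pM => //; rewrite lerDl.
split=> //.
have -> : \int[mu]_z (f (z + x) * (e / (e ^+ 2 + z ^+ 2))) - pi * f x =
    \int[mu]_z (f (z + x) * (e / (e ^+ 2 + z ^+ 2)) - f x * (e / (e ^+ 2 + z ^+ 2))).
  by rewrite int_sub//; [rewrite (int_scale _ LP) EP mulrC|exact: L1Z].
have -> : eta = eta / 2 + eta / 2 by field.
have h1 : \int[mu]_z (eta' * (e / (e ^+ 2 + z ^+ 2)) + e * (1 + d ^- 2) * K z) <=
   eta / 2 + eta / 2.
  rewrite int_add; [|exact: L1Z|exact: L1Z].
  rewrite (int_scale eta' LP) EP (int_scale _ LK); apply: lerD.
    have -> // : eta' * pi = eta / 2.
    rewrite /eta'; move: (@pi R) pi0 => p p0; field.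
    by rewrite gt_eqF.
  have -> : e * (1 + d ^- 2) * \int[mu]_z K z = e * C by rewrite /C; ring.
  move: ee; rewrite ltr_pdivlMr ?mulr_gt0 ?ltr_wpDl// => ee.
  by have := mulr_ge0 (ltW e0) C0; nra.
apply: le_trans h1; apply: norm_int_le.
- by apply: L1B => //; exact: L1Z.
- by apply: L1D; apply: L1Z.
move=> z; rewrite -mulrBl normrM [X in _ * X]ger0_norm; last first.
  by rewrite divr_ge0 ?addr_ge0 ?sqr_ge0// ltW.
have P0 : 0 <= e / (e ^+ 2 + z ^+ 2).
  by rewrite divr_ge0 ?addr_ge0 ?sqr_ge0// ltW.
have [zd|dz] := ltP `|z| d.
  apply: ler_wpDr.
    have K0 : 0 <= K z by rewrite /K mulr_ge0 ?addr_ge0// ltW.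
    have D0 : 0 < 1 + d ^- 2 by rewrite addr_gt0 ?invr_gt0 ?exprn_gt0.
    by apply: mulr_ge0 => //; rewrite ltW// mulr_gt0.
  apply: ler_wpM2r => //; rewrite distrC ltW//; apply: fd.
  by rewrite /ball/= opprD addrA addrAC subrr add0r normrN.
apply: ler_wpDl; first by rewrite mulr_ge0// ltW.
have -> : e * (1 + d ^- 2) * K z =
      (`|f (z + x)| + `|f x|) * (e * (1 + d ^- 2) * (1 + z ^+ 2)^-1).
  by rewrite /K; ring.
apply: ler_pM => //; first by rewrite (le_trans (ler_normB _ _)).
  have z2 : d ^+ 2 <= z ^+ 2.
    by rewrite -[z ^+ 2]real_normK ?num_real// lerXn2r ?nnegrE// ltW.
  have d2 : 0 < d ^+ 2 by rewrite exprn_gt0.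
have h : 1 + z ^+ 2 <= (1 + d ^- 2) * (e ^+ 2 + z ^+ 2).
  have : 1 <= z ^+ 2 * d ^- 2 by rewrite ler_pdivlMr// mul1r.
  by have := sqr_ge0 e; have : 0 < d ^- 2 by [rewrite invr_gt0]; nra.
rewrite ler_pdivrMr ?ltr_pwDl ?exprn_gt0 ?sqr_ge0// mulrAC.
by rewrite ler_pdivlMr ?ltr_pwDl ?sqr_ge0// -mulrA ler_pM2l.
Qed.

Lemma L1_trunc_itv f x h : continuous f -> L1 (f \_ `[x, h]).
Proof.
move=> cf; have hi : mu.-integrable `[x, h] (EFin \o f).
  apply: continuous_compact_integrable; first exact: segment_compact.
  exact: continuous_subspaceT.
have mi : measurable (`[x, h]%classic : set (measurableTypeR R)).
  exact: measurable_itv.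
by have /(_ mi) := (integrable_mkcond _ _).1 hi; rewrite restrict_EFin.
Qed.

End fourier.

(** * Fourier inversion *)

Section inversion.
Context {R : realType}.
Notation mu := (@lebesgue_measure R).
Implicit Types (f g A B a b : R -> R) (k h x e z : R).

Let c : R := (Num.sqrt (2 * pi))^-1.

Lemma fourier_const_sqr : (Num.sqrt (2 * pi))^-1 ^+ 2 * (2 * pi) = 1 :> R.
Proof.
have p0 : 0 < 2 * pi :> R by rewrite mulr_gt0 ?pi_gt0.
by rewrite exprVn sqr_sqrtr ?ltW// mulVf ?gt_eqF.
Qed.

Lemma L1_trunc f (N : nat) : continuous f ->
  L1 (f \_ `[- N%:R, N%:R]).
Proof. exact: L1_trunc_itv. Qed.

Lemma fourier_trunc_reE f N x :
  fourier_trunc_re f N x = c * \int[mu]_y ((f \_ `[- N%:R, N%:R]) y * cos (x * y)).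
Proof.
rewrite /fourier_trunc_re Rintegral_mkcond; congr (_ * _); apply: eq_int => y.
by rewrite !patchE; case: ifP => // _; rewrite ?mul0r// [y * x]mulrC.
Qed.

Lemma fourier_trunc_imE f N x :
  fourier_trunc_im f N x =
  - (c * \int[mu]_y ((f \_ `[- N%:R, N%:R]) y * sin (x * y))).
Proof.
rewrite /fourier_trunc_im Rintegral_mkcond; congr (- (_ * _)); apply: eq_int => y.
by rewrite !patchE; case: ifP => // _; rewrite ?mul0r// [y * x]mulrC.
Qed.

(** Measurability comes from Fubini: multiplied by [exp (- |x|)] the kernel becomes integrable on
    the plane, and the factor is divided out afterwards. *)
Lemma meas_fourier (w f : R -> R) : continuous w -> (forall x, `|w x| <= 1) ->
  L1 f -> measurable_fun setT (fun x => \int[mu]_y (f y * w (x * y))).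
Proof.
move=> cw w1 Lf.
have [Le _] := int_exp_abs (@ltr01 R).
have [H _ _] := @Fubini_kernel R _ _ _ 1 Le Lf (meas_mul_comp cw) (fun z : R * R => w1 (z.1 * z.2)%R).
have -> : (fun x => \int[mu]_y (f y * w (x * y))) =
  (fun x => expR (1 * `|x|) *
    \int[mu]_y (expR (- (1 * `|x|)) * f y * w (x * y))).
  apply/funext => x; rewrite -[in RHS]int_scale; last first.
    apply: (@L1_eq _ (fun y => expR (- (1 * `|x|)) * (f y * w (x * y)))).
      by move=> y; rewrite mulrA.
    apply: L1Z; apply: (@L1_mul_bounded _ f (fun y => w (x * y)) 1) => //.
    apply: cont_meas; apply: cont_comp => //; apply: cont_mul; last exact: cont_id.
    exact: cont_cst.
  by apply: eq_int => y; rewrite !mulrA -expRD subrr expR0 mul1r.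
apply: measurable_funM; last exact: (L1_measurable H).
apply: cont_meas; apply: cont_comp; last exact: continuous_expR.
by apply: cont_mul; [exact: cont_cst|apply: cont_norm; exact: cont_id].
Qed.

(** After exchanging the integrals the trigonometric factors combine into [cos ((x - z) * y)], whose
    damped integral in [y] is a Poisson kernel. Truncation makes [f] integrable, so that Fubini
    applies. *)
Lemma fourier_damped f N x e : 0 < e -> continuous f ->
  L1 (fun y => expR (- (e * `|y|)) * (fourier_trunc_re f N y * cos (x * y) -
      fourier_trunc_im f N y * sin (x * y))) /\
  \int[mu]_y (expR (- (e * `|y|)) * (fourier_trunc_re f N y * cos (x * y) -
      fourier_trunc_im f N y * sin (x * y))) =
  c * \int[mu]_y ((f \_ `[- N%:R, N%:R]) y * (2 * e / (e ^+ 2 + (x - y) ^+ 2))).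
Proof.
move=> e0 cf; set phi := (f \_ _).
have Lphi : L1 phi by exact: L1_trunc.
have [Le _] := int_exp_abs e0.
pose k := fun z : R * R => cos ((x - z.2) * z.1).
have mk : measurable_fun setT k.
  apply: (measurableT_comp (cont_meas (@continuous_cos R))).
  by apply: measurable_funM => //; apply: measurable_funB.
have [H1 _ H2] := @Fubini_kernel R _ _ _ 1 Le Lphi mk (fun z : R * R => norm_cos_le1 _).
have E y : expR (- (e * `|y|)) * (fourier_trunc_re f N y * cos (x * y) -
      fourier_trunc_im f N y * sin (x * y)) =
   c * \int[mu]_z (expR (- (e * `|y|)) * phi z * k (y, z)).
  rewrite fourier_trunc_reE fourier_trunc_imE -/phi /k/=.
  have -> : (fun z => expR (- (e * `|y|)) * phi z * cos ((x - z) * y)) =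
     (fun z => expR (- (e * `|y|)) * (cos (x * y) * (phi z * cos (y * z)) +
         sin (x * y) * (phi z * sin (y * z)))).
    apply/funext => z; rewrite mulrBl cosB [z * y]mulrC; ring.
  rewrite int_scale; last by apply: L1D; apply: L1Z; [exact: L1_cos|exact: L1_sin].
  rewrite int_add; [|by apply: L1Z; exact: L1_cos|by apply: L1Z; exact: L1_sin].
  rewrite int_scale; last exact: L1_cos.
  rewrite int_scale; last exact: L1_sin.
  by ring.
split.
  by apply: (@L1_eq _ (fun y => c * \int[mu]_z (expR (- (e * `|y|)) * phi z * k (y, z))));
    [move=> y; rewrite E|exact: L1Z].
rewrite (eq_int E) int_scale// H2; congr (_ * _); apply: eq_int => y.
have [Lc Ec] := int_exp_abs_cos (x - y) e0.
rewrite -Ec -int_scale//; apply: eq_int => z; rewrite /k/=; ring.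
Qed.

(** The limit of [fourier_damped] as the truncation is removed. On the left the transforms converge
    in L^2 and are tested against the damping factor, itself in L^2; on the right dominated
    convergence applies, as [f] and the Poisson kernel are both in L^2. *)
Lemma fourier_poisson f a b x e : 0 < e -> continuous f ->
  is_fourier f a b -> L1 (fun y => f y ^+ 2) -> L1 a -> L1 b ->
  \int[mu]_y (expR (- (e * `|y|)) * (a y * cos (x * y) - b y * sin (x * y))) =
  2 * c * \int[mu]_z (f (z + x) * (e / (e ^+ 2 + z ^+ 2))).
Proof.
move=> e0 cf [_ ma mb cv] Lf2 La Lb.
pose w : R -> R := fun y => expR (- (e * `|y|)).
have w0 y : 0 <= w y by exact: expR_ge0.
have w1 y : `|w y| <= 1.
  by rewrite ger0_norm// expR_le1 oppr_le0 mulr_ge0// ltW.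
have [Lw _] := int_exp_abs e0.
have Lw2 : L1 (fun y => w y ^+ 2).
  have := L1_mul_bounded Lw (L1_measurable Lw) w1.
  by apply: L1_eq => y; rewrite expr2.
pose W := \int[mu]_y (w y ^+ 2).
have W0 : 0 <= W by apply: int_ge0 => y; exact: sqr_ge0.
have LT : L1 (fun y => w y * (a y * cos (x * y) - b y * sin (x * y))).
  apply: (@L1_eq _ (fun y => (a y * cos (x * y) - b y * sin (x * y)) * w y)).
    by move=> y; rewrite mulrC.
  apply: (L1_mul_bounded _ (L1_measurable Lw) w1).
  by apply: L1B; [exact: L1_cos|exact: L1_sin].
pose re := fourier_trunc_re f; pose im := fourier_trunc_im f.
have mre N : measurable_fun setT (re N).
  have -> : re N = (fun y => c * \int[mu]_z ((f \_ `[- N%:R, N%:R]) z * cos (y * z))).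
    by apply/funext => y; exact: fourier_trunc_reE.
  apply: measurable_funM => //; apply: meas_fourier.
  - exact: continuous_cos.
  - by move=> y; exact: norm_cos_le1.
  - exact: L1_trunc.
have mim N : measurable_fun setT (im N).
  have -> : im N = (fun y => - (c * \int[mu]_z ((f \_ `[- N%:R, N%:R]) z * sin (y * z)))).
    by apply/funext => y; exact: fourier_trunc_imE.
  apply: measurable_funN; apply: measurable_funM => //; apply: meas_fourier.
  - exact: continuous_sin.
  - by move=> y; exact: norm_sin_le1.
  - exact: L1_trunc.
pose q N (y : R) : R := (re N y - a y) ^+ 2 + (im N y - b y) ^+ 2.
have mq N : measurable_fun setT (q N).
  by apply: measurable_funD; apply: measurable_funX; apply: measurable_funB.
have q0 N y : 0 <= q N y by rewrite addr_ge0 ?sqr_ge0.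
pose L N := \int[mu]_y (w y * (re N y * cos (x * y) - im N y * sin (x * y))).
have LE N := fourier_damped N x e0 cf.
have cvL : L N @[N --> \oo] -->
    \int[mu]_y (w y * (a y * cos (x * y) - b y * sin (x * y))).
  apply/cvgrPdist_le => d d0.
  (* Young's inequality bounds the integrand by [eta * w ^+ 2 + (2 * eta)^-1 * q N]. The first term
     integrates to at most [d / 2]; the second does once the integral of [q N] is below
     [d * eta]. *)
  have [eta eta0 e1] : exists2 eta : R, 0 < eta & eta * (2 * (W + 1)) = d.
    exists (d / (2 * (W + 1))); first by rewrite divr_gt0// mulr_gt0// ltr_wpDl.
    by rewrite divfK// gt_eqF// mulr_gt0// ltr_wpDl.
  have de0 : (0 < (d * eta)%:E)%E by rewrite lte_fin mulr_gt0.
  have : \forall N \near \oo, (\int[mu]_y (q N y)%:E < (d * eta)%:E)%E.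
    move: cv => /fine_cvgP[h1 h2].
    near=> N.
    have f1 : (\int[mu]_y (q N y)%:E)%E \is a fin_num by near: N; exact: h1.
    rewrite -(fineK f1) lte_fin.
    have : `|0 - fine (\int[mu]_y (q N y)%:E)%E| < d * eta.
      by near: N; move/cvgrPdist_lt : h2; apply; rewrite mulr_gt0.
    by rewrite sub0r normrN; exact: le_lt_trans (ler_norm _).
  apply: filterS => N qN.
  have Lq : L1 (q N) by apply: L1_lty => //; exact: lt_trans qN (ltry _).
  have Iq : \int[mu]_y q N y < d * eta by rewrite -lte_fin EFin_int.
  have [LN _] := LE N.
  rewrite distrC /L -int_sub//.
  have h : \int[mu]_y (eta * w y ^+ 2 + (2 * eta)^-1 * q N y) <= d.
    rewrite int_add; [|exact: L1Z|exact: L1Z].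
    rewrite (int_scale _ Lw2) (int_scale _ Lq) -/W.
    have h1 : eta * W <= d / 2.
      by nra.
    have h2 : (2 * eta)^-1 * \int[mu]_y q N y <= d / 2.
      rewrite mulrC ler_pdivrMr ?mulr_gt0//.
      by have -> : d / 2 * (2 * eta) = d * eta by [field]; rewrite ltW.
    by rewrite [leRHS](_ : d = d / 2 + d / 2); [exact: lerD|field].
  apply: le_trans h; apply: norm_int_le.
  - exact: L1B.
  - by apply: L1D; exact: L1Z.
  move=> y; rewrite -mulrBr normrM (ger0_norm (w0 y)).
  set p1 := re N y - a y; set p2 := im N y - b y.
  have -> : re N y * cos (x * y) - im N y * sin (x * y) -
     (a y * cos (x * y) - b y * sin (x * y)) = p1 * cos (x * y) - p2 * sin (x * y).
    by rewrite /p1 /p2; ring.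
  have h1 : `|p1 * cos (x * y) - p2 * sin (x * y)| <= `|p1| + `|p2|.
    rewrite (le_trans (ler_normB _ _))// lerD// normrM ler_piMr//.
      exact: norm_cos_le1.
    exact: norm_sin_le1.
  apply: (le_trans (ler_wpM2l (w0 y) h1)).
  rewrite /q -/p1 -/p2 -(real_normK (num_real p1)) -(real_normK (num_real p2)).
  have -> : eta * w y ^+ 2 + (2 * eta)^-1 * (`|p1| ^+ 2 + `|p2| ^+ 2) =
     (2 * eta)^-1 * (2 * eta ^+ 2 * w y ^+ 2 + `|p1| ^+ 2 + `|p2| ^+ 2).
    by field; rewrite gt_eqF.
  rewrite mulrC ler_pdivlMl ?mulr_gt0//.
  by have := sqr_ge0 (eta * w y - `|p1|); have := sqr_ge0 (eta * w y - `|p2|); nra.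
pose p (y : R) : R := 2 * e / (e ^+ 2 + (x - y) ^+ 2).
have pE y : p y = 2 * (e / (e ^+ 2 + (y - x) ^+ 2)).
  by rewrite /p -mulrA -[(x - y) ^+ 2]sqrrN opprB.
have cp : continuous p.
  have -> : p = fun y => 2 * (e / (e ^+ 2 + (y - x) ^+ 2)) by apply/funext.
  apply: cont_mul; first exact: cont_cst.
  exact (@cont_shift _ _ (- x) (cont_poisson e0)).
have [LP _] := int_poisson e0.
have p2 : L1 (fun y => p y ^+ 2).
  have b1 (z : R) : `|e / (e ^+ 2 + z ^+ 2)| <= e^-1.
    rewrite ger0_norm; last by rewrite divr_ge0 ?addr_ge0 ?sqr_ge0// ltW.
    rewrite ler_pdivrMr ?ltr_pwDl ?exprn_gt0 ?sqr_ge0//.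
    by rewrite mulrDr expr2 mulKf ?gt_eqF// lerDl mulr_ge0 ?sqr_ge0// invr_ge0 ltW.
  have h := L1_shift (- x) (L1_mul_bounded LP (cont_meas (cont_poisson e0)) b1).
  by apply: L1_eq (L1Z 4 h) => y /=; rewrite pE; ring.
have Lfp : L1 (fun y => f y * p y).
  by apply: L1_mul_sqr => //; exact: cont_meas.
have cvR : L N @[N --> \oo] --> c * \int[mu]_y (f y * (2 * e / (e ^+ 2 + (x - y) ^+ 2))).
  rewrite (_ : L = fun N => c * \int[mu]_y ((f \_ `[- N%:R, N%:R]) y *
      (2 * e / (e ^+ 2 + (x - y) ^+ 2)))); last first.
    by apply/funext => N; have [_] := LE N.
  apply: cvgM; first exact: cvg_cst.
  apply: (proj2 (@int_cvg _ _ _ _ _ _ _ (L1_norm Lfp) _)).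
  - move=> N; apply: measurable_funM; last exact: cont_meas.
    by apply: L1_measurable; exact: L1_trunc.
  - exact: L1_measurable.
  - move=> y; apply: cvg_near_cst; near=> N.
    rewrite patchE ifT// inE/= in_itv/= -ler_norml.
    by near: N; exact: nbhs_infty_ger.
  - move=> N y; rewrite !normrM ler_wpM2r// patchE.
    by case: ifP => // _; rewrite normr0.
rewrite (cvg_unique _ cvL cvR)//.
have pS z : p (z + x) = 2 * (e / (e ^+ 2 + z ^+ 2)) by rewrite pE addrK.
have LJ : L1 (fun z => f (z + x) * (e / (e ^+ 2 + z ^+ 2))).
  apply: L1_eq (L1Z (1 / 2) (L1_shift x Lfp)) => z.
  by rewrite pS; field; rewrite gt_eqF// ltr_pwDl ?exprn_gt0 ?sqr_ge0.
rewrite -(int_shift x Lfp) -mulrA mulrCA; congr (_ * _).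
rewrite -(int_scale _ LJ); apply: eq_int => z; rewrite pS; ring.
Unshelve. all: by end_near. Qed.


(** The damping [1 / (n + 1)] tends to 0 in [fourier_poisson]: the left side converges by domination
    since [a] and [b] are integrable, the right side by [poisson_approx], and [2 * c ^+ 2 * pi = 1].
    Continuity of [f] gives the identity at every [x]. *)
Lemma fourier_inversion f a b x : continuous f -> is_fourier f a b ->
  L1 (fun y => f y ^+ 2) -> L1 a -> L1 b ->
  f x = c * \int[mu]_y (a y * cos (x * y) - b y * sin (x * y)).
Proof.
move=> cf hf Lf2 La Lb.
pose e (n : nat) : R := n.+1%:R^-1.
have e0 n : 0 < e n by rewrite invr_gt0.
pose g y := a y * cos (x * y) - b y * sin (x * y).
have Lg : L1 g by apply: L1B; [exact: L1_cos|exact: L1_sin].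
have [_ c1] : L1 g /\ \int[mu]_y (expR (- (e n * `|y|)) * g y) @[n --> \oo] -->
    \int[mu]_y g y.
  apply: (int_cvg _ _ _ (L1_norm Lg)).
  - move=> n; apply: measurable_funM; last exact: L1_measurable.
    by apply: cont_meas; exact: cont_exp_abs.
  - exact: L1_measurable.
  - move=> y; rewrite -[X in _ --> X]mul1r; apply: cvgM; last exact: cvg_cst.
    have h : (- (e n * `|y|)) @[n --> \oo] --> (0 : R).
      rewrite -[X in _ --> X]oppr0; apply: cvgN; rewrite -[X in _ --> X](mul0r `|y|).
      by apply: cvgM; [exact: cvg_harmonic|exact: cvg_cst].
    rewrite -(@expR0 R).
    exact (cvg_comp (fun n => - (e n * `|y|)) (@expR R) h (@continuous_expR R 0)).
  - move=> n y; rewrite normrM ler_piMl// ger0_norm ?expR_ge0//.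
    by rewrite expR_le1 oppr_le0 mulr_ge0// ltW.
have c2 : (c * \int[mu]_y (expR (- (e n * `|y|)) * g y)) @[n --> \oo] --> f x.
  have -> : (fun n => c * \int[mu]_y (expR (- (e n * `|y|)) * g y)) =
    (fun n => pi^-1 * \int[mu]_z (f (z + x) * (e n / (e n ^+ 2 + z ^+ 2)))).
    apply/funext => n; rewrite (fourier_poisson x (e0 n) cf hf Lf2 La Lb) mulrA; congr (_ * _).
    have := fourier_const_sqr; rewrite -/c => h.
    apply: (@mulIf _ (pi : R)); first by rewrite gt_eqF// pi_gt0.
    rewrite mulVf ?gt_eqF ?pi_gt0// -[RHS]h.
    by move: (c) (@pi R) => c' p; ring.
  apply/cvgrPdist_le => d d0.
  have pi0 : 0 < pi :> R by exact: pi_gt0.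
  have [e1 e10 H] := @poisson_approx _ f x cf Lf2 (d * pi) (mulr_gt0 d0 pi0).
  near=> n.
  have [_] : L1 (fun z => f (z + x) * (e n / (e n ^+ 2 + z ^+ 2))) /\
     `|\int[mu]_z (f (z + x) * (e n / (e n ^+ 2 + z ^+ 2))) - pi * f x| <= d * pi.
    apply: H => //; near: n.
    by have /cvgrPdist_lt/(_ _ e10) := @cvg_harmonic R; apply: filterS => n;
      rewrite sub0r normrN; exact: le_lt_trans (ler_norm _).
  set J := \int[mu]_z _ => hJ.
  rewrite distrC; have -> : pi^-1 * J - f x = (J - pi * f x) / pi.
    by rewrite mulrBl [J / _]mulrC; congr (_ - _); rewrite mulrAC divff ?gt_eqF// mul1r.
  by rewrite normrM [X in _ * X]gtr0_norm ?invr_gt0// ler_pdivrMr.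
have c3 : (c * \int[mu]_y (expR (- (e n * `|y|)) * g y)) @[n --> \oo] -->
    c * \int[mu]_y g y.
  by apply: cvgM => //; exact: cvg_cst.
exact: cvg_unique c2 c3.
Unshelve. all: by end_near. Qed.

End inversion.

(** * Plancherel inequality *)

Section plancherel.
Context {R : realType}.
Notation mu := (@lebesgue_measure R).
Implicit Types (f g A B a b : R -> R) (h x e : R).

Let c : R := (Num.sqrt (2 * pi))^-1.

(** Schur's test: the integrand is at most [(A x ^+ 2 + A y ^+ 2) / 2 * q (x, y)], and by symmetry
    of [q] either half integrates to half of the right-hand side. *)
Lemma schur_bound A (k q : R * R -> R) (K M : R) :
  L1 A -> L1 (fun x => A x ^+ 2) ->
  measurable_fun setT k -> measurable_fun setT q ->
  (forall z, `|k z| <= q z) -> (forall z, q z <= M) ->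
  (forall x y, q (x, y) = q (y, x)) ->
  (forall x, L1 (fun y => q (x, y)) /\ \int[mu]_y q (x, y) = K) ->
  \int[mu]_x \int[mu]_y (A x * A y * k (x, y)) <= K * \int[mu]_x (A x ^+ 2).
Proof.
move=> LA LA2 mk mq kq qM qC qK.
have kM z : `|k z| <= M by exact: le_trans (kq z) (qM z).
have q0 z : 0 <= q z by exact: le_trans (normr_ge0 _) (kq z).
have [H1 _ _] := Fubini_kernel LA LA mk kM.
have mA := L1_measurable LA.
have Lkx x : L1 (fun y => A x * A y * k (x, y)).
  apply: (@L1_mul_bounded _ (fun y => A x * A y) (fun y => k (x, y)) M) => //.
    exact: L1Z.
  exact (measurableT_comp mk (pair1_measurable x)).
pose F (z : R * R) : R := A z.1 ^+ 2 * q z.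
have mF : measurable_fun setT F.
  apply: measurable_funM => //; apply: measurable_funX.
  by apply: (measurableT_comp mA).
have LF1 x : L1 (fun y => F (x, y)) by rewrite /F/=; apply: L1Z; exact: (qK x).1.
have qK' y : L1 (fun x => q (x, y)).
  by apply: L1_eq (qK y).1 => x; rewrite qC.
have LF2 y : L1 (fun x => F (x, y)).
  rewrite /F/=; apply: (@L1_mul_bounded _ (fun x => A x ^+ 2) (fun x => q (x, y)) M) => //.
    exact: L1_measurable.
  by move=> x; rewrite ger0_norm.
have EF x : \int[mu]_y F (x, y) = K * A x ^+ 2.
  by rewrite /F/= (int_scale _ (qK x).1) (qK x).2 mulrC.
have EF' x : \int[mu]_y `|F (x, y)| = K * A x ^+ 2.
  by rewrite -EF; apply: eq_int => y; rewrite ger0_norm// mulr_ge0 ?sqr_ge0.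
have [_ H2 H3] := @Fubini_L1 _ F (fun x => K * A x ^+ 2) mF LF1 LF2 (L1Z K LA2)
  (fun x => eq_ind_r (fun t => t <= K * A x ^+ 2) (lexx _) (EF' x)).
have I1 : \int[mu]_y \int[mu]_x F (x, y) = K * \int[mu]_x (A x ^+ 2).
  by rewrite -H3 -(int_scale _ LA2); apply: eq_int => x; rewrite EF.
have -> : K * \int[mu]_x (A x ^+ 2) = 1 / 2 * (K * \int[mu]_x (A x ^+ 2)) +
    1 / 2 * (\int[mu]_y \int[mu]_x F (x, y)) by rewrite I1; field.
rewrite -(int_scale K LA2) -(int_scale _ (L1Z K LA2)) -(int_scale _ H2).
rewrite -int_add; [|by apply/L1Z/L1Z|exact: L1Z].
apply: le_int => //; first by apply: L1D; [apply/L1Z/L1Z|exact: L1Z].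
move=> x; rewrite -EF -(int_scale _ (LF1 x)) -(int_scale _ (LF2 x)).
rewrite -int_add; [|exact: L1Z|exact: L1Z].
apply: le_int => //; first by apply: L1D; apply: L1Z.
move=> y; rewrite /F/= (qC y x).
apply: (le_trans (ler_norm _)); rewrite normrM.
have -> : 1 / 2 * (A x ^+ 2 * q (x, y)) + 1 / 2 * (A y ^+ 2 * q (x, y)) =
   (1 / 2 * (A x ^+ 2 + A y ^+ 2)) * q (x, y) by field.
apply: ler_pM => //; rewrite normrM.
rewrite -(real_normK (num_real (A x))) -(real_normK (num_real (A y))).
by have := sqr_ge0 (`|A x| - `|A y|); nra.
Qed.

Lemma cosM x y : cos x * cos y = 1 / 2 * (cos (x - y) + cos (x + y)).
Proof. by rewrite cosB cosD; field. Qed.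

Lemma sinM x y : sin x * sin y = 1 / 2 * (cos (x - y) - cos (x + y)).
Proof. by rewrite cosB cosD; field. Qed.

Lemma cosMsin x y : cos x * sin y = 1 / 2 * (sin (y + x) + sin (y - x)).
Proof. by rewrite sinB sinD; field. Qed.

Lemma L1_cos_r f h : L1 f -> L1 (fun x => f x * cos (x * h)).
Proof. by move=> Lf; apply: L1_eq (L1_cos h Lf) => x; rewrite mulrC [h * x]mulrC mulrC. Qed.

Lemma L1_sin_r f h : L1 f -> L1 (fun x => f x * sin (x * h)).
Proof. by move=> Lf; apply: L1_eq (L1_sin h Lf) => x; rewrite mulrC [h * x]mulrC mulrC. Qed.

(** Fubini moves the transform from [g] onto [f]. The next proof uses it with [f] the damped [g],
    and again with [f] a damped cosine or sine. *)
Lemma fourier_pairing g A B f :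
  (forall x, g x = c * \int[mu]_y (A y * cos (x * y) - B y * sin (x * y))) ->
  L1 A -> L1 B -> L1 f ->
  \int[mu]_x (f x * g x) =
  c * (\int[mu]_y (A y * \int[mu]_x (f x * cos (x * y))) -
       \int[mu]_y (B y * \int[mu]_x (f x * sin (x * y)))).
Proof.
move=> gE LA LB Lf.
have mcos := meas_mul_comp (@continuous_cos R).
have msin := meas_mul_comp (@continuous_sin R).
have bcos (z : R * R) : `|cos (z.1 * z.2)| <= 1 by exact: norm_cos_le1.
have bsin (z : R * R) : `|sin (z.1 * z.2)| <= 1 by exact: norm_sin_le1.
have [H1 H1' H2] := Fubini_kernel Lf LA mcos bcos.
have [H3 H3' H4] := Fubini_kernel Lf LB msin bsin.
have e1 y : \int[mu]_x (f x * A y * cos (x * y)) = A y * \int[mu]_x (f x * cos (x * y)).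
  rewrite -int_scale; last exact: L1_cos_r.
  by apply: eq_int => x; ring.
have e2 y : \int[mu]_x (f x * B y * sin (x * y)) = B y * \int[mu]_x (f x * sin (x * y)).
  rewrite -int_scale; last exact: L1_sin_r.
  by apply: eq_int => x; ring.
transitivity (\int[mu]_x (c * (\int[mu]_y (f x * A y * cos (x * y)) -
      \int[mu]_y (f x * B y * sin (x * y))))).
  apply: eq_int => x.
  have -> : \int[mu]_y (f x * A y * cos (x * y)) = f x * \int[mu]_y (A y * cos (x * y)).
    by rewrite -int_scale; [apply: eq_int => y; ring|exact: L1_cos].
  have -> : \int[mu]_y (f x * B y * sin (x * y)) = f x * \int[mu]_y (B y * sin (x * y)).
    by rewrite -int_scale; [apply: eq_int => y; ring|exact: L1_sin].
  rewrite gE int_sub; [|exact: L1_cos|exact: L1_sin].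
  by ring.
rewrite int_scale; last exact: L1B.
by rewrite int_sub// H2 H4; congr (_ * (_ - _)); apply: eq_int => y; rewrite ?e1 ?e2.
Qed.

(** The damping makes all integrals absolutely convergent. Writing both factors of [g ^+ 2] through
    [A] and [B] leaves two quadratic forms whose kernels are built from Poisson kernels and
    dominated by one of row mass [2 * pi]. [schur_bound] and [c ^+ 2 * (2 * pi) = 1] then give a
    bound independent of [e]. *)
Lemma plancherel_damped g A B e : 0 < e ->
  (forall x, g x = c * \int[mu]_y (A y * cos (x * y) - B y * sin (x * y))) ->
  L1 A -> L1 B -> L1 (fun x => A x ^+ 2) -> L1 (fun x => B x ^+ 2) ->
  L1 (fun x => g x ^+ 2 * expR (- (e * `|x|))) /\
  \int[mu]_x (g x ^+ 2 * expR (- (e * `|x|))) <=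
    \int[mu]_x (A x ^+ 2) + \int[mu]_x (B x ^+ 2).
Proof.
move=> e0 gE LA LB LA2 LB2.
pose w x := expR (- (e * `|x|)).
have [Lw _] := int_exp_abs e0.
have mcos := meas_mul_comp (@continuous_cos R).
have msin := meas_mul_comp (@continuous_sin R).
have bcos (z : R * R) : `|cos (z.1 * z.2)| <= 1 by exact: norm_cos_le1.
have bsin (z : R * R) : `|sin (z.1 * z.2)| <= 1 by exact: norm_sin_le1.
have mg : measurable_fun setT g.
  have -> : g = fun x => c * (\int[mu]_y (A y * cos (x * y)) - \int[mu]_y (B y * sin (x * y))).
    by apply/funext => x; rewrite gE int_sub//; [exact: L1_cos|exact: L1_sin].
  apply: measurable_funM => //; apply: measurable_funB; apply: meas_fourier => //.
  - exact: continuous_cos.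
  - exact: norm_cos_le1.
  - exact: continuous_sin.
  - exact: norm_sin_le1.
have c0 : 0 <= c by rewrite invr_ge0 sqrtr_ge0.
pose G := c * \int[mu]_y (`|A y| + `|B y|).
have gG x : `|g x| <= G.
  rewrite gE normrM (ger0_norm c0) ler_wpM2l//.
  apply: norm_int_le.
  - by apply: L1B; [exact: L1_cos|exact: L1_sin].
  - by apply: L1D; exact: L1_norm.
  move=> y; rewrite (le_trans (ler_normB _ _))// lerD// normrM ler_piMr//.
    exact: norm_cos_le1.
  exact: norm_sin_le1.
pose phi x := w x * g x.
have Lphi : L1 phi by exact: (L1_mul_bounded Lw mg gG).
have LI : L1 (fun x => phi x * g x) by exact: (L1_mul_bounded Lphi mg gG).
have E0 : (fun x => g x ^+ 2 * expR (- (e * `|x|))) = (fun x => phi x * g x).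
  by apply/funext => x; rewrite /phi /w; ring.
rewrite E0; split => //.
pose p (z : R) := 2 * (e / (e ^+ 2 + z ^+ 2)).
have pcont : continuous p.
  by apply: cont_mul; [exact: cont_cst|exact: cont_poisson].
have p0 z : 0 <= p z.
  by rewrite mulr_ge0// divr_ge0 ?addr_ge0 ?sqr_ge0// ltW.
have pM z : p z <= 2 / e.
  rewrite /p ler_pM2l// ler_pdivrMr ?ltr_pwDl ?exprn_gt0 ?sqr_ge0//.
  by rewrite mulrDr expr2 mulKf ?gt_eqF// lerDl mulr_ge0 ?sqr_ge0// invr_ge0 ltW.
have [LP EP] := int_poisson e0.
have wcos z : L1 (fun x => w x * cos (z * x)) /\ \int[mu]_x (w x * cos (z * x)) = p z.
  by have [L1c ->] := int_exp_abs_cos z e0; split => //; rewrite /p mulrA.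
have wsin z := int_exp_abs_sin z e0.
have Lwc x : L1 (fun z => w z * cos (z * x)) by exact: L1_cos_r.
have Lws x : L1 (fun z => w z * sin (z * x)) by exact: L1_sin_r.
have ccE x y : \int[mu]_z (w z * cos (z * x) * cos (z * y)) =
    1 / 2 * (p (x - y) + p (x + y)).
  have [La Ea] := wcos (x - y); have [Lb Eb] := wcos (x + y).
  rewrite -Ea -Eb -int_add// -int_scale; last exact: L1D.
  apply: eq_int => z; rewrite -mulrA cosM -mulrBr -mulrDr.
  by rewrite [z * (x - y)]mulrC [z * (x + y)]mulrC; field.
have ssE x y : \int[mu]_z (w z * sin (z * x) * sin (z * y)) =
    1 / 2 * (p (x - y) - p (x + y)).
  have [La Ea] := wcos (x - y); have [Lb Eb] := wcos (x + y).
  rewrite -Ea -Eb -int_sub// -int_scale; last exact: L1B.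
  apply: eq_int => z; rewrite -mulrA sinM -mulrBr -mulrDr.
  by rewrite [z * (x - y)]mulrC [z * (x + y)]mulrC; field.
have csE x y : \int[mu]_z (w z * cos (z * x) * sin (z * y)) = 0.
  have [La Ea] := wsin (y + x); have [Lb Eb] := wsin (y - x).
  have -> : (fun z => w z * cos (z * x) * sin (z * y)) =
    (fun z => 1 / 2 * (w z * sin ((y + x) * z) + w z * sin ((y - x) * z))).
    apply/funext => z; rewrite -mulrA cosMsin -mulrBr -mulrDr.
    by rewrite [z * (y - x)]mulrC [z * (y + x)]mulrC; field.
  rewrite int_scale; last exact: L1D.
  by rewrite int_add// Ea Eb addr0 mulr0.
have scE x y : \int[mu]_z (w z * sin (z * x) * cos (z * y)) = 0.
  by rewrite -(csE y x); apply: eq_int => z; ring.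
(* The damped products of two cosines give [kp], those of two sines [km], and mixed products vanish
   by oddness. The sign of [km] may vary, but [|km| <= kp]. *)
pose kp (z : R * R) : R := 1 / 2 * (p (z.1 - z.2) + p (z.1 + z.2)).
pose km (z : R * R) : R := 1 / 2 * (p (z.1 - z.2) - p (z.1 + z.2)).
have CE x : \int[mu]_z (phi z * cos (z * x)) = c * \int[mu]_y (A y * kp (x, y)).
  transitivity (\int[mu]_z (w z * cos (z * x) * g z)).
    by apply: eq_int => z; rewrite /phi; ring.
  rewrite (fourier_pairing gE)//; congr (_ * _).
  rewrite [X in _ - X](_ : _ = 0).
    by rewrite subr0; apply: eq_int => y; rewrite ccE.
  rewrite -[RHS](mul0r (\int[mu]_y B y)) -int_scale//.
  by apply: eq_int => y; rewrite csE mulr0 mul0r.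
have SE x : \int[mu]_z (phi z * sin (z * x)) = - (c * \int[mu]_y (B y * km (x, y))).
  transitivity (\int[mu]_z (w z * sin (z * x) * g z)).
    by apply: eq_int => z; rewrite /phi; ring.
  rewrite (fourier_pairing gE)// -mulrN; congr (_ * _).
  rewrite [X in X - _](_ : _ = 0).
    by rewrite sub0r; congr (- _); apply: eq_int => y; rewrite ssE.
  rewrite -[RHS](mul0r (\int[mu]_y A y)) -int_scale//.
  by apply: eq_int => y; rewrite scE mulr0 mul0r.
have mkp : measurable_fun setT kp.
  apply: measurable_funM => //; apply: measurable_funD.
    exact: (meas_sub_comp pcont).
  exact: (meas_add_comp pcont).
have mkm : measurable_fun setT km.
  apply: measurable_funM => //; apply: measurable_funB.
    exact: (meas_sub_comp pcont).
  exact: (meas_add_comp pcont).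
have kpM z : kp z <= 2 / e.
  by rewrite /kp; have := pM (z.1 - z.2); have := pM (z.1 + z.2); lra.
have kpp z : `|kp z| <= kp z.
  rewrite ger0_norm// /kp.
  by have := p0 (z.1 - z.2); have := p0 (z.1 + z.2); lra.
have kmp z : `|km z| <= kp z.
  rewrite /km /kp ler_norml.
  by apply/andP; split; have := p0 (z.1 - z.2); have := p0 (z.1 + z.2); lra.
have pN z : p (- z) = p z by rewrite /p sqrrN.
have Lp : L1 p by exact: L1Z.
have Ip : \int[mu]_x p x = 2 * pi by rewrite /p (int_scale _ LP) EP.
have kpC x y : kp (x, y) = kp (y, x).
  by rewrite /kp/= -opprB pN [y + x]addrC.
have kpI x : L1 (fun y => kp (x, y)) /\ \int[mu]_y kp (x, y) = 2 * pi.
  have -> : (fun y => kp (x, y)) = (fun y => 1 / 2 * (p (y + - x) + p (y + x))).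
    by apply/funext => y; rewrite kpC.
  have La := L1_shift (- x) Lp; have Lb := L1_shift x Lp.
  split; first by apply/L1Z/L1D.
  rewrite int_scale; last exact: L1D.
  rewrite int_add// (int_shift (- x) Lp) (int_shift x Lp) Ip.
  by move: (@pi R) => t; field.
have SA := schur_bound LA LA2 mkp mkp kpp kpM kpC kpI.
have SB := schur_bound LB LB2 mkm mkp kmp kpM kpC kpI.
have LAkp x : L1 (fun y => A y * kp (x, y)).
  apply: (@L1_mul_bounded _ _ (fun y => kp (x, y)) (2 / e)) => //.
    exact (L1_measurable (kpI x).1).
  by move=> y; exact: le_trans (kpp _) (kpM _).
have LBkm x : L1 (fun y => B y * km (x, y)).
  apply: (@L1_mul_bounded _ _ (fun y => km (x, y)) (2 / e)) => //.
    exact (measurableT_comp mkm (pair1_measurable x)).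
  by move=> y; exact: le_trans (kmp _) (kpM _).
have [HA _ _] := @Fubini_kernel _ _ _ _ (2 / e) LA LA mkp (fun z => le_trans (kpp z) (kpM z)).
have [HB _ _] := @Fubini_kernel _ _ _ _ (2 / e) LB LB mkm (fun z => le_trans (kmp z) (kpM z)).
rewrite (fourier_pairing gE)//.
have -> : \int[mu]_y (A y * \int[mu]_x (phi x * cos (x * y))) =
    c * \int[mu]_x \int[mu]_y (A x * A y * kp (x, y)).
  rewrite -int_scale//; apply: eq_int => x; rewrite CE mulrCA; congr (_ * _).
  by rewrite -int_scale//; apply: eq_int => y; rewrite mulrA.
have -> : \int[mu]_y (B y * \int[mu]_x (phi x * sin (x * y))) =
    - (c * \int[mu]_x \int[mu]_y (B x * B y * km (x, y))).
  rewrite -int_scale// -int_neg; last exact: L1Z.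
  apply: eq_int => x; rewrite SE mulrN mulrCA; congr (- (_ * _)).
  by rewrite -int_scale//; apply: eq_int => y; rewrite mulrA.
rewrite opprK -mulrDr mulrA.
have c2 : c * c * (2 * pi) = 1 by have := @fourier_const_sqr R; rewrite expr2.
apply: (le_trans (ler_wpM2l (mulr_ge0 c0 c0) (lerD SA SB))).
by rewrite -mulrDr mulrA c2 mul1r.
Qed.

(** The damped bound is uniform in [e], so Fatou's lemma removes the damping. *)
Lemma plancherel_le g A B :
  (forall x, g x = c * \int[mu]_y (A y * cos (x * y) - B y * sin (x * y))) ->
  L1 A -> L1 B -> L1 (fun x => A x ^+ 2) -> L1 (fun x => B x ^+ 2) ->
  L1 (fun x => g x ^+ 2) /\
  \int[mu]_x (g x ^+ 2) <= \int[mu]_x (A x ^+ 2) + \int[mu]_x (B x ^+ 2).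
Proof.
move=> gE LA LB LA2 LB2.
pose e (n : nat) : R := n.+1%:R^-1.
have e0 n : 0 < e n by rewrite invr_gt0.
have H n := plancherel_damped (e0 n) gE LA LB LA2 LB2.
have cv x : g x ^+ 2 * expR (- (e n * `|x|)) @[n --> \oo] --> g x ^+ 2.
  rewrite -[X in _ --> X]mulr1; apply: cvgM; first exact: cvg_cst.
  have h : (- (e n * `|x|)) @[n --> \oo] --> (0 : R).
    rewrite -[X in _ --> X]oppr0; apply: cvgN; rewrite -[X in _ --> X](mul0r `|x|).
    by apply: cvgM; [exact: cvg_harmonic|exact: cvg_cst].
  rewrite -(@expR0 R).
  exact (cvg_comp (fun n => - (e n * `|x|)) (@expR R) h (@continuous_expR R 0)).
apply: (int_cvg_nneg _ _ _ (fun n => (H n).1) cv (fun n => (H n).2)).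
- by move=> n; exact: (L1_measurable (H n).1).
- apply: (@measurable_fun_cvg _ _ _ _ (fun n x => g x ^+ 2 * expR (- (e n * `|x|)))).
  + by move=> n; exact: (L1_measurable (H n).1).
  + by move=> x _; exact: cv.
- by move=> n x; rewrite mulr_ge0 ?sqr_ge0// expR_ge0.
Qed.

End plancherel.

(** * Sobolev embedding *)

Section trigonometric_estimates.
Context {R : realType}.
Implicit Types (x t th : R).

Lemma normr_sin_le t : `|sin t| <= `|t|.
Proof.
have := @lipschitz_of_derive R sin cos 1 (@is_derive_sin R) (@norm_cos_le1 R) 0 t.
by rewrite sin0 !subr0 mul1r.
Qed.

Lemma normr_cosB1_le t : `|cos t - 1| <= `|t| ^+ 2.
Proof.
wlog t0 : t / 0 <= t.
  move=> H; have [/H//|/ltW t0] := leP 0 t.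
  by rewrite -cosN -[`|t|]normrN; apply: H; rewrite oppr_ge0.
have [z /andP[z0 zt]] := mean_value (@is_derive_cos R) t0.
rewrite cos0 subr0 => ->; rewrite normrM normrN expr2 ler_wpM2r//.
by rewrite (le_trans (normr_sin_le _))// !ger0_norm.
Qed.

Lemma normr_sinB_le t : `|sin t - t| <= `|t| ^+ 3.
Proof.
wlog t0 : t / 0 <= t.
  move=> H; have [/H//|/ltW t0] := leP 0 t.
  have -> : `|sin t - t| = `|sin (- t) - - t|.
    by rewrite sinN -[in RHS]normrN opprD !opprK.
  by rewrite -[`|t|]normrN; apply: H; rewrite oppr_ge0.
have dF x : is_derive x (1 : R) (fun x => sin x - x) (cos x - 1).
  exact: is_derive_sub (is_derive_sin x) (is_derive_x x).
have [z /andP[z0 zt]] := mean_value dF t0.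
rewrite sin0 !subr0 => ->; rewrite normrM exprSr ler_wpM2r//.
by rewrite (le_trans (normr_cosB1_le _))// lerXn2r ?nnegrE// !ger0_norm.
Qed.

Lemma normr_cos_sub_le x t : `|cos (x + t) - cos x| <= `|t|.
Proof.
have h (y : R) : `|- sin y| <= 1 by rewrite normrN norm_sin_le1.
have := lipschitz_of_derive (@is_derive_cos R) h x (x + t).
by rewrite mul1r addrAC subrr add0r.
Qed.

Lemma normr_sin_sub_le x t : `|sin (x + t) - sin x| <= `|t|.
Proof.
have := lipschitz_of_derive (@is_derive_sin R) (@norm_cos_le1 R) x (x + t).
by rewrite mul1r addrAC subrr add0r.
Qed.

Lemma le_powR_small t th : 0 <= t -> t <= 1 -> 0 < th -> th <= 1 -> t <= t `^ th.
Proof.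
rewrite le_eqVlt => /predU1P[<- *|t0 t1 th0 th1]; first by rewrite powR_ge0.
by apply: ger1_powR => //; rewrite t0.
Qed.

Lemma powR_ge1 t th : 1 <= t -> 0 < th -> 1 <= t `^ th.
Proof.
move=> t1 th0; rewrite -(powRr0 t); apply: ler_powR => //; exact: ltW.
Qed.

(** Interpolation between the Lipschitz bound, used for [|t| <= 1], and the bound 2, used for
    [|t| >= 1]. The exponent [th] will be the Hoelder exponent of [u_x]. *)
Lemma cos_increment x t th : 0 < th -> th <= 1 ->
  `|cos (x + t) - cos x| <= 2 * `|t| `^ th.
Proof.
move=> th0 th1; have [t1|/ltW t1] := leP `|t| 1.
  rewrite (le_trans (normr_cos_sub_le _ _))//.
  have := le_powR_small (normr_ge0 t) t1 th0 th1.
  by have := powR_ge0 `|t| th; lra.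
have := powR_ge1 t1 th0; have := norm_cos_le1 (x + t); have := norm_cos_le1 x.
have := ler_normB (cos (x + t)) (cos x); lra.
Qed.

Lemma sin_increment x t th : 0 < th -> th <= 1 ->
  `|sin (x + t) - sin x| <= 2 * `|t| `^ th.
Proof.
move=> th0 th1; have [t1|/ltW t1] := leP `|t| 1.
  rewrite (le_trans (normr_sin_sub_le _ _))//.
  have := le_powR_small (normr_ge0 t) t1 th0 th1.
  by have := powR_ge0 `|t| th; lra.
have := powR_ge1 t1 th0; have := norm_sin_le1 (x + t); have := norm_sin_le1 x.
have := ler_normB (sin (x + t)) (sin x); lra.
Qed.

(** The same interpolation one order higher, for the symbol of the difference quotient minus that of
    the derivative. *)
Lemma cosB1_bound t th : 0 < th -> th <= 1 ->
  `|cos t - 1| <= 2 * (`|t| * `|t| `^ th).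
Proof.
move=> th0 th1; have [t1|/ltW t1] := leP `|t| 1.
  rewrite (le_trans (normr_cosB1_le _))// expr2.
  have := le_powR_small (normr_ge0 t) t1 th0 th1.
  by have := powR_ge0 `|t| th; have := normr_ge0 t; nra.
have := powR_ge1 t1 th0; have := norm_cos_le1 t.
have := ler_normB (cos t) 1; rewrite normr1; nra.
Qed.

Lemma sinB_bound t th : 0 < th -> th <= 1 ->
  `|sin t - t| <= 2 * (`|t| * `|t| `^ th).
Proof.
move=> th0 th1; have [t1|/ltW t1] := leP `|t| 1.
  rewrite (le_trans (normr_sinB_le _))// exprS expr2.
  have := le_powR_small (normr_ge0 t) t1 th0 th1.
  move=> h; have t0 := normr_ge0 t.
  have h1 : `|t| * `|t| <= `|t| * `|t| `^ th by rewrite ler_wpM2l.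
  have h2 : `|t| * `|t| <= `|t| by rewrite ler_piMr.
  have h3 : `|t| * (`|t| * `|t|) <= `|t| * `|t| by rewrite ler_wpM2l.
  have : 0 <= `|t| * `|t| by rewrite mulr_ge0.
  lra.
have := powR_ge1 t1 th0; have := normr_sin_le t.
have := ler_normB (sin t) t; nra.
Qed.

End trigonometric_estimates.

(** * Uniform and L^2 bounds from the Sobolev norm *)

Section sobolev.
Context {R : realType}.
Notation mu := (@lebesgue_measure R).
Implicit Types (f g A B a b : R -> R) (h x e s n : R).

Let c : R := (Num.sqrt (2 * pi))^-1.

Lemma japanese_gt0 x : 0 < 1 + x ^+ 2.
Proof. by rewrite ltr_pwDl ?sqr_ge0. Qed.

Lemma japanese_ge1 x : 1 <= 1 + x ^+ 2.
Proof. by rewrite lerDl sqr_ge0. Qed.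

Lemma meas_japanese s : measurable_fun setT (fun x => (1 + x ^+ 2) `^ s).
Proof.
apply: (measurableT_comp (measurable_powR s)).
by apply: cont_meas; apply: cont_add; [exact: cont_cst|exact: (cont_sqr cont_id)].
Qed.

(** Young's inequality with weight [n]: [|a phi|] is at most [n^-1 w a^2 + n phi^2 / w], and both
    terms integrate to a multiple of [n]. *)
Lemma weighted_integrable a (phi w : R -> R) n K : 0 < n ->
  measurable_fun setT a -> measurable_fun setT phi -> (forall x, 0 < w x) ->
  L1 (fun x => w x * a x ^+ 2) -> \int[mu]_x (w x * a x ^+ 2) <= n ^+ 2 ->
  L1 (fun x => phi x ^+ 2 / w x) -> \int[mu]_x (phi x ^+ 2 / w x) <= K ->
  L1 (fun x => a x * phi x) /\ \int[mu]_x `|a x * phi x| <= (1 + K) * n.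
Proof.
move=> n0 ma mphi w0 La Ia Lp Ip.
have b x : `|a x * phi x| <= n^-1 * (w x * a x ^+ 2) + n * (phi x ^+ 2 / w x).
  rewrite normrM -(real_normK (num_real (a x))) -(real_normK (num_real (phi x))).
  set p := `|a x|; set q := `|phi x|; have wx := w0 x.
  have -> : n^-1 * (w x * p ^+ 2) + n * (q ^+ 2 / w x) =
    (n * w x)^-1 * ((w x * p) ^+ 2 + (n * q) ^+ 2).
    by field; rewrite !gt_eqF.
  rewrite ler_pdivlMl ?mulr_gt0//.
  have := sqr_ge0 (w x * p - n * q).
  have p0 : 0 <= p by exact: normr_ge0.
  have q0 : 0 <= q by exact: normr_ge0.
  have : 0 <= (w x * p) * (n * q) by rewrite !mulr_ge0// ltW.
  by nra.
have LG : L1 (fun x => n^-1 * (w x * a x ^+ 2) + n * (phi x ^+ 2 / w x)).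
  by apply: L1D; exact: L1Z.
have L : L1 (fun x => a x * phi x).
  by apply: L1_le LG b; exact: measurable_funM.
split=> //; apply: (le_trans (le_int (L1_norm L) LG b)).
rewrite int_add; [|exact: L1Z|exact: L1Z].
rewrite (int_scale _ La) (int_scale _ Lp) mulrDl mul1r [K * n]mulrC.
apply: lerD; last by rewrite ler_pM2l.
by rewrite mulrC ler_pdivrMr// -expr2.
Qed.

(** An infimum strictly below [n ^+ 2] is undercut by an actual pair of transforms; this is why the
    bounds on Sobolev norms are kept strict. *)
Lemma sobolev_transform s f n : 0 < n -> (sobolev_normsq s f < (n ^+ 2)%:E)%E ->
  exists a b, [/\ is_fourier f a b, L1 (fun x => f x ^+ 2),
    measurable_fun setT a /\ measurable_fun setT b &
    [/\ L1 (fun x => (1 + x ^+ 2) `^ s * a x ^+ 2),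
      L1 (fun x => (1 + x ^+ 2) `^ s * b x ^+ 2) &
      \int[mu]_x ((1 + x ^+ 2) `^ s * a x ^+ 2) +
      \int[mu]_x ((1 + x ^+ 2) `^ s * b x ^+ 2) <= n ^+ 2]].
Proof.
move=> n0 /ereal_inf_lt[_ [a [b [hf ->]]] hn]; exists a, b.
have [hL ma mb _] := hf.
have mw := meas_japanese s.
have m1 : measurable_fun setT (fun x => (1 + x ^+ 2) `^ s * a x ^+ 2).
  by apply: measurable_funM => //; exact: measurable_funX.
have m2 : measurable_fun setT (fun x => (1 + x ^+ 2) `^ s * b x ^+ 2).
  by apply: measurable_funM => //; exact: measurable_funX.
have L : L1 (fun x => (1 + x ^+ 2) `^ s * (a x ^+ 2 + b x ^+ 2)).
  apply: L1_lty.
  - apply: measurable_funM => //; apply: measurable_funD; exact: measurable_funX.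
  - by move=> x; rewrite mulr_ge0 ?addr_ge0 ?sqr_ge0// powR_ge0.
  - exact: lt_trans hn (ltry _).
have La : L1 (fun x => (1 + x ^+ 2) `^ s * a x ^+ 2).
  apply: (L1_le m1 L) => x; rewrite ger0_norm; last first.
    by apply: mulr_ge0; [exact: powR_ge0|exact: sqr_ge0].
  by rewrite ler_wpM2l ?powR_ge0// lerDl sqr_ge0.
have Lb : L1 (fun x => (1 + x ^+ 2) `^ s * b x ^+ 2).
  apply: (L1_le m2 L) => x; rewrite ger0_norm; last first.
    by apply: mulr_ge0; [exact: powR_ge0|exact: sqr_ge0].
  by rewrite ler_wpM2l ?powR_ge0// lerDr sqr_ge0.
split=> //.
  exact (Lfun2_integrable_sqr hL).
split=> //; rewrite -int_add// -lee_fin EFin_int; last exact: L1D.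
apply: ltW; apply: le_lt_trans hn; rewrite le_eqVlt; apply/orP; left; apply/eqP.
by apply: eq_integral => x _; rewrite mulrDr.
Qed.

Lemma L1_dominated_sqr s A a C n : 0 <= C ->
  measurable_fun setT A ->
  L1 (fun x => (1 + x ^+ 2) `^ s * a x ^+ 2) ->
  (forall x, A x ^+ 2 <= C * ((1 + x ^+ 2) `^ s * a x ^+ 2)) ->
  L1 (fun x => A x ^+ 2) /\
  \int[mu]_x (A x ^+ 2) <= C * \int[mu]_x ((1 + x ^+ 2) `^ s * a x ^+ 2).
Proof.
move=> C0 mA La h.
have L : L1 (fun x => A x ^+ 2).
  apply: (L1_le _ (L1Z C La)); first exact: measurable_funX.
  by move=> x; rewrite ger0_norm ?sqr_ge0.
by split=> //; rewrite -int_scale//; apply: le_int => //; exact: L1Z.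
Qed.

Definition sobolev_sup (s : R) (C : R) := forall f n, 0 < n -> continuous f ->
  (sobolev_normsq s f < (n ^+ 2)%:E)%E ->
  [/\ forall x, `|f x| <= C * n, L1 (fun x => f x ^+ 2) &
      \int[mu]_x (f x ^+ 2) <= n ^+ 2].

Lemma fourier_const_ge0 : 0 <= c.
Proof. by rewrite invr_ge0 sqrtr_ge0. Qed.

Lemma inverse_fourier_le g A B x : L1 A -> L1 B ->
  (g x = c * \int[mu]_y (A y * cos (x * y) - B y * sin (x * y))) ->
  `|g x| <= c * (\int[mu]_y `|A y| + \int[mu]_y `|B y|).
Proof.
move=> LA LB ->; rewrite normrM (ger0_norm fourier_const_ge0).
rewrite ler_wpM2l ?fourier_const_ge0// -int_add; [|exact: L1_norm|exact: L1_norm].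
apply: norm_int_le.
- by apply: L1B; [exact: L1_cos|exact: L1_sin].
- by apply: L1D; exact: L1_norm.
move=> y; rewrite (le_trans (ler_normB _ _))// lerD// normrM ler_piMr//.
  exact: norm_cos_le1.
exact: norm_sin_le1.
Qed.

Lemma powR_japanese_ge1 s x : 0 <= s -> 1 <= (1 + x ^+ 2) `^ s.
Proof. by move=> s0; rewrite -[leLHS](powRr0 (1 + x ^+ 2)) ler_powR// japanese_ge1. Qed.

(** The weight has an integrable inverse, so [a] and [b] are integrable and inversion bounds [f]
    uniformly. As the weight is at least 1, Plancherel bounds the L^2 norm by [n]. *)
Lemma sobolev_embedding s : 1 / 2 < s -> exists C, sobolev_sup s C.
Proof.
move=> s2.
pose K := \int[mu]_x ((1 + x ^+ 2) `^ (- s)).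
have Lw := L1_weight s2.
exists (c * (2 * (1 + K))) => f n n0 cf.
move=> /(sobolev_transform n0)[a [b [hf Lf [ma mb] [La Lb Iab]]]].
have w0 x : 0 < (1 + x ^+ 2) `^ s by rewrite powR_gt0// japanese_gt0.
have a0 : 0 <= \int[mu]_x ((1 + x ^+ 2) `^ s * a x ^+ 2).
  by apply: int_ge0 => x; rewrite mulr_ge0 ?sqr_ge0 ?powR_ge0.
have b0 : 0 <= \int[mu]_x ((1 + x ^+ 2) `^ s * b x ^+ 2).
  by apply: int_ge0 => x; rewrite mulr_ge0 ?sqr_ge0 ?powR_ge0.
have Ia : \int[mu]_x ((1 + x ^+ 2) `^ s * a x ^+ 2) <= n ^+ 2 by lra.
have Ib : \int[mu]_x ((1 + x ^+ 2) `^ s * b x ^+ 2) <= n ^+ 2 by lra.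
have e1 : (fun x => 1 ^+ 2 / (1 + x ^+ 2) `^ s) = (fun x => (1 + x ^+ 2) `^ (- s)).
  by apply/funext => x; rewrite expr1n mul1r powRN.
have Lw' : L1 (fun x => 1 ^+ 2 / (1 + x ^+ 2) `^ s) by rewrite e1.
have Iw' : \int[mu]_x (1 ^+ 2 / (1 + x ^+ 2) `^ s) <= K by rewrite e1.
have [LA IA] := @weighted_integrable a (fun=> 1) _ n K n0 ma (measurable_cst _) w0 La Ia Lw' Iw'.
have [LB IB] := @weighted_integrable b (fun=> 1) _ n K n0 mb (measurable_cst _) w0 Lb Ib Lw' Iw'.
have m1 : forall g, (fun x : R => g x * 1) = g :> (R -> R).
  by move=> g; apply/funext => x; rewrite mulr1.
rewrite !m1 in LA LB IA IB.
have fE x := fourier_inversion x cf hf Lf LA LB.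
have [La2 Ia2] : L1 (fun x => a x ^+ 2) /\
    \int[mu]_x (a x ^+ 2) <= 1 * \int[mu]_x ((1 + x ^+ 2) `^ s * a x ^+ 2).
  apply: L1_dominated_sqr => // x; rewrite mul1r ler_peMl ?sqr_ge0//.
  by apply: powR_japanese_ge1; lra.
have [Lb2 Ib2] : L1 (fun x => b x ^+ 2) /\
    \int[mu]_x (b x ^+ 2) <= 1 * \int[mu]_x ((1 + x ^+ 2) `^ s * b x ^+ 2).
  apply: L1_dominated_sqr => // x; rewrite mul1r ler_peMl ?sqr_ge0//.
  by apply: powR_japanese_ge1; lra.
have [_ P] := plancherel_le fE LA LB La2 Lb2.
split=> //; last by lra.
move=> x; rewrite (le_trans (inverse_fourier_le LA LB (fE x)))//.
rewrite -mulrA ler_wpM2l ?fourier_const_ge0//.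
move: IA IB; under eq_int do rewrite mulr1.
move=> IA; under eq_int do rewrite mulr1.
by move=> IB; nra.
Qed.

End sobolev.

(* [n] bounds the norm of [f] in [H^s], [s > 3/2]; [C] and the modulus of
   continuity [om] depend on [s] only. *)
Record C1_bounds (R : realType) (C : R) (om : R -> R) (n : R) (f : R -> R) : Prop := {
  C1_derive : forall x, is_derive x (1 : R) f (derive1 f x);
  C1_cont : continuous (derive1 f);
  C1_sup : forall x, `|f x| <= C * n;
  C1_dsup : forall x, `|derive1 f x| <= C * n;
  C1_mod : forall x h, `|derive1 f (x + h) - derive1 f x| <= om h * n;
  C1_L2 : L1 (fun x => f x ^+ 2) /\
    \int[lebesgue_measure]_x (f x ^+ 2) <= n ^+ 2;
  C1_dL2 : L1 (fun x => derive1 f x ^+ 2) /\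
    \int[lebesgue_measure]_x (derive1 f x ^+ 2) <= n ^+ 2;
  C1_quot : forall h, h != 0 ->
    L1 (fun x => ((f (x + h) - f x) / h - derive1 f x) ^+ 2) /\
    \int[lebesgue_measure]_x (((f (x + h) - f x) / h - derive1 f x) ^+ 2)
      <= (om h * n) ^+ 2 }.

(** * Hoelder continuous derivative in H^s for s > 3/2 *)

Section sobolev_C1.
Context {R : realType}.
Notation mu := (@lebesgue_measure R).
Implicit Types (f g A B a b : R -> R) (h x e s n : R).

Let c : R := (Num.sqrt (2 * pi))^-1.

(** The first moments of the transform dominate the differentiated integrand. The result has the
    same shape, with [- b y * y] and [a y * y] in place of [a] and [b], so the Plancherel inequality
    applies to the derivative as well. *)
Lemma inverse_fourier_derive f a b :
  (forall x, f x = c * \int[mu]_y (a y * cos (x * y) - b y * sin (x * y))) ->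
  L1 a -> L1 b -> L1 (fun y => a y * y) -> L1 (fun y => b y * y) ->
  forall x, is_derive x (1 : R) f
    (c * \int[mu]_y (- (b y * y) * cos (x * y) - (a y * y) * sin (x * y))).
Proof.
move=> fE La Lb La1 Lb1 x.
pose k x y := a y * cos (x * y) - b y * sin (x * y).
pose G y := `|a y * y| + `|b y * y|.
have dk t y : is_derive t (1 : R) (k ^~ y) (- (b y * y) * cos (t * y) - (a y * y) * sin (t * y)).
  have h1 := is_derive_scale (a y) (is_derive_cos_lin y t).
  have h2 := is_derive_scale (b y) (is_derive_sin_lin y t).
  apply: (@is_derive_ext _ (fun t => a y * cos (y * t) - b y * sin (y * t))).
    by move=> r; rewrite /k [y * r]mulrC.
  refine (is_deriveE (is_derive_sub h1 h2) _).
  by rewrite [y * t]mulrC; ring.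
have Lk t : L1 (k t) by apply: L1B; [exact: L1_cos|exact: L1_sin].
have LG : L1 G by apply: L1D; exact: L1_norm.
have xI : (`](x - 1), (x + 1)[%classic : set R) x.
  by rewrite /= in_itv/= ltrBlDr ltrDl ltr01.
have Gb t y : (`](x - 1), (x + 1)[%classic : set R) t -> setT y ->
    `|partial1of2 k t y| <= G y.
  move=> _ _; rewrite /partial1of2 (is_derive_derive1 (dk t y)).
  rewrite (le_trans (ler_normB _ _))// addrC; apply: lerD.
    by rewrite normrM ler_piMr// norm_sin_le1.
  by rewrite normrM normrN ler_piMr// norm_cos_le1.
have dk' t y : (`](x - 1), (x + 1)[%classic : set R) t -> setT y ->
    derivable (k ^~ y) t 1.
  by move=> _ _; exact: is_derive_derivable (dk t y).
have H1 := @derivable_under_integral R _ _ mu k setT measurableT x _ _ xI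
  (fun t _ => Lk t) dk' G (fun y => addr_ge0 (normr_ge0 _) (normr_ge0 _)) LG Gb.
have H2 := @differentiation_under_integral R _ _ mu k setT measurableT x _ _ xI
  (fun t _ => Lk t) dk' G (fun y => addr_ge0 (normr_ge0 _) (normr_ge0 _)) LG Gb.
have H3 := is_derive_scale c (derivable_is_derive H1).
apply: (@is_derive_ext _ (fun t => c * \int[mu]_y k t y)).
  by move=> t; rewrite fE.
refine (is_deriveE H3 _); congr (_ * _); rewrite H2.
by apply: eq_int => y; exact: (is_derive_derive1 (dk x y)).
Qed.

Lemma powR_abs_cvg0 (th : R) : 0 < th -> `|h| `^ th @[h --> (0 : R)] --> (0 : R).
Proof.
move=> th0; apply/cvgrPdist_lt => e e0.
have p0 : 0 < e `^ th^-1 by rewrite powR_gt0.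
near=> h.
rewrite sub0r normrN ger0_norm ?powR_ge0//.
rewrite -[ltRHS](powRr1 (ltW e0)) -(mulVf (lt0r_neq0 th0)) powRrM.
have hh : `|h| < e `^ th^-1; last first.
  by apply: gt0_ltr_powR => //; rewrite ?nnegrE ?powR_ge0.
near: h; apply/nbhs_ballP; exists (e `^ th^-1) => //= h.
by rewrite /ball/= ?sub0r ?normrN.
Unshelve. all: by end_near. Qed.

(** The excess of [s] over [3 / 2] makes [|xi| ^ (1 + th)] times the transform integrable. One power
    of [xi] pays for the derivative, the remaining [th] for its modulus of continuity; the same [th]
    gives the L^2 rate of the difference quotients. *)
Lemma sobolev_C1 s : 3 / 2 < s -> exists C om, [/\ 0 < C, (forall h, 0 <= om h),
  om h @[h --> (0 : R)] --> (0 : R) &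
  forall f n, 0 < n -> continuous f -> (sobolev_normsq s f < (n ^+ 2)%:E)%E ->
    C1_bounds C om n f].
Proof.
move=> s32.
(* Half of the excess, so that [s - (1 + th)] remains above [1 / 2] as [L1_weight] requires; the cap
   1 is for the trigonometric increments. *)
pose th := Num.min 1 ((s - 3 / 2) / 2).
have th0 : 0 < th by rewrite lt_min ltr01/=; lra.
have th1 : th <= 1 by rewrite ge_min lexx.
have ths : th <= (s - 3 / 2) / 2 by rewrite ge_min lexx orbT.
have s1 : 1 / 2 < s - (1 + th) by lra.
pose J x := 1 + x ^+ 2.
have J0 x : 0 < J x by exact: japanese_gt0.
have J1 x : 1 <= J x by exact: japanese_ge1.
have w0 x : 0 < J x `^ s by rewrite powR_gt0.
have JD r t x : J x `^ (r + t) = J x `^ r * J x `^ t.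
  by rewrite powRD// (lt0r_neq0 (J0 x)) implybT.
pose K := \int[mu]_x (J x `^ (- (s - (1 + th)))).
have LK := L1_weight s1.
have K0 : 0 <= K by apply: int_ge0 => x; exact: powR_ge0.
have phiK (phi : R -> R) : measurable_fun setT phi ->
    (forall x, phi x ^+ 2 <= J x `^ (1 + th)) ->
    L1 (fun x => phi x ^+ 2 / J x `^ s) /\ \int[mu]_x (phi x ^+ 2 / J x `^ s) <= K.
  move=> mphi hphi.
  have b x : phi x ^+ 2 / J x `^ s <= J x `^ (- (s - (1 + th))).
    rewrite ler_pdivrMr// -JD.
    by rewrite (_ : - _ + s = 1 + th)//; ring.
  have L : L1 (fun x => phi x ^+ 2 / J x `^ s).
    apply: (L1_le _ LK) => [|x]; last first.
      by rewrite ger0_norm ?b// divr_ge0 ?sqr_ge0// ltW.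
    apply: measurable_funM; first exact: measurable_funX.
    have -> : (fun x => (J x `^ s)^-1) = (fun x => J x `^ (- s)).
      by apply/funext => x; rewrite powRN.
    exact: meas_japanese.
  by split=> //; exact: le_int.
pose phi2 (x : R) := `|x| * `|x| `^ th.
have phi20 x : 0 <= phi2 x by rewrite mulr_ge0 ?powR_ge0.
have mphi2 : measurable_fun setT phi2.
  apply: measurable_funM => //.
  by apply: (measurableT_comp (measurable_powR th)).
have sqJ x : x ^+ 2 <= J x by rewrite lerDr.
have Jth x : 1 <= J x `^ th by apply: powR_ge1.
have phi1b x : x ^+ 2 <= J x `^ (1 + th).
  rewrite JD.
  rewrite powRr1; last exact: ltW.
  by rewrite (le_trans (sqJ x))// ler_peMr// ltW.
have phi2b x : phi2 x ^+ 2 <= J x `^ (1 + th).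
  rewrite JD.
  rewrite powRr1; last exact: ltW.
  rewrite exprMn real_normK ?num_real//; apply: ler_pM => //.
    by rewrite sqr_ge0.
  rewrite expr2 -powRM// -expr2 real_normK ?num_real//.
  by apply: ge0_ler_powR; rewrite ?nnegrE ?sqr_ge0// ltW.
have Jle x : J x `^ (1 + th) <= J x `^ s.
  by apply: ler_powR => //; lra.
have c0 : 0 <= c by exact: fourier_const_ge0.
(* The first summand serves the uniform modulus of continuity, the 4 the L^2 distance from the
   difference quotient to the derivative. *)
pose Cm := c * (4 * (1 + K)) + 4.
have cK0 : 0 <= c * (4 * (1 + K)) by rewrite !mulr_ge0// addr_ge0.
have Cm0 : 0 <= Cm by rewrite addr_ge0.
exists (c * (2 * (1 + K)) + 1), (fun h => Cm * `|h| `^ th); split.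
- by rewrite ltr_wpDl// !mulr_ge0// addr_ge0.
- by move=> h; rewrite mulr_ge0 ?powR_ge0.
- rewrite -[X in _ --> X](mulr0 Cm); apply: cvgM; first exact: cvg_cst.
  exact: powR_abs_cvg0.
move=> f n n0 cf.
move=> /(sobolev_transform n0)[a [b [hf Lf [ma mb] [La Lb Iab]]]].
have a0 : 0 <= \int[mu]_x (J x `^ s * a x ^+ 2).
  by apply: int_ge0 => x; rewrite mulr_ge0 ?sqr_ge0 ?powR_ge0.
have b0 : 0 <= \int[mu]_x (J x `^ s * b x ^+ 2).
  by apply: int_ge0 => x; rewrite mulr_ge0 ?sqr_ge0 ?powR_ge0.
have Ia : \int[mu]_x (J x `^ s * a x ^+ 2) <= n ^+ 2 by rewrite /J; lra.
have Ib : \int[mu]_x (J x `^ s * b x ^+ 2) <= n ^+ 2 by rewrite /J; lra.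
have W (a' phi : R -> R) : measurable_fun setT a' -> measurable_fun setT phi ->
    L1 (fun x => J x `^ s * a' x ^+ 2) ->
    \int[mu]_x (J x `^ s * a' x ^+ 2) <= n ^+ 2 ->
    (forall x, phi x ^+ 2 <= J x `^ (1 + th)) ->
    L1 (fun x => a' x * phi x) /\ \int[mu]_x `|a' x * phi x| <= (1 + K) * n.
  move=> ma' mphi La' Ia' hphi; have [L1' I1'] := phiK _ mphi hphi.
  exact: (@weighted_integrable _ a' phi _ n K n0 ma' mphi w0 La' Ia' L1' I1').
have one x : (1 : R) ^+ 2 <= J x `^ (1 + th).
  by rewrite expr1n powR_ge1// addr_gt0.
have m1 : forall g, (fun x : R => g x * 1) = g :> (R -> R).
  by move=> g; apply/funext => x; rewrite mulr1.
have E1 g : \int[mu]_x `|g x * 1| = \int[mu]_x `|g x|.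
  by apply: eq_int => x; rewrite mulr1.
have [LA0 IA0] := W a (fun=> 1) ma (measurable_cst _) La Ia one.
have [LB0 IB0] := W b (fun=> 1) mb (measurable_cst _) Lb Ib one.
rewrite !E1 in IA0 IB0; rewrite !m1 in LA0 LB0.
have mid : measurable_fun [set: R] (fun x : R => x) by exact: measurable_id.
have [LA1 IA1] := W a (fun x => x) ma mid La Ia phi1b.
have [LB1 IB1] := W b (fun x => x) mb mid Lb Ib phi1b.
have [LA2 IA2] := W a phi2 ma mphi2 La Ia phi2b.
have [LB2 IB2] := W b phi2 mb mphi2 Lb Ib phi2b.
have fE x := fourier_inversion x cf hf Lf LA0 LB0.
have df := inverse_fourier_derive fE LA0 LB0 LA1 LB1.
have dfE x : derive1 f x =
    c * \int[mu]_y (- (b y * y) * cos (x * y) - (a y * y) * sin (x * y)).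
  exact: is_derive_derive1 (df x).
have na y : `|a y * phi2 y| = `|a y| * phi2 y by rewrite normrM (ger0_norm (phi20 y)).
have nb y : `|b y * phi2 y| = `|b y| * phi2 y by rewrite normrM (ger0_norm (phi20 y)).
have LNB1 : L1 (fun y => - (b y * y)) by exact: L1N.
have mod' x h : `|derive1 f (x + h) - derive1 f x| <= Cm * `|h| `^ th * n.
  have H0 : 0 <= `|h| `^ th by exact: powR_ge0.
  pose k y := - (b y * y) * (cos ((x + h) * y) - cos (x * y)) -
     (a y * y) * (sin ((x + h) * y) - sin (x * y)).
  have kE y : k y = (- (b y * y) * cos ((x + h) * y) - (a y * y) * sin ((x + h) * y)) -
     (- (b y * y) * cos (x * y) - (a y * y) * sin (x * y)) by rewrite /k; ring.
  have L1t t : L1 (fun y => - (b y * y) * cos (t * y) - (a y * y) * sin (t * y)).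
    by apply: L1B; [exact: L1_cos|exact: L1_sin].
  have Lk : L1 k.
    by apply: L1_eq (L1B (L1t (x + h)) (L1t x)) => y; rewrite kE.
  have -> : derive1 f (x + h) - derive1 f x = c * \int[mu]_y k y.
    rewrite !dfE -mulrBr -int_sub//; congr (_ * _); apply: eq_int => y.
    by rewrite kE.
  rewrite normrM (ger0_norm c0).
  have b1 : `|\int[mu]_y k y| <=
      \int[mu]_y (2 * `|h| `^ th * (`|b y * phi2 y| + `|a y * phi2 y|)).
    apply: norm_int_le => //; first by apply: L1Z; apply: L1D; exact: L1_norm.
    move=> y; rewrite /k (le_trans (ler_normB _ _))// [leRHS]mulrDr; apply: lerD.
      rewrite nb normrM normrN normrM /phi2 [(x + h) * y]mulrDl.
      have := cos_increment (x * y) (h * y) th0 th1.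
      rewrite normrM powRM// => hc.
      have -> : 2 * `|h| `^ th * (`|b y| * (`|y| * `|y| `^ th)) =
        `|b y| * `|y| * (2 * (`|h| `^ th * `|y| `^ th)) by ring.
      by rewrite ler_wpM2l// mulr_ge0.
    rewrite na normrM [`|a y * y|]normrM /phi2 [(x + h) * y]mulrDl.
    have := sin_increment (x * y) (h * y) th0 th1.
    rewrite normrM powRM// => hc.
    have -> : 2 * `|h| `^ th * (`|a y| * (`|y| * `|y| `^ th)) =
      `|a y| * `|y| * (2 * (`|h| `^ th * `|y| `^ th)) by ring.
    by rewrite ler_wpM2l// mulr_ge0.
  have b2 : \int[mu]_y (2 * `|h| `^ th * (`|b y * phi2 y| + `|a y * phi2 y|)) <=
      4 * (1 + K) * (`|h| `^ th * n).
    rewrite int_scale; last by apply: L1D; exact: L1_norm.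
    rewrite int_add; [|exact: L1_norm|exact: L1_norm].
    have -> : 4 * (1 + K) * (`|h| `^ th * n) =
      2 * `|h| `^ th * ((1 + K) * n + (1 + K) * n) by ring.
    by apply: ler_wpM2l; [rewrite mulr_ge0|rewrite lerD].
  apply: (le_trans (ler_wpM2l c0 (le_trans b1 b2))).
  have : 0 <= `|h| `^ th * n by rewrite mulr_ge0// ltW.
  have -> : Cm * `|h| `^ th * n = c * (4 * (1 + K) * (`|h| `^ th * n)) + 4 * (`|h| `^ th * n).
    by rewrite /Cm; ring.
  by move=> ?; rewrite lerDl mulr_ge0.
have sqa (A : R -> R) : measurable_fun setT A ->
    (forall x, A x ^+ 2 <= J x `^ s * a x ^+ 2) ->
    L1 (fun x => A x ^+ 2) /\ \int[mu]_x (A x ^+ 2) <= 1 * \int[mu]_x (J x `^ s * a x ^+ 2).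
  move=> mA hA; apply: (@L1_dominated_sqr _ s A a 1) => // x; rewrite mul1r; exact: hA.
have sqb (A : R -> R) : measurable_fun setT A ->
    (forall x, A x ^+ 2 <= J x `^ s * b x ^+ 2) ->
    L1 (fun x => A x ^+ 2) /\ \int[mu]_x (A x ^+ 2) <= 1 * \int[mu]_x (J x `^ s * b x ^+ 2).
  move=> mA hA; apply: (@L1_dominated_sqr _ s A b 1) => // x; rewrite mul1r; exact: hA.
have Js1 x : 1 <= J x `^ s by apply: powR_ge1 => //; lra.
split.
- by move=> x; apply: derivable_is_derive; exact: is_derive_derivable (df x).
- move=> x; apply/cvgrPdist_le => e e0.
  have : (Cm * `|h| `^ th * n) @[h --> (0 : R)] --> (0 : R).
    rewrite -[X in _ --> X](mul0r n) -[X in X * n](mulr0 Cm).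
    apply: cvgM; last exact: cvg_cst.
    by apply: cvgM; [exact: cvg_cst|exact: powR_abs_cvg0].
  move=> /cvgrPdist_lt/(_ e e0)/nbhs_ballP[d /= d0 hd].
  apply/nbhs_ballP; exists d => //= t.
  rewrite /ball/= => td; rewrite distrC.
  have -> : t = x + (t - x) by rewrite addrCA subrr addr0.
  apply: (le_trans (mod' _ _)).
  have /hd : ball 0 d (t - x) by rewrite /ball/= sub0r normrN distrC.
  by rewrite sub0r normrN => /ltW; apply: le_trans; exact: ler_norm.
- move=> x; rewrite (le_trans (inverse_fourier_le LA0 LB0 (fE x)))//.
  have : c * (\int[mu]_y `|a y| + \int[mu]_y `|b y|) <= c * (2 * ((1 + K) * n)).
    by rewrite ler_wpM2l//; lra.
  move=> hh; apply: (le_trans hh).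
  have -> : (c * (2 * (1 + K)) + 1) * n = c * (2 * ((1 + K) * n)) + n by ring.
  by rewrite lerDl ltW.
- move=> x; rewrite (le_trans (inverse_fourier_le LNB1 LA1 (dfE x)))//.
  have -> : \int[mu]_y `|- (b y * y)| = \int[mu]_y `|b y * y|.
    by apply: eq_int => y; rewrite normrN.
  have : c * (\int[mu]_y `|b y * y| + \int[mu]_y `|a y * y|) <= c * (2 * ((1 + K) * n)).
    by rewrite ler_wpM2l//; lra.
  move=> hh; apply: (le_trans hh).
  have -> : (c * (2 * (1 + K)) + 1) * n = c * (2 * ((1 + K) * n)) + n by ring.
  by rewrite lerDl ltW.
- exact: mod'.
- have [L1a I1a] : L1 (fun x => a x ^+ 2) /\ \int[mu]_x (a x ^+ 2) <= 1 * \int[mu]_x (J x `^ s * a x ^+ 2).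
    by apply: sqa => // x; rewrite ler_peMl ?sqr_ge0.
  have [L1b I1b] : L1 (fun x => b x ^+ 2) /\ \int[mu]_x (b x ^+ 2) <= 1 * \int[mu]_x (J x `^ s * b x ^+ 2).
    by apply: sqb => // x; rewrite ler_peMl ?sqr_ge0.
  have [Lp Ip] := plancherel_le fE LA0 LB0 L1a L1b.
  by split=> //; rewrite /J in I1a I1b; lra.
- have hx x : x ^+ 2 <= J x `^ s by exact: le_trans (phi1b x) (Jle x).
  have [L1a I1a] : L1 (fun x => (a x * x) ^+ 2) /\ \int[mu]_x ((a x * x) ^+ 2) <= 1 * \int[mu]_x (J x `^ s * a x ^+ 2).
    apply: sqa => [|x]; first exact: L1_measurable.
    by rewrite exprMn mulrC ler_wpM2r ?sqr_ge0.
  have [L1b I1b] : L1 (fun x => (- (b x * x)) ^+ 2) /\ \int[mu]_x ((- (b x * x)) ^+ 2) <= 1 * \int[mu]_x (J x `^ s * b x ^+ 2).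
    apply: sqb => [|x]; first exact: L1_measurable.
    by rewrite sqrrN exprMn mulrC ler_wpM2r ?sqr_ge0.
  have [Lp Ip] := plancherel_le dfE LNB1 LA1 L1b L1a.
  by split=> //; rewrite /J in I1a I1b; lra.
- move=> h h0.
  (* Real and imaginary parts of [(exp (i h y) - 1) / h - i y], the symbol of the difference
     quotient minus the derivative; [A + i B] is its product with [a + i b]. *)
  pose al y := (cos (h * y) - 1) / h; pose be y := sin (h * y) / h - y.
  pose A y := a y * al y - b y * be y; pose B y := a y * be y + b y * al y.
  set H := `|h| `^ th; have H0 : 0 <= H by exact: powR_ge0.
  have nh0 : 0 < `|h| by rewrite normr_gt0.
  have mal : measurable_fun setT al.
    apply: cont_meas; apply: cont_mul; last exact: cont_cst.
    by apply: cont_sub; [exact: cont_cos_lin|exact: cont_cst].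
  have mbe : measurable_fun setT be.
    apply: cont_meas; apply: cont_sub; last exact: cont_id.
    by apply: cont_mul; [exact: cont_sin_lin|exact: cont_cst].
  have alb y : `|al y| <= 2 * H * phi2 y.
    rewrite /al normrM normfV ler_pdivrMr//.
    have := cosB1_bound (h * y) th0 th1; rewrite !normrM powRM// => hh.
    by apply: (le_trans hh); rewrite /phi2 -/H; nra.
  have beb y : `|be y| <= 2 * H * phi2 y.
    have -> : be y = (sin (h * y) - h * y) / h by rewrite /be; field.
    rewrite normrM normfV ler_pdivrMr//.
    have := sinB_bound (h * y) th0 th1; rewrite !normrM powRM// => hh.
    by apply: (le_trans hh); rewrite /phi2 -/H; nra.
  have mA : measurable_fun setT A by apply: measurable_funB; exact: measurable_funM.
  have mB : measurable_fun setT B by apply: measurable_funD; exact: measurable_funM.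
  pose G y := 2 * H * (`|a y * phi2 y| + `|b y * phi2 y|).
  have LG : L1 G by apply: L1Z; apply: L1D; exact: L1_norm.
  have GE y : G y = `|a y| * (2 * H * phi2 y) + `|b y| * (2 * H * phi2 y).
    by rewrite /G na nb; ring.
  have LA : L1 A.
    apply: (L1_le mA LG) => y; rewrite GE (le_trans (ler_normB _ _))//.
    by apply: lerD; rewrite normrM ler_wpM2l.
  have LB : L1 B.
    apply: (L1_le mB LG) => y; rewrite GE (le_trans (ler_normD _ _))//.
    by apply: lerD; rewrite normrM ler_wpM2l.
  have sq t y : `|t| <= 2 * H * phi2 y -> t ^+ 2 <= 4 * H ^+ 2 * J y `^ s.
    move=> ht; rewrite -(real_normK (num_real t)).
    apply: (@le_trans _ _ ((2 * H * phi2 y) ^+ 2)).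
      by rewrite lerXn2r ?nnegrE// !mulr_ge0.
    rewrite exprMn [(2 * H) ^+ 2]exprMn; have -> : 2 ^+ 2 = 4 :> R by ring.
    apply: ler_wpM2l; first by rewrite mulr_ge0 ?sqr_ge0.
    exact: le_trans (phi2b y) (Jle y).
  have bnd (D : R -> R) (p q : R -> R) : measurable_fun setT D ->
     (forall y, D y = a y * p y + b y * q y) ->
     (forall y, `|p y| <= 2 * H * phi2 y) -> (forall y, `|q y| <= 2 * H * phi2 y) ->
     L1 (fun y => D y ^+ 2) /\ \int[mu]_y (D y ^+ 2) <= 8 * H ^+ 2 * n ^+ 2.
    move=> mD DE hp hq.
    have Lab : L1 (fun y => 8 * H ^+ 2 * (J y `^ s * a y ^+ 2 + J y `^ s * b y ^+ 2)).
      by apply: L1Z; exact: L1D.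
    have bD y : D y ^+ 2 <= 8 * H ^+ 2 * (J y `^ s * a y ^+ 2 + J y `^ s * b y ^+ 2).
      have h1 : D y ^+ 2 <= 2 * (a y ^+ 2 * p y ^+ 2 + b y ^+ 2 * q y ^+ 2).
        by rewrite DE; have := sqr_ge0 (a y * p y - b y * q y); nra.
      apply: (le_trans h1).
      have -> : 8 * H ^+ 2 * (J y `^ s * a y ^+ 2 + J y `^ s * b y ^+ 2) =
        2 * (a y ^+ 2 * (4 * H ^+ 2 * J y `^ s) + b y ^+ 2 * (4 * H ^+ 2 * J y `^ s)) by ring.
      rewrite ler_pM2l// lerD// ler_wpM2l ?sqr_ge0//.
        by apply: sq; exact: hp.
      by apply: sq; exact: hq.
    have LD : L1 (fun y => D y ^+ 2).
      apply: (L1_le _ Lab) => [|y]; first exact: measurable_funX.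
      by rewrite ger0_norm ?sqr_ge0.
    split=> //; apply: (le_trans (le_int LD Lab bD)).
    rewrite int_scale; last exact: L1D.
    by rewrite ler_wpM2l ?mulr_ge0 ?sqr_ge0// int_add.
  have [LA' IA'] : L1 (fun y => A y ^+ 2) /\ \int[mu]_y (A y ^+ 2) <= 8 * H ^+ 2 * n ^+ 2.
    apply: (bnd A al (fun y => - be y)) => // y; first by rewrite /A; ring.
    by rewrite normrN.
  have [LB' IB'] : L1 (fun y => B y ^+ 2) /\ \int[mu]_y (B y ^+ 2) <= 8 * H ^+ 2 * n ^+ 2.
    by apply: (bnd B be al).
  have gE x : (f (x + h) - f x) / h - derive1 f x =
      c * \int[mu]_y (A y * cos (x * y) - B y * sin (x * y)).
    rewrite dfE !fE.
    have L0 t : L1 (fun y => a y * cos (t * y) - b y * sin (t * y)).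
      by apply: L1B; [exact: L1_cos|exact: L1_sin].
    have Ld : L1 (fun y => - (b y * y) * cos (x * y) - (a y * y) * sin (x * y)).
      by apply: L1B; [exact: L1_cos|exact: L1_sin].
    have -> : \int[mu]_y (A y * cos (x * y) - B y * sin (x * y)) =
      h^-1 * (\int[mu]_y (a y * cos ((x + h) * y) - b y * sin ((x + h) * y)) -
        \int[mu]_y (a y * cos (x * y) - b y * sin (x * y))) -
      \int[mu]_y (- (b y * y) * cos (x * y) - (a y * y) * sin (x * y)).
      rewrite -int_sub// -int_scale; last exact: L1B.
      rewrite -int_sub//; last by apply: L1Z; exact: L1B.
      apply: eq_int => y; rewrite /A /B /al /be [(x + h) * y]mulrDl cosD sinD.
      by field.
    set I1 := Rintegral _ _ _; set I2 := Rintegral _ _ _; set I3 := Rintegral _ _ _.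
    by rewrite -/c; move: (c) I1 I2 I3 => c' I1 I2 I3; field.
  have [Lp Ip] := plancherel_le gE LA LB LA' LB'.
  split=> //; apply: (le_trans Ip); apply: (le_trans (lerD IA' IB')).
  have -> : 8 * H ^+ 2 * n ^+ 2 + 8 * H ^+ 2 * n ^+ 2 = (4 * H * n) ^+ 2 by ring.
  rewrite lerXn2r ?nnegrE ?mulr_ge0//; try exact: ltW.
  by rewrite ler_pM2r// ler_wpM2r// lerDr.
Qed.

End sobolev_C1.

(** * Helmholtz kernel *)

(** One half of [exp (- |z|)]: cut at its kink, the Helmholtz kernel yields two one-sided averages,
    each solving a first order differential equation. *)
Definition exp_half (R : realType) : R -> R :=
  (fun z => expR (- z)) \_ `[0, +oo[.

(* [sg = -1] averages [f] over [(-oo, x]] and [sg = 1] over [[x, +oo)]. *)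
Definition exp_avg (R : realType) (sg : R) (f : R -> R) (x : R) : R :=
  \int[lebesgue_measure]_z (exp_half z * f (x + sg * z)).

Section helmholtz_kernel.
Context {R : realType}.
Notation mu := (@lebesgue_measure R).
Notation eh := (@exp_half R).
Implicit Types (f g m : R -> R) (h x z M sg : R).

Lemma exp_half_ge0 z : 0 <= eh z.
Proof. by rewrite /exp_half patchE; case: ifP => // _; exact: expR_ge0. Qed.

Lemma exp_half_meas : measurable_fun setT eh.
Proof.
have m1 : measurable_fun [set: R] (fun z : R => expR (- z)).
  by apply: cont_meas; apply: cont_comp; [exact: (cont_opp cont_id)|exact: continuous_expR].
have mi : measurable (`[0, +oo[%classic : set R) by exact: measurable_itv.
apply/(measurable_restrict _ mi measurableT).
by apply: measurable_funS m1.
Qed.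

Lemma exp_half_le z : eh z <= expR (- (1 * `|z|)).
Proof.
rewrite /exp_half patchE; case: ifPn => [|_]; last exact: expR_ge0.
by rewrite inE/= in_itv/= andbT => z0; rewrite mul1r ger0_norm.
Qed.

Lemma L1_exp_half : L1 eh.
Proof.
apply: (L1_le exp_half_meas (int_exp_abs (@ltr01 R)).1) => z.
by rewrite ger0_norm ?exp_half_ge0// exp_half_le.
Qed.

Lemma int_exp_half : \int[mu]_z eh z = 1.
Proof.
rewrite -Rintegral_mkcond.
have dF z : is_derive z (1 : R) (fun z => - expR (- z)) (expR (- z)).
  have h := is_derive_opp (is_derive_comp (is_derive_expR _) (is_derive_opp (is_derive_x z))).
  by refine (is_deriveE h _); ring.
have ce : continuous (fun z : R => expR (- z)).
  by apply: cont_comp; [exact: (cont_opp cont_id)|exact: continuous_expR].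
rewrite (@Rintegral_ge0_continuous_FTC2y _ (fun z => expR (- z)) (fun z => - expR (- z)) 0 0).
- by rewrite oppr0 expR0 sub0r opprK.
- by move=> z _; exact: expR_ge0.
- exact: continuous_subspaceT.
- by rewrite -[X in _ --> X]oppr0; apply: cvgN; exact: cvgr_expR.
- by move=> z _; exact: is_derive_derivable (dF z).
- by apply: cvg_at_right_cont; exact: is_derive_continuous dF.
- by move=> z _; exact: is_derive_derive1 (dF z).
Qed.

Lemma cont_affine f x sg : continuous f -> continuous (fun z => f (x + sg * z)).
Proof.
move=> cf; apply: cont_comp => //; apply: cont_add; first exact: cont_cst.
by apply: cont_mul; [exact: cont_cst|exact: cont_id].
Qed.

Lemma L1_exp_avg f M sg x : continuous f -> (forall y, `|f y| <= M) ->
  L1 (fun z => eh z * f (x + sg * z)).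
Proof.
move=> cf fM; apply: (@L1_mul_bounded _ eh (fun z => f (x + sg * z)) M) => //.
  exact: L1_exp_half.
by apply: cont_meas; exact: cont_affine.
Qed.

Lemma exp_avg_le f M sg x : continuous f -> (forall y, `|f y| <= M) ->
  `|exp_avg sg f x| <= M.
Proof.
move=> cf fM; have -> : M = \int[mu]_z (M * eh z).
  by rewrite int_scale ?int_exp_half ?mulr1//; exact: L1_exp_half.
apply: norm_int_le; [exact: L1_exp_avg fM|by apply: L1Z; exact: L1_exp_half|].
move=> z; rewrite normrM mulrC (ger0_norm (exp_half_ge0 z)).
by rewrite ler_wpM2r// exp_half_ge0.
Qed.

Lemma exp_avg_add f g Mf Mg sg x : continuous f -> continuous g ->
  (forall y, `|f y| <= Mf) -> (forall y, `|g y| <= Mg) ->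
  exp_avg sg (fun y => f y + g y) x = exp_avg sg f x + exp_avg sg g x.
Proof.
move=> cf cg fM gM; rewrite /exp_avg -int_add.
- by apply: eq_int => z; rewrite mulrDr.
- exact: L1_exp_avg fM.
- exact: L1_exp_avg gM.
Qed.

Lemma exp_avg_scale f M k sg x : continuous f -> (forall y, `|f y| <= M) ->
  exp_avg sg (fun y => k * f y) x = k * exp_avg sg f x.
Proof.
move=> cf fM; rewrite /exp_avg -int_scale; last exact: L1_exp_avg fM.
by apply: eq_int => z; rewrite mulrCA.
Qed.

Lemma exp_avg_shift f h sg x :
  exp_avg sg (fun y => f (y + h)) x = exp_avg sg f (x + h).
Proof. by apply: eq_int => z; rewrite addrAC. Qed.

(** The average is [exp (- x)] times the integral of [exp y * f y] over [(-oo, x]]; the product rule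
    and the fundamental theorem of calculus apply. *)
Lemma exp_avg_derive_left f M x : continuous f -> (forall y, `|f y| <= M) ->
  is_derive x (1 : R) (exp_avg (-1) f) (f x - exp_avg (-1) f x).
Proof.
move=> cf fM.
pose F x := \int[mu]_(y in `]-oo, x]) (expR y * f y).
have gE u y : (fun y => expR y * f y) \_ `]-oo, u] y = expR u * (eh (u - y) * f y).
  rewrite /exp_half !patchE mem_setE in_itv/= mem_setE in_itv/= andbT subr_ge0.
  case: ifP => // _; last by rewrite mul0r mulr0.
  by rewrite mulrA -expRD; congr (expR _ * _); ring.
have Lg u : L1 (fun y => eh (u - y) * f y).
  have h := L1_shift (- u) (L1_opp (@L1_exp_avg f M (-1) u cf fM)).
  apply: L1_eq h => y /=.
  by rewrite mulN1r opprK (addrC y) addNKr opprD opprK addrC.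
have AE u : exp_avg (-1) f u = expR (- u) * F u.
  rewrite /F Rintegral_mkcond (eq_int (gE u)) (int_scale _ (Lg u)) mulrA.
  rewrite -expRD addNr expR0 mul1r -(int_shift u (Lg u)).
  rewrite -(int_opp (L1_shift u (Lg u))); apply: eq_int => z.
  by rewrite opprD opprK addrCA subrr addr0 mulN1r addrC.
have intF u : mu.-integrable `]-oo, u] (EFin \o (fun y => expR y * f y)).
  have mi : measurable (`]-oo, u]%classic : set (measurableTypeR R)).
    exact: measurable_itv.
  apply/(integrable_mkcond _ mi); rewrite restrict_EFin.
  have : L1 ((fun y => expR y * f y) \_ `]-oo, u]).
    by apply: L1_eq (L1Z (expR u) (Lg u)) => y; rewrite gE.
  by [].
have cef : continuous (fun y => expR y * f y).
  by apply: cont_mul => //; exact: continuous_expR.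
have x1 : x < x + 1 by rewrite ltrDl.
have [dF EF] := continuous_FTC1 x1 (intF (x + 1)) (ltNyr _) (cef x).
have dF' : is_derive x (1 : R) F (expR x * f x).
  by have := derivable_is_derive dF; rewrite EF.
have dE : is_derive x (1 : R) (fun z : R => expR (- z)) (- expR (- x)).
  have h := is_derive_comp (is_derive_expR _) (is_derive_opp (is_derive_x x)).
  by refine (is_deriveE h _); ring.
apply: (@is_derive_ext _ (fun u => expR (- u) * F u)).
  by move=> u; rewrite AE.
refine (is_deriveE (is_derive_mul dE dF') _).
by rewrite AE mulrA -expRD addNr expR0 mul1r; ring.
Qed.

Lemma exp_avg_opp f sg x :
  exp_avg (- sg) f x = exp_avg sg (fun y => f (- y)) (- x).
Proof. by apply: eq_int => z; rewrite opprD opprK mulNr. Qed.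

Lemma exp_avg_derive_right f M x : continuous f -> (forall y, `|f y| <= M) ->
  is_derive x (1 : R) (exp_avg 1 f) (exp_avg 1 f x - f x).
Proof.
move=> cf fM.
have E u : exp_avg 1 f u = exp_avg (-1) (fun y => f (- y)) (- u).
  by rewrite -exp_avg_opp opprK.
apply: (@is_derive_ext _ (fun u => exp_avg (-1) (fun y => f (- y)) (- u))).
  by move=> u; rewrite E.
have cf' : continuous (fun y => f (- y)).
  by apply: cont_comp => //; exact: (cont_opp cont_id).
have h := is_derive_reflect (@exp_avg_derive_left _ M (- x) cf' (fun y => fM (- y))).
by refine (is_deriveE h _); rewrite opprK E; ring.
Qed.

Lemma exp_avg_sum f M x : continuous f -> (forall y, `|f y| <= M) ->
  exp_avg (-1) f x + exp_avg 1 f x = \int[mu]_z (expR (- `|z|) * f (x + z)).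
Proof.
move=> cf fM.
pose k z := expR (- `|z|) * f (x + z).
have ck : continuous (fun z => f (x + z)).
  have := @cont_affine f x 1 cf.
  by under eq_fun do rewrite mul1r.
have Lk : L1 k.
  apply: (@L1_mul_bounded _ (fun z => expR (- `|z|)) (fun z => f (x + z)) M) => //.
    by apply: L1_eq (int_exp_abs (@ltr01 R)).1 => z; rewrite mul1r.
  exact: cont_meas.
have mi1 : measurable (`]-oo, 0[%classic : set (measurableTypeR R)).
  exact: measurable_itv.
have mi2 : measurable (`[0, +oo[%classic : set (measurableTypeR R)).
  exact: measurable_itv.
have U : (`]-oo, 0[%classic `|` `[0, +oo[%classic : set R) = setT.
  apply/seteqP; split => z //= _; rewrite !in_itv/= andbT.
  by have [_|_] := leP 0 z; [right|left].
have -> : \int[mu]_z k z = \int[mu]_(z in `]-oo, 0[) k z + \int[mu]_(z in `[0, +oo[) k z.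
  rewrite -Rintegral_setU//; first by rewrite U.
    by rewrite U; exact: Lk.
  apply/disj_setPS => z /=; rewrite !in_itv/= andbT => -[z0 z1].
  by move: (lt_le_trans z0 z1); rewrite ltxx.
rewrite Rintegral_itv_bndo_bndc; last exact: integrableS Lk.
rewrite [X in _ = X + _]Rintegral_mkcond [X in _ = _ + X]Rintegral_mkcond.
congr (_ + _).
  rewrite [LHS]/exp_avg -(int_opp (@L1_exp_avg f M (-1) x cf fM)).
  apply: eq_int => z; rewrite /exp_half !patchE mem_setE in_itv/= mem_setE in_itv/= andbT oppr_ge0.
  case: ifP => [z0|_]; last by rewrite mul0r.
  by rewrite /k ler0_norm// opprK mulN1r opprK.
apply: eq_int => z; rewrite /exp_half !patchE mem_setE in_itv/= andbT.
case: ifP => [z0|_]; last by rewrite mul0r.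
by rewrite /k ger0_norm// mul1r.
Qed.

(** The two averages are taken over complementary half-lines, so the L^1 norm is counted once, not
    twice. This gives the factor 1/2 of [C1] and [C2]. *)
Lemma exp_avg_norm_le f M x : continuous f -> (forall y, `|f y| <= M) -> L1 f ->
  `|exp_avg (-1) f x| + `|exp_avg 1 f x| <= \int[mu]_y `|f y|.
Proof.
move=> cf fM Lf.
have cf' := cont_norm cf.
have fM' y : `| `|f y| | <= M by rewrite normr_id.
have le sg : `|exp_avg sg f x| <= exp_avg sg (fun y => `|f y|) x.
  apply: norm_int_le; [exact: L1_exp_avg fM|exact: L1_exp_avg fM'|].
  by move=> z; rewrite normrM (ger0_norm (exp_half_ge0 z)).
apply: (le_trans (lerD (le _) (le _))); rewrite (exp_avg_sum x cf' fM').
rewrite -(int_shift x (L1_norm Lf)).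
have Ls : L1 (fun z => `|f (z + x)|) by exact: (L1_shift x (L1_norm Lf)).
apply: le_int => //.
  apply: L1_le Ls _.
    apply: cont_meas; apply: cont_mul.
      apply: cont_comp; last exact: continuous_expR.
      by apply: cont_opp; exact: (cont_norm cont_id).
    have := @cont_affine _ x 1 cf'.
    by under eq_fun do rewrite mul1r.
  move=> z; rewrite normrM normr_id [x + z]addrC ler_piMl// (ger0_norm (expR_ge0 _)).
  by rewrite expR_le1 oppr_le0.
by move=> z; rewrite [x + z]addrC ler_piMl// expR_le1 oppr_le0.
Qed.

Lemma convolution_helmholtz f M x : continuous f -> (forall y, `|f y| <= M) ->
  convolution (@helmholtz R) f x = 2^-1 * (exp_avg (-1) f x + exp_avg 1 f x).
Proof.
move=> cf fM; rewrite (exp_avg_sum x cf fM) /convolution /helmholtz.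
have ck : continuous (fun z => f (z + x)) by exact: cont_shift.
have L0 : L1 (fun z => expR (- `|z|) * f (z + x)).
  apply: (@L1_mul_bounded _ (fun z => expR (- `|z|)) (fun z => f (z + x)) M) => //.
    by apply: L1_eq (int_exp_abs (@ltr01 R)).1 => z; rewrite mul1r.
  exact: cont_meas.
have L : L1 (fun y => 2^-1 * expR (- `|x - y|) * f y).
  apply: L1_eq (L1Z 2^-1 (L1_shift (- x) L0)) => y /=.
  by rewrite subrK mulrA distrC.
rewrite -(int_shift x L) -int_scale.
  apply: eq_int => z; rewrite opprD addrCA subrr addr0 normrN mulrA.
  by rewrite [z + x]addrC.
by apply: L1_eq L0 => z; rewrite addrC.
Qed.

(** Fubini and the substitution [x - sg * z] for [x]: the adjoint averages over the opposite side.
    Only [f] is integrable; [m] is merely bounded. *)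
Lemma exp_avg_adjoint f m Mf Mm sg : continuous f -> (forall y, `|f y| <= Mf) ->
  L1 f -> continuous m -> (forall y, `|m y| <= Mm) ->
  [/\ L1 (fun x => exp_avg sg f x * m x), L1 (fun x => f x * exp_avg (- sg) m x) &
    \int[mu]_x (exp_avg sg f x * m x) = \int[mu]_x (f x * exp_avg (- sg) m x)].
Proof.
move=> cf fM Lf cm mM.
pose F (p : R * R) : R := eh p.1 * (f (p.2 + sg * p.1) * m p.2).
have ms : measurable_fun setT (fun p : R * R => p.2 + sg * p.1).
  by apply: measurable_funD => //; apply: measurable_funM.
have ms' : measurable_fun setT (fun p : R * R => p.2 + (- sg) * p.1).
  by apply: measurable_funD => //; apply: measurable_funM.
have mF : measurable_fun setT F.
  apply: measurable_funM; first exact: (measurableT_comp exp_half_meas).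
  apply: measurable_funM; first exact: (measurableT_comp (cont_meas cf) ms).
  by apply: (measurableT_comp (cont_meas cm)).
have Lfs z : L1 (fun x => f (x + sg * z) * m x).
  apply: L1_mul_bounded mM; first exact: L1_shift.
  exact: cont_meas.
have LF1 z : L1 (fun x => F (z, x)) by exact (L1Z (eh z) (Lfs z)).
have LF2 x : L1 (fun z => F (z, x)).
  apply: (@L1_eq _ (fun z => m x * (eh z * f (x + sg * z)))).
    by move=> z; rewrite /F/=; ring.
  by apply: L1Z; exact: L1_exp_avg fM.
have bF z : \int[mu]_x `|F (z, x)| <= (Mm * \int[mu]_x `|f x|) * eh z.
  have -> : Mm * (\int[mu]_x `|f x|) * eh z = \int[mu]_x (eh z * Mm * `|f (x + sg * z)|).
    rewrite int_scale; last exact: (L1_shift _ (L1_norm Lf)).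
    by rewrite (int_shift (sg * z) (L1_norm Lf)); ring.
  apply: le_int; first exact/L1_norm/LF1.
    by apply: L1Z; exact: (L1_shift _ (L1_norm Lf)).
  move=> x; rewrite /F/= !normrM (ger0_norm (exp_half_ge0 z)) -mulrA.
  by rewrite ler_wpM2l ?exp_half_ge0// mulrC ler_wpM2r.
have [_ H2 H3] := Fubini_L1 mF LF1 LF2 (L1Z (Mm * \int[mu]_x `|f x|) L1_exp_half) bF.
have mk : measurable_fun setT (fun p : R * R => m (p.2 + (- sg) * p.1)).
  exact: (measurableT_comp (cont_meas cm) ms').
have [_ H4 H5] := Fubini_kernel L1_exp_half Lf mk (fun p => mM _).
have E1 x : exp_avg sg f x * m x = \int[mu]_z F (z, x).
  rewrite mulrC /exp_avg -int_scale; last exact: L1_exp_avg fM.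
  by apply: eq_int => z; rewrite /F/=; ring.
have E2 x : f x * exp_avg (- sg) m x = \int[mu]_z (eh z * f x * m (x + - sg * z)).
  rewrite /exp_avg -int_scale; last exact: L1_exp_avg mM.
  by apply: eq_int => z; ring.
split.
- by apply: L1_eq H2 => x; rewrite E1.
- by apply: L1_eq H4 => x; rewrite E2.
rewrite (eq_int E1) (eq_int E2) -H3 -H5; apply: eq_int => z.
rewrite /F/= int_scale//.
have Lms : L1 (fun x => f x * m (x + - sg * z)).
  by apply: L1_mul_bounded (fun x => mM _) => //; apply: cont_meas; exact: cont_shift.
have -> : \int[mu]_x (f (x + sg * z) * m x) = \int[mu]_x (f x * m (x + - sg * z)).
  rewrite -[RHS](int_shift (sg * z) Lms); apply: eq_int => x.
  by rewrite -addrA mulNr subrr addr0.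
by rewrite -int_scale//; apply: eq_int => x; rewrite mulrA.
Qed.

End helmholtz_kernel.

(** * Vanishing integrals of derivatives, and difference quotients *)

Section energy_rate.
Context {R : realType}.
Notation mu := (@lebesgue_measure R).
Implicit Types (f g m q r t : R -> R) (h x y z s w M : R).

(** No decay of [f] at infinity is invoked: averaging [f'] over shifts in [[0, 1]] leaves its
    integral unchanged and turns the integrand into [f (x + 1) - f x], of integral 0. *)
Lemma int_derive0 f f' : (forall x, is_derive x (1 : R) f (f' x)) ->
  continuous f' -> L1 f -> L1 f' -> \int[mu]_x f' x = 0.
Proof.
move=> df cf' Lf Lf'.
pose ind : R -> R := (fun _ : R => 1 : R) \_ `[0, 1].
have Lind : L1 ind by exact (@L1_trunc_itv R (fun _ => 1) 0 1 (@cont_cst R 1)).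
pose F (p : R * R) : R := ind p.1 * f' (p.2 + p.1).
have mF : measurable_fun setT F.
  apply: measurable_funM.
    by apply: (measurableT_comp (L1_measurable Lind)).
  by apply: (measurableT_comp (cont_meas cf')); apply: measurable_funD.
have ind01 (s : R) : 0 <= ind s /\ ind s <= 1.
  by rewrite /ind patchE; case: ifP => _; split.
have LF1 s : L1 (fun x => F (s, x)) by exact: (L1Z (ind s) (L1_shift s Lf')).
have LF2E x : (fun s => F (s, x)) = (fun s => f' (x + s)) \_ `[0, 1].
  apply/funext => s; rewrite /F/= /ind !patchE; case: ifP => _.
    by rewrite mul1r.
  by rewrite mul0r.
have cfs x : continuous (fun s => f' (x + s)).
  by have := @cont_shift _ f' x cf'; under eq_fun do rewrite addrC.
have LF2 x : L1 (fun s => F (s, x)) by rewrite LF2E; exact: L1_trunc_itv.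
have bF s : \int[mu]_x `|F (s, x)| <= (\int[mu]_x `|f' x|) * ind s.
  rewrite /F/=; have [i0 _] := ind01 s.
  have -> : (\int[mu]_x `|f' x|) * ind s = \int[mu]_x (ind s * `|f' (x + s)|).
    rewrite int_scale; last exact: (L1_shift s (L1_norm Lf')).
    by rewrite (int_shift s (L1_norm Lf')) mulrC.
  rewrite le_eqVlt; apply/orP; left; apply/eqP; apply: eq_int => x.
  by rewrite normrM (ger0_norm i0).
have [H1 H2 H3] := Fubini_L1 mF LF1 LF2 (L1Z (\int[mu]_x `|f' x|) Lind) bF.
have e1 s : \int[mu]_x F (s, x) = (\int[mu]_x f' x) * ind s.
  by rewrite /F/= (int_scale _ (L1_shift s Lf')) (int_shift s Lf') mulrC.
have e2 x : \int[mu]_s F (s, x) = f (x + 1) - f x.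
  have dfs s : is_derive s (1 : R) (fun s => f (x + s)) (f' (x + s)).
    have -> : (fun s => f (x + s)) = (fun s => f (s + x)).
      by apply/funext => r; rewrite addrC.
    by apply: is_derive_translate; rewrite addrC.
  rewrite LF2E -Rintegral_mkcond (int_deriv dfs (cfs x) ler01).
  by rewrite addr0.
have := H3; rewrite (eq_int e1) (eq_int e2) (int_scale _ Lind).
rewrite int_sub//; last exact: L1_shift.
rewrite (int_shift 1 Lf) subrr.
have -> : \int[mu]_s ind s = 1.
  rewrite /ind -Rintegral_mkcond.
  have d1 s : is_derive s (1 : R) (fun s : R => s) ((fun=> 1) s) by exact: is_derive_x.
  by rewrite (int_deriv d1 (@cont_cst R 1) ler01) subr0.
by rewrite mulr1.
Qed.

Definition diff_quot f h x := (f (x + h) - f x) / h.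
(** Minus the L^2 adjoint of [diff_quot], applied to [diff_quot f h]. Hence [f - second_quot f h] is
    half the gradient of the discrete energy. *)
Definition second_quot f h x := (f (x + h) - 2 * f x + f (x - h)) / h ^+ 2.

Lemma diff_quot_near f f' h x w : 0 < h ->
  (forall x, is_derive x (1 : R) f (f' x)) ->
  (forall y, `|y| <= h -> `|f' (x + y) - f' x| <= w) ->
  `|diff_quot f h x - f' x| <= w.
Proof.
move=> h0 df fw; have xh : x <= x + h by rewrite lerDl ltW.
have [z /andP[xz zh]] := mean_value df xh.
rewrite /diff_quot [x + h - x]addrAC subrr add0r => ->; rewrite mulfK ?gt_eqF//.
have -> : z = x + (z - x) by rewrite addrCA subrr addr0.
by apply: fw; rewrite ger0_norm ?subr_ge0// lerBlDl.
Qed.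

(** The mean value theorem is used twice, on the even function [psi] and then on [r] over
    [[x - z, x + z]], so only continuity of the second derivative [t] is needed. *)
Lemma second_quot_near q r t h x w : 0 < h ->
  (forall x, is_derive x (1 : R) q (r x)) ->
  (forall x, is_derive x (1 : R) r (t x)) ->
  (forall y, `|y| <= h -> `|t (x + y) - t x| <= w) ->
  `|second_quot q h x - t x| <= 2 * w.
Proof.
move=> h0 dq dr tw.
pose psi y := q (x + y) + q (x - y) - t x * y ^+ 2.
pose dpsi y := r (x + y) - r (x - y) - t x * (2 * y).
have dpsiE y : is_derive y (1 : R) psi (dpsi y).
  have h1 : is_derive y (1 : R) (fun y => q (x + y)) (r (x + y)).
    have -> : (fun y => q (x + y)) = (fun y => q (y + x)).
      by apply/funext => u; rewrite addrC.
    by apply: is_derive_translate; rewrite addrC.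
  have h2 : is_derive y (1 : R) (fun y => q (x - y)) (- r (x - y)).
    have hq : is_derive (- y) (1 : R) (fun y => q (x + y)) (r (x - y)).
      have -> : (fun y => q (x + y)) = (fun y => q (y + x)).
        by apply/funext => u; rewrite addrC.
      by apply: is_derive_translate; rewrite addrC.
    exact: (is_derive_reflect hq).
  have h3 := is_derive_scale (t x) (is_derive_sqr (is_derive_x y)).
  refine (is_deriveE (is_derive_sub (is_derive_add h1 h2) h3) _).
  by rewrite /dpsi; ring.
have [z /andP[z0 zh] E] := mean_value dpsiE (ltW h0).
have xz : x - z <= x + z by rewrite lerD2l ge0_cp// oppr_le0.
have [y /andP[y1 y2] Ey] := mean_value dr xz.
have w0 : 0 <= w by apply: le_trans (tw 0 _); rewrite ?normr0 // ltW.
have dz : dpsi z = 2 * z * (t y - t x).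
  by rewrite /dpsi Ey; ring.
have -> : second_quot q h x - t x = (psi h - psi 0) / h ^+ 2.
  by rewrite /second_quot /psi subr0 addr0; field; rewrite gt_eqF.
rewrite E subr0 dz normrM normfV [`|h ^+ 2|]ger0_norm ?sqr_ge0//.
rewrite ler_pdivrMr ?exprn_gt0// 2!normrM (ger0_norm (ltW h0)).
have ty : `|t y - t x| <= w.
  have -> : y = x + (y - x) by rewrite addrCA subrr addr0.
  by apply: tw; rewrite ler_norml; apply/andP; split; lra.
rewrite [`|2 * z|]ger0_norm ?mulr_ge0//.
have : 2 * z * `|t y - t x| <= 2 * h * w by apply: ler_pM; rewrite ?mulr_ge0// ler_pM2l.
have := ltW h0; nra.
Qed.

End energy_rate.

(** * Balance of the energy *)

Lemma double_prod_le (R : realType) (a b c : R) :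
  2 * `|a * b| + 2 * `|a * c| <= 2 * a ^+ 2 + b ^+ 2 + c ^+ 2.
Proof.
have H (x y : R) : 2 * `|x * y| <= x ^+ 2 + y ^+ 2.
  rewrite normrM -(real_normK (num_real x)) -(real_normK (num_real y)).
  by have := sqr_ge0 (`|x| - `|y|); nra.
by have := H a b; have := H a c; lra.
Qed.

Lemma half_prod_le (R : realType) (a b : R) :
  2^-1 * `|a * b| + 2^-1 * a ^+ 2 <= 2^-1 * b ^+ 2 + a ^+ 2.
Proof.
have b0 := sqr_ge0 b; have := double_prod_le a b 0.
by rewrite mulr0 normr0 mulr0 addr0 expr0n/= addr0; lra.
Qed.

(* [pressure 1 F] is [G * F] and [pressure (-1) F] is its derivative. *)
Definition pressure (R : realType) (sg : R) (F : R -> R) (x : R) : R :=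
  2^-1 * (exp_avg 1 F x + sg * exp_avg (-1) F x).

Section pressure.
Context {R : realType}.
Notation mu := (@lebesgue_measure R).
Implicit Types (f m : R -> R) (h x y M : R).

Lemma pressure_derive f M x : continuous f -> (forall y, `|f y| <= M) ->
  is_derive x (1 : R) (pressure 1 f) (pressure (-1) f x).
Proof.
move=> cf fM.
have h := is_derive_scale 2^-1 (is_derive_add (exp_avg_derive_right x cf fM)
  (is_derive_scale 1 (exp_avg_derive_left x cf fM))).
by refine (is_deriveE h _); rewrite /pressure; ring.
Qed.

Lemma pressure_derive2 f M x : continuous f -> (forall y, `|f y| <= M) ->
  is_derive x (1 : R) (pressure (-1) f) (pressure 1 f x - f x).
Proof.
move=> cf fM.
have h := is_derive_scale 2^-1 (is_derive_add (exp_avg_derive_right x cf fM)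
  (is_derive_scale (-1) (exp_avg_derive_left x cf fM))).
by refine (is_deriveE h _); rewrite /pressure; field.
Qed.

Lemma pressure_convolution f M : continuous f -> (forall y, `|f y| <= M) ->
  convolution (@helmholtz R) f = pressure 1 f.
Proof.
move=> cf fM; apply/funext => x.
by rewrite (convolution_helmholtz x cf fM) /pressure mul1r addrC.
Qed.

Lemma pressure_sup f M (sg : R) x : continuous f -> (forall y, `|f y| <= M) ->
  `|sg| = 1 -> `|pressure sg f x| <= M.
Proof.
move=> cf fM sg1; rewrite /pressure normrM ger0_norm//.
rewrite ler_pdivrMl// (le_trans (ler_normD _ _))// normrM sg1 mul1r mulr_natl mulr2n.
by rewrite lerD// exp_avg_le.
Qed.

Lemma pressure_L1_le f M (sg : R) x : continuous f -> (forall y, `|f y| <= M) ->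
  L1 f -> `|sg| = 1 -> `|pressure sg f x| <= 2^-1 * \int[mu]_y `|f y|.
Proof.
move=> cf fM Lf sg1; rewrite /pressure normrM ger0_norm// ler_wpM2l//.
rewrite (le_trans (ler_normD _ _))// normrM sg1 mul1r addrC.
exact: exp_avg_norm_le fM Lf.
Qed.

(** Convolution with the even kernel [G] is symmetric, with its odd derivative antisymmetric; the
    sign [sg] covers both. *)
Lemma pressure_adjoint f m Mf Mm (sg : R) : continuous f ->
  (forall y, `|f y| <= Mf) -> L1 f -> continuous m -> (forall y, `|m y| <= Mm) ->
  sg * sg = 1 ->
  [/\ L1 (fun x => pressure sg f x * m x), L1 (fun x => f x * pressure sg m x) &
  \int[mu]_x (pressure sg f x * m x) = sg * \int[mu]_x (f x * pressure sg m x)].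
Proof.
move=> cf fM Lf cm mM sg1.
have [L1a L2a Ea] := exp_avg_adjoint (-1) cf fM Lf cm mM.
have [L1b L2b Eb] := exp_avg_adjoint 1 cf fM Lf cm mM.
rewrite opprK in L2a Ea.
have E1 x : pressure sg f x * m x =
    2^-1 * (exp_avg 1 f x * m x + sg * (exp_avg (-1) f x * m x)).
  by rewrite /pressure; ring.
have E2 x : f x * pressure sg m x =
    2^-1 * (f x * exp_avg 1 m x + sg * (f x * exp_avg (-1) m x)).
  by rewrite /pressure; ring.
split.
- by apply: L1_eq (L1Z 2^-1 (L1D L1b (L1Z sg L1a))) => x; rewrite E1.
- by apply: L1_eq (L1Z 2^-1 (L1D L2a (L1Z sg L2b))) => x; rewrite E2.
rewrite (eq_int E1) (eq_int E2) !int_scale; [|by apply: L1D => //; exact: L1Z..].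
rewrite !int_add ?int_scale//; [|exact: L1Z..].
rewrite Ea Eb [RHS]mulrCA [sg * (_ + _)]mulrDr [sg * (sg * _)]mulrA sg1 mul1r.
by congr (_ * _); rewrite addrC.
Qed.

(** Convolution commutes with translations, hence with difference quotients. These then fall on
    [G * f], which is twice differentiable when [f] is only continuous. *)
Lemma pressure_second_quot f M h (sg : R) x : continuous f ->
  (forall y, `|f y| <= M) ->
  pressure sg (fun y => f y - second_quot f h y) x =
  pressure sg f x - second_quot (pressure sg f) h x.
Proof.
move=> cf fM.
have E t : exp_avg t (fun y => f y - second_quot f h y) x =
    exp_avg t f x - second_quot (exp_avg t f) h x.
  have c1 : continuous (fun y => f (y + h)) by exact: cont_shift.
  have c2 : continuous (fun y => f (y - h)) by exact (@cont_shift _ f (- h) cf).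
  pose k := - h ^- 2.
  have -> : (fun y => f y - second_quot f h y) =
    (fun y => (1 - 2 * k) * f y + (k * f (y + h) + k * f (y - h))).
    by apply/funext => y; rewrite /second_quot /k; ring.
  have fM' a y : `|a * f y| <= `|a| * M by rewrite normrM ler_wpM2l.
  have ca (a : R) (g : R -> R) : continuous g -> continuous (fun y => a * g y).
    by move=> cg; apply: cont_mul => //; exact: cont_cst.
  rewrite (@exp_avg_add _ _ _ (`|1 - 2 * k| * M) (`|k| * M + `|k| * M)); last first.
  - by move=> y; rewrite (le_trans (ler_normD _ _))// lerD.
  - by move=> y; exact: fM'.
  - by apply: cont_add; exact: ca.
  - exact: ca.
  rewrite (@exp_avg_add _ _ _ (`|k| * M) (`|k| * M)); last first.
  - by move=> y; exact: fM'.
  - by move=> y; exact: fM'.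
  - exact: ca.
  - exact: ca.
  rewrite (exp_avg_scale _ _ _ cf fM) (exp_avg_scale _ _ _ c1 (fun y => fM _)).
  rewrite (exp_avg_scale _ _ _ c2 (fun y => fM _)) !exp_avg_shift.
  by rewrite /second_quot /k; ring.
by rewrite /pressure !E /second_quot; ring.
Qed.

End pressure.

Section energy_balance.
Context {R : realType}.
Notation mu := (@lebesgue_measure R).

Context (f f' : R -> R) (M S h w l1 l2 l3 l4 l5 l6 : R).
Context (df : forall x, is_derive x (1 : R) f (f' x)) (cf' : continuous f').
Context (fM : forall x, `|f x| <= M) (f'M : forall x, `|f' x| <= M).
Context (h0 : 0 < h).
Context (fw : forall x y, `|y| <= h -> `|f' (x + y) - f' x| <= w).
Context (Lf : L1 (fun x => f x ^+ 2)) (If : \int[mu]_x (f x ^+ 2) <= S).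
Context (Lf' : L1 (fun x => f' x ^+ 2)) (If' : \int[mu]_x (f' x ^+ 2) <= S).
Context (Lq : L1 (fun x => diff_quot f h x ^+ 2))
  (Iq : \int[mu]_x (diff_quot f h x ^+ 2) <= S).
Context (h13 : l1 + l3 = 0) (h14 : 2 * l1 + l4 = 0) (h26 : l2 = 2 * l6).

Let cf : continuous f. Proof. exact: is_derive_continuous df. Qed.
Let D := diff_quot f h.
(** The discrete counterpart of the momentum [u - u_xx]. *)
Let m x := f x - second_quot f h x.
Let F1 y := l3 * f y ^+ 2 + l4 * f' y ^+ 2.
Let F2 y := l5 * f y ^+ 2 + l6 * f' y ^+ 2.

Let M0 : 0 <= M. Proof. exact: le_trans (fM 0). Qed.
Let w0 : 0 <= w.
Proof. by apply: le_trans (fw 0 (y := 0) _); rewrite ?normr0 // ltW. Qed.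
Let S0 : 0 <= S.
Proof. by apply: le_trans If; apply: int_ge0 => x; exact: sqr_ge0. Qed.

Let cD : continuous D.
Proof.
by apply: cont_mul; [apply: cont_sub => //; exact: cont_shift|exact: cont_cst].
Qed.

Let cm : continuous m.
Proof.
apply: cont_sub => //; apply: cont_mul; last exact: cont_cst.
apply: cont_add; last exact (@cont_shift _ f (- h) cf).
apply: cont_sub; first exact: cont_shift.
by apply: cont_mul => //; exact: cont_cst.
Qed.

Let dD x : is_derive x (1 : R) D ((f' (x + h) - f' x) / h).
Proof.
have h1 := is_derive_mul (is_derive_sub (is_derive_translate (df (x + h))) (df x))
  (is_derive_c h^-1 x).
by refine (is_deriveE h1 _); rewrite mulr0 addr0.
Qed.

Let Dw x : `|D x - f' x| <= w.
Proof. by apply: diff_quot_near => // y; exact: fw. Qed.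

Let fh x : `|f (x + h) - f x| <= M * h.
Proof.
have := lipschitz_of_derive df f'M x (x + h).
by rewrite addrAC subrr add0r (gtr0_norm h0).
Qed.

Let Mm := M + 4 * M / h ^+ 2.
Let mM x : `|m x| <= Mm.
Proof.
rewrite /m (le_trans (ler_normB _ _))// lerD// /second_quot normrM normfV.
rewrite [`|h ^+ 2|]ger0_norm ?sqr_ge0// ler_pM2r ?invr_gt0 ?exprn_gt0//.
rewrite (le_trans (ler_normD _ _))// (_ : 4 * M = (M + 2 * M) + M); last by ring.
rewrite lerD// (le_trans (ler_normB _ _))// lerD// normrM (gtr0_norm (ltr0Sn _ 1)).
by rewrite ler_pM2l.
Qed.

Let second_quotE x : second_quot f h x = (D x - D (x - h)) / h.
Proof. by rewrite /second_quot /D /diff_quot subrK; field; rewrite gt_eqF. Qed.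

Let DM x : `|D x| <= M + w.
Proof.
have -> : D x = f' x + (D x - f' x) by rewrite addrCA subrr addr0.
by rewrite (le_trans (ler_normD _ _))// lerD.
Qed.

Let sum_by_parts (F : R -> R) : L1 F -> continuous F ->
  L1 (fun x => F x * second_quot f h x) /\
  \int[mu]_x (F x * second_quot f h x) = - \int[mu]_x (diff_quot F h x * D x).
Proof.
move=> LF cF.
have LFD : L1 (fun x => F x * D x).
  by apply: L1_mul_bounded DM => //; exact: cont_meas.
have LFD' : L1 (fun x => F (x + h) * D x).
  by apply: L1_mul_bounded DM => //; [exact: L1_shift|exact: cont_meas].
have E1 x : F x * second_quot f h x = h^-1 * (F x * D x - F x * D (x - h)).
  by rewrite second_quotE; ring.
have L2 : L1 (fun x => F x * D (x - h)).
  by apply: L1_eq (L1_shift (- h) LFD') => x; rewrite subrK.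
have E2 x : diff_quot F h x * D x = h^-1 * (F (x + h) * D x - F x * D x).
  by rewrite /diff_quot; ring.
split.
  by apply: (@L1_eq _ (fun x => h^-1 * (F x * D x - F x * D (x - h)))) => //;
    apply: L1Z; exact: L1B.
rewrite (eq_int E1) (eq_int E2) !int_scale; [|exact: L1B|exact: L1B].
rewrite !int_sub// -(int_shift h L2).
have -> : (fun x => F (x + h) * D (x + h - h)) = (fun x => F (x + h) * D x).
  by apply/funext => x; rewrite addrK.
by ring.
Qed.

Let Lff' : L1 (fun x => f x * f' x).
Proof. by apply: L1_mul_sqr => //; exact: cont_meas. Qed.

Let Lc : L1 (fun x => f x ^+ 2 * f' x).
Proof. by apply: L1_mul_bounded f'M => //; exact: cont_meas. Qed.

Let L3 : L1 (fun x => f x ^+ 3).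
Proof.
have := L1_mul_bounded Lf (cont_meas cf) fM.
by apply: L1_eq => x; ring.
Qed.

Let Z1 : \int[mu]_x (f x ^+ 2 * f' x) = 0.
Proof.
have d3 x : is_derive x (1 : R) (fun x => 3^-1 * f x ^+ 3) (f x ^+ 2 * f' x).
  have e : (fun x => 3^-1 * f x ^+ 3) = (fun x => 3^-1 * (f x ^+ 2 * f x)).
    by apply/funext => y; ring.
  rewrite e; refine (is_deriveE (is_derive_scale 3^-1
    (is_derive_mul (is_derive_sqr (df x)) (df x))) _).
  by field.
apply: (int_derive0 d3) => //; first by apply: cont_mul => //; exact: cont_sqr.
exact: L1Z.
Qed.

(** Discrete form of [int u^2 (u - u_xx) = int u^3 + 2 int u u_x^2]; the factor [f x + f (x + h)]
    comes from the difference of two squares. *)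
Let T1 : \int[mu]_x (f x ^+ 2 * m x) = \int[mu]_x (f x ^+ 3) +
   \int[mu]_x ((f x + f (x + h)) * D x ^+ 2).
Proof.
have [Ls Es] := sum_by_parts Lf (cont_sqr cf).
have E x : f x ^+ 2 * m x = f x ^+ 3 - f x ^+ 2 * second_quot f h x.
  by rewrite /m; ring.
rewrite (eq_int E) int_sub// Es opprK; congr (_ + _); apply: eq_int => x.
by rewrite /D /diff_quot; ring.
Qed.

Let LD2M (g : R -> R) K : continuous g -> (forall x, `|g x| <= K) ->
  L1 (fun x => g x * D x ^+ 2).
Proof.
move=> cg gK; apply: (@L1_eq _ (fun x => D x ^+ 2 * g x)).
  by move=> x; rewrite mulrC.
by apply: L1_mul_bounded gK => //; exact: cont_meas.
Qed.

(** Discrete form of [int u u_x (u - u_xx) = int u_x^3 / 2]. *)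
Let T2 : \int[mu]_x (f x * f' x * m x) =
   \int[mu]_x ((f' x - 2^-1 * f' (x + h)) * D x ^+ 2).
Proof.
have cff' : continuous (fun x => f x * f' x) by exact: cont_mul.
have [Ls Es] := sum_by_parts Lff' cff'.
pose Dp x := (f' (x + h) - f' x) / h.
have cDp : continuous Dp.
  by apply: cont_mul; [apply: cont_sub => //; exact: cont_shift|exact: cont_cst].
have DpM x : `|Dp x| <= 2 * M / h.
  rewrite normrM normfV (gtr0_norm h0) ler_pM2r ?invr_gt0//.
  by rewrite (le_trans (ler_normB _ _))// mulr_natl mulr2n lerD.
(* The derivative of [f (x + h) * D x ^+ 2], of integral 0. Subtracting half of it removes the
   derivative of [D], as in the integration by parts of [u u_x u_xx]. *)
pose G x := f' (x + h) * D x ^+ 2 + f (x + h) * (2 * D x * Dp x).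
have Lsh : L1 (fun x => f (x + h) * D x ^+ 2).
  by apply: (@LD2M (fun x => f (x + h)) M) => //; exact: cont_shift.
have Lsh' : L1 (fun x => f' (x + h) * D x ^+ 2).
  by apply: (@LD2M (fun x => f' (x + h)) M) => //; exact: cont_shift.
have LfD : L1 (fun x => f (x + h) * D x).
  apply: L1_mul_sqr => //; [exact (cont_meas (@cont_shift _ f h cf))|exact: cont_meas|].
  exact: (L1_shift h Lf).
have LfDD : L1 (fun x => f (x + h) * D x * Dp x).
  by apply: L1_mul_bounded DpM => //; exact: cont_meas.
have Z2 : \int[mu]_x G x = 0.
  have dG x : is_derive x (1 : R) (fun x => f (x + h) * D x ^+ 2) (G x).
    exact: (is_derive_mul (is_derive_translate (df (x + h))) (is_derive_sqr (dD x))).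
  apply: (int_derive0 dG) => //.
    apply: cont_add; first by apply: cont_mul; [exact: cont_shift|exact: cont_sqr].
    apply: cont_mul; first exact: cont_shift.
    by apply: cont_mul => //; apply: cont_mul => //; exact: cont_cst.
  apply: L1D => //; apply: L1_eq (L1Z 2 LfDD) => x; ring.
have E x : f x * f' x * m x = f x ^+ 2 * f' x - f x * f' x * second_quot f h x.
  by rewrite /m; ring.
rewrite (eq_int E) int_sub// Z1 Es sub0r opprK.
have Lfin : L1 (fun x => (f' x - 2^-1 * f' (x + h)) * D x ^+ 2).
  apply: (@LD2M (fun x => f' x - 2^-1 * f' (x + h)) (M + 2^-1 * M)).
    apply: cont_sub => //; apply: cont_mul; first exact: cont_cst.
    exact: cont_shift.
  move=> x; rewrite (le_trans (ler_normB _ _))// lerD// normrM ger0_norm//.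
  by rewrite ler_wpM2l.
have LG : L1 G.
  by apply: L1D => //; apply: L1_eq (L1Z 2 LfDD) => x; ring.
have E' x : diff_quot (fun x => f x * f' x) h x * D x =
    (f' x - 2^-1 * f' (x + h)) * D x ^+ 2 + 2^-1 * G x.
  by rewrite /G /Dp /D /diff_quot; field; rewrite gt_eqF.
rewrite (eq_int E') int_add//; last exact: L1Z.
by rewrite int_scale// Z2 mulr0 addr0.
Qed.

Let F1M y : `|F1 y| <= (`|l3| + `|l4|) * M ^+ 2.
Proof.
rewrite /F1 (le_trans (ler_normD _ _))// mulrDl (normrM l3) (normrM l4) !normrX.
by rewrite lerD// ler_wpM2l// lerXn2r ?nnegrE.
Qed.

Let F2M y : `|F2 y| <= (`|l5| + `|l6|) * M ^+ 2.
Proof.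
rewrite /F2 (le_trans (ler_normD _ _))// mulrDl (normrM l5) (normrM l6) !normrX.
by rewrite lerD// ler_wpM2l// lerXn2r ?nnegrE.
Qed.

Let cF1 : continuous F1.
Proof.
by apply: cont_add; apply: cont_mul; (try exact: cont_cst); exact: cont_sqr.
Qed.

Let cF2 : continuous F2.
Proof.
by apply: cont_add; apply: cont_mul; (try exact: cont_cst); exact: cont_sqr.
Qed.

Let LF1 : L1 F1. Proof. by apply: L1D; exact: L1Z. Qed.
Let LF2 : L1 F2. Proof. by apply: L1D; exact: L1Z. Qed.

(** Since [G * (u - u_xx) = u], this error and the next would vanish for the true momentum. *)
Let err3 x := pressure 1 m x - f x.
Let err4 x := pressure (-1) m x - f' x.

(** With [q = G * f] one has [q'' = q - f], and the error is [q''] minus the second quotient of [q];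
    [q''] is Lipschitz with constant [2 * M]. *)
Let err3b x : `|err3 x| <= 4 * (M * h).
Proof.
have sup1 y : `|pressure (-1) f y| <= M by apply: pressure_sup => //; rewrite normrN1.
have H : `|second_quot (pressure 1 f) h x - (pressure 1 f x - f x)| <= 2 * (2 * (M * h)).
  apply: (@second_quot_near _ _ (pressure (-1) f) (fun x => pressure 1 f x - f x)) => //.
  - by move=> y; exact: pressure_derive fM.
  - by move=> y; exact: pressure_derive2 fM.
  move=> y yh.
  have := lipschitz_of_derive (fun y => pressure_derive y cf fM) sup1 x (x + y).
  have := lipschitz_of_derive df f'M x (x + y).
  rewrite [x + y - x]addrAC subrr add0r => h1 h2.
  have -> : pressure 1 f (x + y) - f (x + y) - (pressure 1 f x - f x) =
    (pressure 1 f (x + y) - pressure 1 f x) - (f (x + y) - f x) by ring.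
  have h3 : M * `|y| <= M * h by rewrite ler_wpM2l.
  by rewrite (le_trans (ler_normB _ _))//; lra.
have -> : err3 x = - (second_quot (pressure 1 f) h x - (pressure 1 f x - f x)).
  by rewrite /err3 /m (pressure_second_quot _ _ _ cf fM); ring.
by rewrite normrN (le_trans H)// mulrA -natrM.
Qed.

(** The same one derivative higher. The second derivative of [pressure (-1) f] now contains [f'],
    controlled only by its modulus of continuity; hence the term in [w]. *)
Let err4b x : `|err4 x| <= 4 * (M * h) + 2 * w.
Proof.
have sup1 y : `|pressure 1 f y - f y| <= 2 * M.
  rewrite (le_trans (ler_normB _ _))// mulr_natl mulr2n lerD//.
  by apply: pressure_sup => //; rewrite normr1.
have H : `|second_quot (pressure (-1) f) h x - (pressure (-1) f x - f' x)|
    <= 2 * (2 * (M * h) + w).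
  apply: (@second_quot_near _ _ (fun x => pressure 1 f x - f x)
    (fun x => pressure (-1) f x - f' x)) => //.
  - by move=> y; exact: pressure_derive2 fM.
  - by move=> y; apply: is_derive_sub => //; exact: pressure_derive fM.
  move=> y yh.
  have := lipschitz_of_derive (fun y => pressure_derive2 y cf fM) sup1 x (x + y).
  have := fw x yh.
  rewrite [x + y - x]addrAC subrr add0r => h1 h2.
  have -> : pressure (-1) f (x + y) - f' (x + y) - (pressure (-1) f x - f' x) =
    (pressure (-1) f (x + y) - pressure (-1) f x) - (f' (x + y) - f' x) by ring.
  have h3 : M * `|y| <= M * h by rewrite ler_wpM2l.
  by rewrite (le_trans (ler_normB _ _))//; lra.
have -> : err4 x = - (second_quot (pressure (-1) f) h x - (pressure (-1) f x - f' x)).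
  by rewrite /err4 /m (pressure_second_quot _ _ _ cf fM); ring.
by rewrite normrN (le_trans H)//; lra.
Qed.

Definition energy_const : R :=
  S * (`|l1| * (M + 4) + 2 * `|l2| + (`|l3| + `|l4|) * (4 * M) +
       (`|l5| + `|l6|) * (4 * M + 2)).

(** The integral is half the time derivative of the discrete energy. Summation by parts and
    adjointness turn it into the integral of a cubic expression in which the conditions on the
    coefficients cancel all leading terms pointwise. *)
Lemma energy_rate (g : R -> R) :
  (forall x, g x = - (l1 * f x ^+ 2 + l2 * f x * f' x + pressure 1 F1 x +
    pressure (-1) F2 x)) ->
  `|\int[mu]_x (g x * (f x - second_quot f h x))| <= energy_const * (h + w).
Proof.
move=> gE.
have [A1 A2 A3] := pressure_adjoint cF1 F1M LF1 cm mM (mul1r (1 : R)).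
have sg1 : (-1) * (-1) = 1 :> R by rewrite mulrNN mulr1.
have [B1 B2 B3] := pressure_adjoint cF2 F2M LF2 cm mM sg1.
have Lm1 : L1 (fun x => f x ^+ 2 * m x).
  by apply: L1_mul_bounded mM => //; exact: cont_meas.
have Lm2 : L1 (fun x => f x * f' x * m x).
  by apply: L1_mul_bounded mM => //; exact: cont_meas.
have LS1 : L1 (fun x => (f x + f (x + h)) * D x ^+ 2).
  apply: (@LD2M (fun x => f x + f (x + h)) (M + M)).
    by apply: cont_add => //; exact: cont_shift.
  by move=> x; rewrite (le_trans (ler_normD _ _))// lerD.
have LS2 : L1 (fun x => (f' x - 2^-1 * f' (x + h)) * D x ^+ 2).
  apply: (@LD2M (fun x => f' x - 2^-1 * f' (x + h)) (M + 2^-1 * M)).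
    apply: cont_sub => //; apply: cont_mul; first exact: cont_cst.
    exact: cont_shift.
  move=> x; rewrite (le_trans (ler_normB _ _))// lerD// normrM ger0_norm//.
  by rewrite ler_wpM2l.
(* The last term has integral 0; it is added to cancel the [l5] part of [F2 x * f' x] pointwise. *)
pose K x := l1 * (f x ^+ 3 + (f x + f (x + h)) * D x ^+ 2) +
   l2 * ((f' x - 2^-1 * f' (x + h)) * D x ^+ 2) +
   F1 x * pressure 1 m x - F2 x * pressure (-1) m x + l5 * (f x ^+ 2 * f' x).
have LK : L1 K.
  apply: L1D; last exact: L1Z.
  apply: L1B => //; apply: L1D => //; apply: L1D; apply: L1Z => //.
  exact: L1D.
have EI : \int[mu]_x (g x * (f x - second_quot f h x)) = - \int[mu]_x K x.
  have E x : g x * (f x - second_quot f h x) =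
    - (l1 * (f x ^+ 2 * m x) + l2 * (f x * f' x * m x) + pressure 1 F1 x * m x +
    pressure (-1) F2 x * m x) by rewrite gE /m; ring.
  rewrite (eq_int E) int_neg; last first.
    by apply: L1D => //; apply: L1D => //; apply: L1D; exact: L1Z.
  congr (- _).
  rewrite int_add//; last by apply: L1D => //; apply: L1D; exact: L1Z.
  rewrite int_add//; last by apply: L1D; exact: L1Z.
  rewrite int_add; [|exact: L1Z|exact: L1Z].
  rewrite (int_scale _ Lm1) (int_scale _ Lm2) T1 T2 A3 B3.
  rewrite /K int_add; last 2 first.
    apply: L1B => //; apply: L1D => //; apply: L1D; apply: L1Z => //.
    exact: L1D.
    exact: L1Z.
  rewrite (int_scale _ Lc) Z1.
  rewrite int_sub//; last first.
    by apply: L1D => //; apply: L1D; apply: L1Z => //; exact: L1D.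
  rewrite int_add//; last by apply: L1D; apply: L1Z => //; exact: L1D.
  rewrite int_add; last 2 first.
    by apply: L1Z; exact: L1D.
    exact: L1Z.
  rewrite (int_scale _ LS2) (int_scale _ (L1D L3 LS1)) int_add//.
  by ring.
rewrite EI normrN.
pose Bd x := (`|l1| * (M * h + w) + `|l2| * w) * D x ^+ 2 +
  (`|l1| * (2 * w) + `|l3| * (4 * (M * h)) + `|l5| * (4 * (M * h) + 2 * w)) * f x ^+ 2 +
  (`|l1| * w + `|l2| * w + `|l4| * (4 * (M * h)) + `|l6| * (4 * (M * h) + 2 * w)) * f' x ^+ 2.
have LBd : L1 Bd by apply: L1D; [apply: L1D|]; exact: L1Z.
have Mh : 0 <= M * h by rewrite mulr_ge0// ltW.
have KB x : `|K x| <= Bd x.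
  (* After the cancellations each product contains an increment of [f] or [f'], the difference
     [D x - f' x], or one of the errors [err3] and [err4], all small with [h] and [w]. *)
  have -> : K x = l1 * ((f (x + h) - f x) * D x ^+ 2 +
        2 * f x * (D x - f' x) * (D x + f' x)) +
      l2 * (2^-1 * (f' x - f' (x + h)) * D x ^+ 2 +
        2^-1 * f' x * (D x - f' x) * (D x + f' x)) +
      F1 x * err3 x - F2 x * err4 x.
    rewrite /K /err3 /err4 /F1 /F2 h26.
    have -> : l3 = - l1 by apply/eqP; rewrite -subr_eq0 opprK addrC h13.
    have -> : l4 = - (2 * l1) by apply/eqP; rewrite -subr_eq0 opprK addrC h14.
    by field.
  have f2 : 0 <= f x ^+ 2 by exact: sqr_ge0.
  have D2 : 0 <= D x ^+ 2 by exact: sqr_ge0.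
  have f'2 : 0 <= f' x ^+ 2 by exact: sqr_ge0.
  have k1 : `|(f (x + h) - f x) * D x ^+ 2| <= M * h * D x ^+ 2.
    by rewrite normrM (ger0_norm D2) ler_wpM2r.
  have k2 : `|2 * f x * (D x - f' x) * (D x + f' x)| <=
      w * (2 * f x ^+ 2 + D x ^+ 2 + f' x ^+ 2).
    have -> : 2 * f x * (D x - f' x) * (D x + f' x) =
       (D x - f' x) * (2 * (f x * D x) + 2 * (f x * f' x)) by ring.
    rewrite normrM; apply: ler_pM => //.
    rewrite (le_trans (ler_normD _ _))// (normrM 2 (f x * D x)).
    rewrite (normrM 2 (f x * f' x)) (gtr0_norm (ltr0Sn _ 1)).
    exact: double_prod_le.
  have k3 : `|2^-1 * (f' x - f' (x + h)) * D x ^+ 2| <= 2^-1 * w * D x ^+ 2.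
    rewrite normrM (ger0_norm D2) ler_wpM2r// normrM ger0_norm// ler_wpM2l//.
    by rewrite distrC; apply: fw; rewrite (gtr0_norm h0).
  have k4 : `|2^-1 * f' x * (D x - f' x) * (D x + f' x)| <=
      w * (2^-1 * D x ^+ 2 + f' x ^+ 2).
    have -> : 2^-1 * f' x * (D x - f' x) * (D x + f' x) =
       (D x - f' x) * (2^-1 * (f' x * D x) + 2^-1 * f' x ^+ 2) by ring.
    rewrite normrM; apply: ler_pM => //.
    rewrite (le_trans (ler_normD _ _))// (ger0_norm (mulr_ge0 _ f'2))//.
    rewrite normrM ger0_norm//.
    exact: half_prod_le.
  have e3 := err3b x; have e4 := err4b x.
  have k5 : `|F1 x * err3 x| <= (`|l3| * f x ^+ 2 + `|l4| * f' x ^+ 2) * (4 * (M * h)).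
    rewrite normrM; apply: ler_pM => //.
    by rewrite (le_trans (ler_normD _ _))// (normrM l3) (normrM l4) (ger0_norm f2) (ger0_norm f'2).
  have k6 : `|F2 x * err4 x| <=
      (`|l5| * f x ^+ 2 + `|l6| * f' x ^+ 2) * (4 * (M * h) + 2 * w).
    rewrite normrM; apply: ler_pM => //.
    by rewrite (le_trans (ler_normD _ _))// (normrM l5) (normrM l6) (ger0_norm f2) (ger0_norm f'2).
  rewrite (le_trans (ler_normB _ _))//.
  have -> : Bd x = (`|l1| * (M * h * D x ^+ 2 + w * (2 * f x ^+ 2 + D x ^+ 2 + f' x ^+ 2)) +
     `|l2| * (2^-1 * w * D x ^+ 2 + w * (2^-1 * D x ^+ 2 + f' x ^+ 2)) +
     (`|l3| * f x ^+ 2 + `|l4| * f' x ^+ 2) * (4 * (M * h))) +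
     (`|l5| * f x ^+ 2 + `|l6| * f' x ^+ 2) * (4 * (M * h) + 2 * w).
    by rewrite /Bd; field.
  apply: lerD => //; rewrite (le_trans (ler_normD _ _))//; apply: lerD => //.
  rewrite (le_trans (ler_normD _ _))// !normrM.
  by apply: lerD; rewrite ler_wpM2l// (le_trans (ler_normD _ _))// lerD// -?normrM.
apply: (le_trans (norm_int_le LK LBd KB)).
rewrite /Bd int_add; [|by apply: L1D; exact: L1Z|exact: L1Z].
rewrite int_add; [|exact: L1Z|exact: L1Z].
rewrite (int_scale _ Lf) (int_scale _ Lf') int_scale//.
set ID := \int[mu]_x (D x ^+ 2).
have a1 := normr_ge0 l1; have a2 := normr_ge0 l2; have a3 := normr_ge0 l3.
have a4 := normr_ge0 l4; have a5 := normr_ge0 l5; have a6 := normr_ge0 l6.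
have le3 a x : 0 <= a -> x <= S -> a * x <= a * S by move=> a0 xS; rewrite ler_wpM2l.
apply: (le_trans (lerD (lerD (le3 _ _ _ Iq) (le3 _ _ _ If)) (le3 _ _ _ If'))).
- by rewrite !(addr_ge0, mulr_ge0)// ltW.
- by rewrite !(addr_ge0, mulr_ge0)// ltW.
- by rewrite !(addr_ge0, mulr_ge0)// ltW.
rewrite -!mulrDl [leLHS]mulrC /energy_const -mulrA ler_wpM2l//.
have h1 : 0 <= `|l1| * (M * w) by rewrite !mulr_ge0.
have h2 := ltW h0.
have h3 : 0 <= (`|l3| + `|l4|) * (M * w) by rewrite !mulr_ge0// addr_ge0.
have h4 : 0 <= (`|l5| + `|l6|) * (M * w) by rewrite !mulr_ge0// addr_ge0.
have h5 : 0 <= `|l1| * h by rewrite mulr_ge0.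
have h6 : 0 <= `|l2| * h by rewrite mulr_ge0.
have h7 : 0 <= (`|l5| + `|l6|) * h by rewrite mulr_ge0// addr_ge0.
by lra.
Qed.

End energy_balance.

(** * L^2 inequalities and stability of the C^1 bounds *)

Section L2_tools.
Context {R : realType}.
Notation mu := (@lebesgue_measure R).
Implicit Types (f g om : R -> R) (a b h n m C : R).

Lemma L1_sqr_add f g : measurable_fun setT f -> measurable_fun setT g ->
  L1 (fun x => f x ^+ 2) -> L1 (fun x => g x ^+ 2) ->
  L1 (fun x => (f x + g x) ^+ 2) /\
  \int[mu]_x ((f x + g x) ^+ 2) <=
    2 * (\int[mu]_x (f x ^+ 2) + \int[mu]_x (g x ^+ 2)).
Proof.
move=> mf mg Lf Lg.
have b x : (f x + g x) ^+ 2 <= 2 * (f x ^+ 2 + g x ^+ 2).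
  by have := sqr_ge0 (f x - g x); nra.
have LB : L1 (fun x => 2 * (f x ^+ 2 + g x ^+ 2)) by apply: L1Z; exact: L1D.
have L : L1 (fun x => (f x + g x) ^+ 2).
  apply: (L1_le _ LB) => [|x]; last by rewrite ger0_norm ?sqr_ge0.
  by apply: measurable_funX; exact: measurable_funD.
split=> //; apply: (le_trans (le_int L LB b)).
by rewrite int_scale ?int_add//; exact: L1D.
Qed.

(** Young's inequality with the ratio [b / a], for which both terms contribute [a * b / 2]. *)
Lemma cauchy_schwarz f g a b : 0 < a -> 0 < b ->
  measurable_fun setT f -> measurable_fun setT g ->
  L1 (fun x => f x ^+ 2) -> \int[mu]_x (f x ^+ 2) <= a ^+ 2 ->
  L1 (fun x => g x ^+ 2) -> \int[mu]_x (g x ^+ 2) <= b ^+ 2 ->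
  `|\int[mu]_x (f x * g x)| <= a * b.
Proof.
move=> a0 b0 mf mg Lf If Lg Ig.
have r0 : 0 < b / a by rewrite divr_gt0.
have LG : L1 (fun x => 2^-1 * (b / a * f x ^+ 2 + (b / a)^-1 * g x ^+ 2)).
  by apply: L1Z; apply: L1D; exact: L1Z.
have H x : `|f x * g x| <= 2^-1 * (b / a * f x ^+ 2 + (b / a)^-1 * g x ^+ 2).
  rewrite -(real_normK (num_real (f x))) -(real_normK (num_real (g x))) normrM.
  rewrite ler_pdivlMl// -subr_ge0; move: (`|f x|) (`|g x|) (b / a) r0 => y z r r0.
  have -> : r * y ^+ 2 + r^-1 * z ^+ 2 - 2 * (y * z) = r^-1 * (r * y - z) ^+ 2.
    by field; exact: lt0r_neq0.
  by rewrite mulr_ge0 ?sqr_ge0// invr_ge0 ltW.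
apply: (le_trans (norm_int_le (L1_mul_sqr mf mg Lf Lg) LG H)).
rewrite int_scale; last by apply: L1D; exact: L1Z.
rewrite int_add; [|exact: L1Z|exact: L1Z].
rewrite (int_scale _ Lf) (int_scale _ Lg) ler_pdivrMl//.
have -> : 2 * (a * b) = b / a * a ^+ 2 + (b / a)^-1 * b ^+ 2.
  by field; rewrite !lt0r_neq0.
by apply: lerD; rewrite ler_wpM2l// ?invr_ge0 ltW.
Qed.

Lemma int_sqr_close f g a b : 0 < a -> 0 < b ->
  measurable_fun setT f -> measurable_fun setT g ->
  L1 (fun x => (f x - g x) ^+ 2) -> \int[mu]_x ((f x - g x) ^+ 2) <= a ^+ 2 ->
  L1 (fun x => g x ^+ 2) -> \int[mu]_x (g x ^+ 2) <= b ^+ 2 ->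
  L1 (fun x => f x ^+ 2) /\
  `|\int[mu]_x (f x ^+ 2) - \int[mu]_x (g x ^+ 2)| <= a ^+ 2 + 2 * (a * b).
Proof.
move=> a0 b0 mf mg Lr Ir Lg Ig.
have mr : measurable_fun setT (fun x => f x - g x) by exact: measurable_funB.
have Lrg := L1_mul_sqr mr mg Lr Lg.
have E x : (f x - g x) ^+ 2 + 2 * ((f x - g x) * g x) + g x ^+ 2 = f x ^+ 2 by ring.
have Lf : L1 (fun x => f x ^+ 2).
  by apply: L1_eq E _; apply: L1D => //; apply: L1D => //; exact: L1Z.
split=> //; rewrite -(eq_int E) int_add//; last by apply: L1D => //; exact: L1Z.
rewrite int_add//; last exact: L1Z.
rewrite int_scale// addrK (le_trans (ler_normD _ _))// lerD//.
  by rewrite ger0_norm// int_ge0// => x; exact: sqr_ge0.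
by rewrite normrM ger0_norm// ler_wpM2l//; exact: cauchy_schwarz.
Qed.

Lemma int_diff_quot_prod f g h : measurable_fun setT f -> measurable_fun setT g ->
  L1 (fun x => f x ^+ 2) -> L1 (fun x => g x ^+ 2) -> h != 0 ->
  \int[mu]_x (diff_quot f h x * diff_quot g h x) =
  - \int[mu]_x (f x * second_quot g h x).
Proof.
move=> mf mg Lf Lg h0.
have ms (k : R -> R) (r : R) : measurable_fun setT k -> measurable_fun setT (fun x : R => k (x + r)).
  by move=> mk; apply: (measurableT_comp mk); exact: measurable_funD.
have L00 := L1_mul_sqr mf mg Lf Lg.
have L10 := L1_mul_sqr (ms f h mf) mg (L1_shift h Lf) Lg.
have L01 := L1_mul_sqr mf (ms g h mg) Lf (L1_shift h Lg).
have L11 := L1_shift h L00.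
have L0N := L1_mul_sqr mf (ms g (- h) mg) Lf (L1_shift (- h) Lg).
have E1 x : h ^- 2 * (f (x + h) * g (x + h) + f x * g x
    - (f (x + h) * g x + f x * g (x + h))) = diff_quot f h x * diff_quot g h x.
  by rewrite /diff_quot; field.
have E2 x : h ^- 2 * (f x * g (x + h) + f x * g (x - h) - 2 * (f x * g x)) =
    f x * second_quot g h x.
  by rewrite /second_quot; field.
rewrite -(eq_int E1) -(eq_int E2).
have L1a : L1 (fun x => f (x + h) * g (x + h) + f x * g x) by exact: L1D.
have L1b : L1 (fun x => f (x + h) * g x + f x * g (x + h)) by exact: L1D.
have L1c : L1 (fun x => f x * g (x + h) + f x * g (x - h)) by exact: L1D.
have L1d := L1Z 2 L00.
rewrite (int_scale _ (L1B L1a L1b)) (int_scale _ (L1B L1c L1d)) -mulrN.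
congr (_ * _); rewrite int_sub// int_sub// int_add// int_add// int_add//.
rewrite int_scale// (int_shift h L00).
have -> : \int[mu]_x (f (x + h) * g x) = \int[mu]_x (f x * g (x - h)).
  rewrite -(int_shift h L0N); apply: eq_int => x.
  by rewrite -addrA subrr addr0.
by ring.
Qed.

Lemma C1_bounds_le C om n m f : 0 <= C -> (forall h, 0 <= om h) -> 0 <= n -> n <= m ->
  C1_bounds C om n f -> C1_bounds C om m f.
Proof.
move=> C0 om0 n0 nm [d c s ds md [L I] [L' I'] q].
have m0 : 0 <= m by exact: le_trans nm.
have sq (r t : R) : 0 <= r -> r <= t -> r ^+ 2 <= t ^+ 2 by move=> r0 rt; rewrite lerXn2r ?nnegrE// (le_trans r0).
split=> // [x|x|x h|||h /q[Lq Iq]].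
- by rewrite (le_trans (s x))// ler_wpM2l.
- by rewrite (le_trans (ds x))// ler_wpM2l.
- by rewrite (le_trans (md x h))// ler_wpM2l.
- by split=> //; rewrite (le_trans I)// sq.
- by split=> //; rewrite (le_trans I')// sq.
- by split=> //; rewrite (le_trans Iq)// sq ?mulr_ge0// ler_wpM2l.
Qed.

(** The factor 2 comes from the L^2 clauses, through [2 (n^2 + m^2) <= (2 (n + m))^2]. *)
Lemma C1_bounds_add C om n m f g : 0 <= C -> (forall h, 0 <= om h) -> 0 <= n -> 0 <= m ->
  C1_bounds C om n f -> C1_bounds C om m g ->
  C1_bounds C om (2 * (n + m)) (fun x => f x + g x).
Proof.
move=> C0 om0 n0 m0 Bf Bg.
have df := C1_derive Bf; have dg := C1_derive Bg.
have E : derive1 (fun x => f x + g x) = fun x => derive1 f x + derive1 g x.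
  by apply/funext => x; apply: is_derive_derive1; exact: is_derive_add.
have sq (r t : R) : 0 <= r -> 0 <= t -> 2 * (r ^+ 2 + t ^+ 2) <= (2 * (r + t)) ^+ 2.
  by move=> r0 t0; have := mulr_ge0 r0 t0; nra.
have lin (k a b c d : R) : 0 <= k -> `|c| <= k * n -> `|d| <= k * m -> a = c + d -> b = k * (2 * (n + m)) -> `|a| <= b.
  move=> k0 hc hd -> ->; rewrite (le_trans (ler_normD _ _))//.
  have : 0 <= k * (n + m) by rewrite mulr_ge0// addr_ge0.
  by move: (lerD hc hd); nra.
have mf : measurable_fun setT f by apply: cont_meas; exact: is_derive_continuous df.
have mg : measurable_fun setT g by apply: cont_meas; exact: is_derive_continuous dg.
have mdf := cont_meas (C1_cont Bf); have mdg := cont_meas (C1_cont Bg).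
split.
- by move=> x; rewrite E; exact: is_derive_add.
- by rewrite E; apply: cont_add; [exact: C1_cont Bf|exact: C1_cont Bg].
- by move=> x; apply: (lin _ _ _ _ _ C0 (C1_sup Bf x) (C1_sup Bg x)).
- by move=> x; rewrite E; apply: (lin _ _ _ _ _ C0 (C1_dsup Bf x) (C1_dsup Bg x)).
- move=> x h; rewrite E; apply: (lin _ _ _ _ _ (om0 h) (C1_mod Bf x h) (C1_mod Bg x h)) => //.
  by ring.
- have [Lf If] := C1_L2 Bf; have [Lg Ig] := C1_L2 Bg.
  have [L I] := L1_sqr_add mf mg Lf Lg; split=> //.
  by rewrite (le_trans I)// (le_trans _ (sq _ _ n0 m0))// ler_wpM2l// lerD.
- have [Lf If] := C1_dL2 Bf; have [Lg Ig] := C1_dL2 Bg.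
  have [L I] := L1_sqr_add mdf mdg Lf Lg; rewrite E; split=> //.
  by rewrite (le_trans I)// (le_trans _ (sq _ _ n0 m0))// ler_wpM2l// lerD.
- move=> h h0; have [Lf If] := C1_quot Bf h0; have [Lg Ig] := C1_quot Bg h0.
  have mq (k : R -> R) : measurable_fun setT k -> measurable_fun setT (derive1 k) ->
      measurable_fun setT (fun x : R => (k (x + h) - k x) / h - derive1 k x).
    move=> mk mdk; apply: measurable_funB => //; apply: measurable_funM => //.
    apply: measurable_funB => //.
    by apply: (measurableT_comp mk); exact: measurable_funD.
  have [L I] := L1_sqr_add (mq _ mf mdf) (mq _ mg mdg) Lf Lg.
  have EE x : ((f (x + h) - f x) / h - derive1 f x + ((g (x + h) - g x) / h - derive1 g x)) ^+ 2
     = ((f (x + h) + g (x + h) - (f x + g x)) / h - derive1 (fun x => f x + g x) x) ^+ 2.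
    by rewrite E; field.
  split; first exact: L1_eq EE L.
  rewrite -(eq_int EE) (le_trans I)//.
  have := sq _ _ (mulr_ge0 (om0 h) n0) (mulr_ge0 (om0 h) m0).
  rewrite -mulrDr mulrCA; apply: le_trans.
  by rewrite ler_wpM2l// lerD.
Qed.

End L2_tools.

(** * Strong solutions *)

(** What the rest of the proof retains of a solution: Sobolev norms are replaced by the bounds they
    imply, and convolutions by [pressure]. No derivative of [ut] in [x] occurs, because [ut] is only
    in [H^(s-1)] with [s - 1 > 1/2]. *)
Record strong_solution (R : realType) (l1 l2 l3 l4 l5 l6 : R) (T : \bar R)
    (u ut : R -> R -> R) (C C' : R) (om : R -> R) : Prop := {
  mod_const_ge0 : 0 <= C;
  mod_ge0 : forall h, 0 <= om h;
  mod_cvg0 : om h @[h --> (0 : R)] --> (0 : R);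
  sol_bounded : forall t1, time_interval T t1 -> exists2 n, 0 < n &
    forall t, 0 <= t <= t1 -> C1_bounds C om n (u t);
  sol_cont : forall t e, time_interval T t -> 0 < e -> exists2 d, 0 < d &
    forall t', time_interval T t' -> `|t' - t| < d ->
      C1_bounds C om e (fun x => u t' x - u t x);
  sol_dcont : forall t, time_interval T t -> continuous (ut t);
  sol_dbounded : forall t, time_interval T t -> exists2 n, 0 < n &
    [/\ forall x, `|ut t x| <= C' * n, L1 (fun x => ut t x ^+ 2) &
      \int[lebesgue_measure]_x (ut t x ^+ 2) <= n ^+ 2];
  sol_derive : forall t e, time_interval T t -> 0 < e -> exists2 d, 0 < d &
    forall t', time_interval T t' -> t' != t -> `|t' - t| < d ->
      [/\ forall x, `|(u t' x - u t x) / (t' - t) - ut t x| <= C' * e,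
          L1 (fun x => ((u t' x - u t x) / (t' - t) - ut t x) ^+ 2) &
          \int[lebesgue_measure]_x (((u t' x - u t x) / (t' - t) - ut t x) ^+ 2)
            <= e ^+ 2];
  sol_equation : forall t x, 0 < t -> (t%:E < T)%E ->
    ut t x = - (l1 * u t x ^+ 2 + l2 * u t x * derive1 (u t) x
      + pressure 1 (fun y => l3 * u t y ^+ 2 + l4 * derive1 (u t) y ^+ 2) x
      + pressure (-1) (fun y => l5 * u t y ^+ 2 + l6 * derive1 (u t) y ^+ 2) x) }.

Section strong_solution_exists.
Context {R : realType}.
Notation mu := (@lebesgue_measure R).
Implicit Types (f g : R -> R) (h n e C : R).

Lemma sobolev_norm_lt s f : (sobolev_normsq s f < +oo)%E ->
  exists2 n, 0 < n & (sobolev_normsq s f < (n ^+ 2)%:E)%E.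
Proof.
case: (sobolev_normsq s f) => [r|//|] _; last by exists 1; rewrite // ltNyr.
exists (1 + `|r|); first by rewrite ltr_pwDl.
rewrite lte_fin; have := ler_norm r; have := normr_ge0 r; nra.
Qed.

Lemma quadratic_source_bound f f' M a b : (forall x, `|f x| <= M) ->
  (forall x, `|f' x| <= M) ->
  forall x, `|a * f x ^+ 2 + b * f' x ^+ 2| <= (`|a| + `|b|) * M ^+ 2.
Proof.
move=> fM f'M x; have M0 : 0 <= M by exact: le_trans (fM 0).
rewrite (le_trans (ler_normD _ _))// mulrDl (normrM a) (normrM b) !normrX.
by rewrite lerD// ler_wpM2l// lerXn2r ?nnegrE.
Qed.

Lemma quadratic_source_cont f f' (a b : R) : continuous f -> continuous f' ->
  continuous (fun x => a * f x ^+ 2 + b * f' x ^+ 2).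
Proof.
by move=> cf cf'; apply: cont_add; apply: cont_mul; (try exact: cont_cst); exact: cont_sqr.
Qed.

Lemma quadratic_source_L1 f f' (a b : R) : L1 (fun x => f x ^+ 2) ->
  L1 (fun x => f' x ^+ 2) -> L1 (fun x => a * f x ^+ 2 + b * f' x ^+ 2).
Proof. by move=> Lf Lf'; apply: L1D; exact: L1Z. Qed.

Lemma strong_solution_exists l1 l2 l3 l4 l5 l6 s u0 T u : 3 / 2 < s ->
  is_solution l1 l2 l3 l4 l5 l6 s u0 T u ->
  exists ut C C' om, strong_solution l1 l2 l3 l4 l5 l6 T u ut C C' om.
Proof.
move=> s32 [T0 uC0 _ [ut [vC0 utC0 utd] eq]].
have s12 : 1 / 2 < s - 1 by lra.
have [C [om [C0 om0 omc HC]]] := sobolev_C1 s32.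
have [C' HC'] := sobolev_embedding s12.
have cu t : time_interval T t -> continuous (u t) by case/uC0 => -[].
have bnd t : time_interval T t -> exists2 n, 0 < n & C1_bounds C om n (u t).
  move=> Jt; have [[ct /sobolev_norm_lt[n n0 hn]] _] := uC0 t Jt.
  by exists n => //; exact: HC.
have near t e : time_interval T t -> 0 < e -> exists2 d, 0 < d &
    forall t', time_interval T t' -> `|t' - t| < d ->
      C1_bounds C om e (fun x => u t' x - u t x).
  move=> Jt e0; have [_ h] := uC0 t Jt.
  have e20 : (0 < (e ^+ 2)%:E)%E by rewrite lte_fin exprn_gt0.
  have /nbhs_ballP[d /= d0 hd] := h _ (open_ereal_lt' e20).
  exists d => // t' Jt' td; apply: HC => //.
    by apply: cont_sub; exact: cu.
  by apply: hd => //; rewrite /ball/= distrC.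
exists ut, C, C', om; split=> //.
- exact: ltW.
- move=> t1 Jt1.
  have sub t : 0 <= t <= t1 -> time_interval T t.
    move=> /andP[t0 tt1]; split=> //; apply: le_lt_trans (proj2 Jt1).
    by rewrite lee_fin.
  (* Continuity in H^s gives a bound near each time, and compactness of [[0, t1]] a common one. *)
  have /compact_near_coveringP nc := @segment_compact R 0 t1.
  pose P (n t : R) := 0 <= t <= t1 -> C1_bounds C om n (u t).
  have /(nc R (nbhs +oo%R) P) : forall t, `[0, t1]%classic t ->
      \forall t' \near t & n \near +oo%R, P n t'.
    move=> t; rewrite /= in_itv/= => /sub Jt.
    have [n n0 hn] := bnd t Jt.
    have [d d0 hd] := near t 1 Jt ltr01.
    (* Within [d] the solution is [u t], bounded by [n], plus a function bounded by 1; the factor 2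
       is that of [C1_bounds_add]. *)
    exists (ball t d, [set m | 2 * (n + 1) < m]).
      by split; [apply/nbhsx_ballx|apply: nbhs_pinfty_gt]; rewrite ?num_real.
    move=> [t' m] [/= td nm] /sub Jt'.
    apply: (@C1_bounds_le _ _ _ (2 * (n + 1))) => //; first exact: ltW.
    - by rewrite mulr_ge0// addr_ge0// ltW.
    - exact: ltW.
    have td' : `|t' - t| < d by rewrite distrC.
    have := @C1_bounds_add _ C om n 1 _ _ (ltW C0) om0 (ltW n0) ler01 hn (hd t' Jt' td').
    by congr (C1_bounds _ _ _ _); apply/funext => x; rewrite addrC subrK.
  move=> hn.
  have : \forall n \near +oo, 0 < n /\ `[0, t1]%classic `<=` P n.
    near=> n; split; near: n; first exact: nbhs_pinfty_gt.
    exact: hn.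
  move=> /filter_ex[n [n0 Pn]]; exists n => // t tt.
  by apply: Pn => //=; rewrite in_itv.
- by move=> t /utC0[[]].
- move=> t /utC0[[ct /sobolev_norm_lt[n n0 hn]] _]; exists n => //.
  exact: HC'.
- move=> t e Jt e0.
  have e20 : (0 < (e ^+ 2)%:E)%E by rewrite lte_fin exprn_gt0.
  have /nbhs_ballP[d /= d0 hd] := utd t Jt _ (open_ereal_lt' e20).
  exists d => // t' Jt' tt' td; apply: HC' => //.
    apply: cont_sub; last by have [[]] := utC0 t Jt.
    apply: cont_mul; last exact: cont_cst.
    by apply: cont_sub; exact: cu.
  by apply: hd => //; rewrite /ball/= distrC.
- move=> t x t0 tT; have Jt : time_interval T t by split=> //; exact: ltW.
  have [n n0 B] := bnd t Jt.
  have c' := C1_cont B; have b1 := quadratic_source_bound _ _ (C1_sup B) (C1_dsup B).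
  have c1 (a b : R) := quadratic_source_cont (a := a) (b := b) (cu t Jt) c'.
  have := eq t x t0 tT.
  rewrite (pressure_convolution (c1 l3 l4) (b1 l3 l4)).
  rewrite (pressure_convolution (c1 l5 l6) (b1 l5 l6)).
  rewrite (is_derive_derive1 (pressure_derive x (c1 l5 l6) (b1 l5 l6))).
  move: (pressure _ _ _) (pressure _ _ _) => p q.
  by move/eqP; rewrite -!addrA addr_eq0 => /eqP ->; rewrite !addrA.
Unshelve. all: by end_near. Qed.

End strong_solution_exists.

(** * Decay of the energy *)

Section quadratic_form.
Context {R : realType}.
Notation mu := (@lebesgue_measure R).
Implicit Types (f g r : R -> R) (a b h n e : R).

Lemma is_derive_eps (F : R -> R) (t l : R) :
  (forall e, 0 < e -> exists2 d, 0 < d & forall t', t' != t -> `|t' - t| < d ->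
    `|(F t' - F t) / (t' - t) - l| <= e) -> is_derive t (1 : R) F l.
Proof.
move=> H.
have C : h^-1 *: (F (h *: (1 : R) + t) - F t) @[h --> (0 : R)^'] --> l.
  apply/cvgrPdist_le => e /H[d d0 hd].
  apply/nbhs_ballP; exists d => //= h; rewrite /ball/= sub0r normrN => hd' h0.
  have E : h *: (1 : R) + t - t = h by rewrite addrK /GRing.scale/= mulr1.
  have := hd (h *: 1 + t); rewrite -subr_eq0 !E => /(_ h0 hd').
  by rewrite distrC mulrC.
by split; [apply: cvgP C | exact: cvg_lim C].
Qed.

Lemma time_interior (T : \bar R) (t : R) : 0 < t -> (t%:E < T)%E ->
  exists2 d, 0 < d & forall t', `|t' - t| < d -> 0 < t' /\ (t'%:E < T)%E.
Proof.
move=> t0; case: T => [T||//]; last first.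
  move=> _; exists t => // t'; rewrite ltr_norml => /andP[h _].
  by split; [lra|exact: ltry].
rewrite lte_fin => tT; exists (Num.min t (T - t)); first by rewrite lt_min t0 subr_gt0.
move=> t'; rewrite lt_min !ltr_norml => /andP[/andP[h _] /andP[_ h']].
by split; [lra|rewrite lte_fin; lra].
Qed.

Definition energy_h h f := \int[mu]_x (f x ^+ 2 + diff_quot f h x ^+ 2).

(** For fixed [h] the discrete energy is bounded by the L^2 norm alone, so L^2 differentiability of
    [u] in time is enough to differentiate it. *)
Lemma energy_h_le h f : h != 0 -> continuous f -> L1 (fun x => f x ^+ 2) ->
  L1 (fun x => f x ^+ 2 + diff_quot f h x ^+ 2) /\
  energy_h h f <= (1 + 4 / h ^+ 2) * \int[mu]_x (f x ^+ 2).
Proof.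
move=> h0 cf Lf.
have Ls := L1_shift h Lf.
have b x : diff_quot f h x ^+ 2 <= 2 / h ^+ 2 * (f (x + h) ^+ 2 + f x ^+ 2).
  rewrite /diff_quot expr_div_n ler_pdivrMr ?exprn_even_gt0//.
  rewrite mulrAC mulfVK ?expf_neq0//; have := sqr_ge0 (f (x + h) + f x); nra.
have LB : L1 (fun x => 2 / h ^+ 2 * (f (x + h) ^+ 2 + f x ^+ 2)).
  by apply: L1Z; exact: L1D.
have LD : L1 (fun x => diff_quot f h x ^+ 2).
  apply: (L1_le _ LB) => [|x]; last by rewrite ger0_norm ?sqr_ge0.
  apply: measurable_funX; apply: cont_meas; apply: cont_mul; last exact: cont_cst.
  by apply: cont_sub => //; exact: cont_shift.
split; first exact: L1D.
rewrite /energy_h int_add//; have := le_int LD LB b.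
rewrite int_scale; last exact: L1D.
rewrite int_add// (int_shift h Lf).
by set I := \int[mu]_x (f x ^+ 2); set K := Rintegral _ _ _; nra.
Qed.

(** Here [f'] is the state after a time [d], not a derivative: [f' = f + d * (g + r)] with [g] the
    time derivative and [r] the remainder. Expanding the quadratic form leaves twice the pairing of
    [f] with [r], and [d] times the energy of [g + r]. *)
Lemma energy_h_increment h (d e n m : R) f g f' r : h != 0 -> 0 < e ->
  continuous f -> continuous g -> continuous r ->
  L1 (fun x => f x ^+ 2) -> \int[mu]_x (f x ^+ 2) <= n ^+ 2 ->
  L1 (fun x => g x ^+ 2) -> \int[mu]_x (g x ^+ 2) <= m ^+ 2 ->
  L1 (fun x => r x ^+ 2) -> \int[mu]_x (r x ^+ 2) <= e ^+ 2 ->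
  d != 0 -> `|d| <= e ->
  (forall x, (f' x - f x) / d - g x = r x) ->
  `|(energy_h h f' - energy_h h f) / d -
     2 * \int[mu]_x (f x * g x + diff_quot f h x * diff_quot g h x)|
  <= (1 + 4 / h ^+ 2) * (e * (n ^+ 2 + 1 + 2 * m ^+ 2 + 2 * e ^+ 2)).
Proof.
move=> h0 e0 cf cg cr Lf If Lg Ig Lr Ir d0 de rE.
have [Ef ef] := energy_h_le h0 cf Lf.
have [Eg eg] := energy_h_le h0 cg Lg.
have [Er er] := energy_h_le h0 cr Lr.
pose D := fun k : R -> R => diff_quot k h.
have f'E x : f' x = f x + d * (g x + r x) by rewrite -rE; field.
have cf' : continuous f'.
  rewrite (_ : f' = fun x => f x + d * (g x + r x)); last exact/funext.
  apply: cont_add => //; apply: cont_mul; first exact: cont_cst.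
  exact: cont_add.
have Lf' : L1 (fun x => f' x ^+ 2).
  have [Lgr _] := L1_sqr_add (cont_meas cg) (cont_meas cr) Lg Lr.
  have mgr : measurable_fun setT (fun x => d * (g x + r x)).
    apply: cont_meas; apply: cont_mul; first exact: cont_cst.
    exact: cont_add.
  have Ld : L1 (fun x => (d * (g x + r x)) ^+ 2).
    by apply: L1_eq (L1Z (d ^+ 2) Lgr) => x; rewrite exprMn.
  have [L _] := L1_sqr_add (cont_meas cf) mgr Lf Ld.
  by apply: L1_eq L => x; rewrite f'E.
have [Ef' _] := energy_h_le h0 cf' Lf'.
have LDk (k : R -> R) : continuous k -> L1 (fun x => k x ^+ 2) ->
   L1 (fun x => k x ^+ 2 + D k x ^+ 2) -> L1 (fun x => D k x ^+ 2).
  move=> ck Lk Ek; apply: L1_eq (L1B Ek Lk) => x.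
  by rewrite addrAC subrr add0r.
have mD (k : R -> R) : continuous k -> measurable_fun setT (D k).
  move=> ck; apply: cont_meas; apply: cont_mul; last exact: cont_cst.
  by apply: cont_sub => //; exact: cont_shift.
have Lfg : L1 (fun x => f x * g x + D f x * D g x).
  apply: L1D; first exact: (L1_mul_sqr (cont_meas cf) (cont_meas cg)).
  by apply: L1_mul_sqr; [exact: mD|exact: mD|exact: LDk|exact: LDk].
pose k x := (f' x ^+ 2 + D f' x ^+ 2 - (f x ^+ 2 + D f x ^+ 2)) / d
   - 2 * (f x * g x + D f x * D g x).
have Lk : L1 k.
  apply: L1B; last exact: L1Z.
  by apply: (@L1_eq _ (fun x => d^-1 * (f' x ^+ 2 + D f' x ^+ 2 - (f x ^+ 2 + D f x ^+ 2))));
    [move=> x; rewrite mulrC|apply: L1Z; exact: L1B].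
have -> : (energy_h h f' - energy_h h f) / d -
     2 * \int[mu]_x (f x * g x + diff_quot f h x * diff_quot g h x) = \int[mu]_x k x.
  rewrite /k int_sub//; last 2 first.
    by apply: (@L1_eq _ (fun x => d^-1 * (f' x ^+ 2 + D f' x ^+ 2 - (f x ^+ 2 + D f x ^+ 2))));
      [move=> x; rewrite mulrC|apply: L1Z; exact: L1B].
    exact: L1Z.
  rewrite (int_scale _ Lfg); congr (_ - _).
  rewrite /energy_h -int_sub// mulrC -int_scale; last exact: L1B.
  by apply: eq_int => x; rewrite mulrC.
pose N f x := f x ^+ 2 + D f x ^+ 2.
(* The weight [e] in Young's inequality fits because [N r] integrates to order [e ^+ 2]. *)
pose G x := e * N f x + e^-1 * N r x + e * (2 * N g x + 2 * N r x).
have LG : L1 G.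
  apply: L1D; first by apply: L1D; exact: L1Z.
  by apply: L1Z; apply: L1D; exact: L1Z.
have kG x : `|k x| <= G x.
  have -> : k x = 2 * (f x * r x + D f x * D r x) +
      d * ((g x + r x) ^+ 2 + (D g x + D r x) ^+ 2).
    by rewrite /k /D /diff_quot !f'E; field; rewrite h0 d0.
  rewrite /G /N; move: (f x) (g x) (r x) (D f x) (D g x) (D r x) => a b c a' b' c'.
  rewrite (le_trans (ler_normD _ _))//; apply: lerD.
    have amgm (p q : R) : 2 * `|p * q| <= e * p ^+ 2 + e^-1 * q ^+ 2.
      rewrite -(real_normK (num_real p)) -(real_normK (num_real q)) normrM -subr_ge0.
      move: (`|p|) (`|q|) => y z.
      have -> : e * y ^+ 2 + e^-1 * z ^+ 2 - 2 * (y * z) = e^-1 * (e * y - z) ^+ 2.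
        by field; exact: lt0r_neq0.
      by rewrite mulr_ge0 ?sqr_ge0// invr_ge0 ltW.
    rewrite normrM ger0_norm//.
    have := ler_normD (a * c) (a' * c'); have := amgm a c; have := amgm a' c'.
    by lra.
  rewrite normrM [X in _ * X]ger0_norm ?addr_ge0 ?sqr_ge0//.
  apply: ler_pM => //; first by rewrite addr_ge0 ?sqr_ge0.
  by have := sqr_ge0 (b - c); have := sqr_ge0 (b' - c'); nra.
apply: (le_trans (norm_int_le Lk LG kG)).
rewrite /G int_add; last 2 first.
  by apply: L1D; exact: L1Z.
  by apply: L1Z; apply: L1D; exact: L1Z.
rewrite int_add; [|exact: L1Z|exact: L1Z].
rewrite (int_scale _ Ef) (int_scale _ Er) int_scale; last by apply: L1D; exact: L1Z.
rewrite (int_add (L1Z 2 Eg) (L1Z 2 Er)).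
rewrite (int_scale _ Eg) (int_scale _ Er).
rewrite -/(energy_h h f) -/(energy_h h g) -/(energy_h h r).
set c := 1 + 4 / h ^+ 2 in ef eg er *.
have c0 : 0 <= c by rewrite addr_ge0// divr_ge0// sqr_ge0.
have ef' := le_trans ef (ler_wpM2l c0 If).
have eg' := le_trans eg (ler_wpM2l c0 Ig).
have er' := le_trans er (ler_wpM2l c0 Ir).
have -> : c * (e * (n ^+ 2 + 1 + 2 * m ^+ 2 + 2 * e ^+ 2)) =
  e * (c * n ^+ 2) + e^-1 * (c * e ^+ 2) + e * (2 * (c * m ^+ 2) + 2 * (c * e ^+ 2)).
  by field; exact: lt0r_neq0.
apply: lerD; first by apply: lerD; apply: ler_wpM2l; rewrite ?invr_ge0// ltW.
apply: ler_wpM2l; first exact: ltW.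
by apply: lerD; rewrite ler_wpM2l.
Qed.

End quadratic_form.

Lemma perturbed_le (R : realType) (x1 x2 y1 y2 a b c d e : R) :
  - (y2 - x2) <= a -> y1 - x1 <= a -> y2 - y1 = c -> c <= b ->
  d = a + a + b -> d <= e -> x2 <= x1 + e.
Proof. by lra. Qed.

(** * Comparison of the energy with its discrete version *)

Section energy_static.
Context {R : realType}.
Notation mu := (@lebesgue_measure R).
Implicit Types (f g om : R -> R) (C h n m e : R).

Definition energy f := \int[mu]_x (f x ^+ 2) + \int[mu]_x (derive1 f x ^+ 2).

Lemma C1_bounds_cont C om n f : C1_bounds C om n f -> continuous f.
Proof. by move=> /C1_derive; exact: is_derive_continuous. Qed.

(** The difference quotient lies within [e * n] of the derivative in L^2, so the squared norms
    differ by at most [(e n)^2 + 2 e n^2], which is at most [3 e n^2] as [e <= 1]. *)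
Lemma diff_quot_energy C om n f h e : 0 < n -> h != 0 -> 0 <= om h -> om h <= e ->
  0 < e -> e <= 1 -> C1_bounds C om n f ->
  [/\ L1 (fun x => diff_quot f h x ^+ 2),
      \int[mu]_x (diff_quot f h x ^+ 2) <= 4 * n ^+ 2 &
      `|energy_h h f - energy f| <= 3 * e * n ^+ 2].
Proof.
move=> n0 h0 om0 ome e0 e1 B.
have [Lf' If'] := C1_dL2 B; have [Lr Ir] := C1_quot B h0.
have en0 : 0 < e * n by rewrite mulr_gt0.
have Ir' : \int[mu]_x ((diff_quot f h x - derive1 f x) ^+ 2) <= (e * n) ^+ 2.
  rewrite (le_trans Ir)// lerXn2r ?nnegrE ?mulr_ge0//; last by rewrite ler_wpM2r// ltW.
  - exact: ltW.
  - exact: ltW.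
  - exact: ltW.
have cf := C1_bounds_cont B.
have mD : measurable_fun setT (diff_quot f h).
  apply: cont_meas; apply: cont_mul; last exact: cont_cst.
  by apply: cont_sub => //; exact: cont_shift.
have [LD ID] := int_sqr_close en0 n0 mD (cont_meas (C1_cont B)) Lr Ir' Lf' If'.
have ID' : `|\int[mu]_x (diff_quot f h x ^+ 2) - \int[mu]_x (derive1 f x ^+ 2)| <= 3 * e * n ^+ 2.
  apply: (le_trans ID).
  have : 0 <= (1 - e) * (e * n ^+ 2) by rewrite !mulr_ge0 ?subr_ge0 ?sqr_ge0// ltW.
  have -> : (1 - e) * (e * n ^+ 2) = 3 * e * n ^+ 2 - ((e * n) ^+ 2 + 2 * (e * n * n)) by ring.
  by rewrite subr_ge0.
split=> //.
  have := ler_norm (\int[mu]_x (diff_quot f h x ^+ 2) - \int[mu]_x (derive1 f x ^+ 2)).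
  have : e * n ^+ 2 <= n ^+ 2 by rewrite ler_piMl ?sqr_ge0.
  rewrite -mulrA in ID'; move: ID' If'; clear; move: (e * n ^+ 2) (n ^+ 2) => p q.
  by set A := Rintegral _ _ _; set B := Rintegral _ _ _; lra.
have [Lf _] := C1_L2 B.
by rewrite /energy_h /energy int_add// opprD addrACA subrr add0r.
Qed.

Lemma energy_close C om n m e f g : 0 < n -> 0 < e ->
  C1_bounds C om m f -> C1_bounds C om n g ->
  C1_bounds C om e (fun x => f x - g x) ->
  `|energy f - energy g| <= 2 * (e ^+ 2 + 2 * (e * n)).
Proof.
move=> n0 e0 Bf Bg Bd.
have E x : derive1 (fun x => f x - g x) x = derive1 f x - derive1 g x.
  exact: is_derive_derive1 (is_derive_sub (C1_derive Bf x) (C1_derive Bg x)).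
have [Lg Ig] := C1_L2 Bg; have [Lg' Ig'] := C1_dL2 Bg.
have [Ld Id] := C1_L2 Bd; have [Ld' Id'] := C1_dL2 Bd.
have E2 x : derive1 (fun x => f x - g x) x ^+ 2 = (derive1 f x - derive1 g x) ^+ 2.
  by rewrite E.
move: Ld' Id'; rewrite (eq_int E2) => /(L1_eq E2) Ld' Id'.
have [_ h1] := int_sqr_close e0 n0 (cont_meas (C1_bounds_cont Bf))
  (cont_meas (C1_bounds_cont Bg)) Ld Id Lg Ig.
have [_ h2] := int_sqr_close e0 n0 (cont_meas (C1_cont Bf))
  (cont_meas (C1_cont Bg)) Ld' Id' Lg' Ig'.
rewrite /energy opprD addrACA (le_trans (ler_normD _ _))//.
by rewrite [2 * _]mulr_natl mulr2n lerD.
Qed.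

Lemma mod_small om e : om h @[h --> (0 : R)] --> (0 : R) -> 0 < e ->
  exists h, [/\ 0 < h, h <= e & forall y, `|y| <= h -> om y <= e].
Proof.
move=> /cvgrPdist_lt h e0; have /nbhs_ballP[d /= d0 hd] := h e e0.
exists (Num.min (d / 2) e); split.
- by rewrite lt_min e0 divr_gt0.
- by rewrite ge_min lexx orbT.
move=> y; rewrite le_min => /andP[yd _].
have /hd : ball 0 d y by rewrite /ball/= sub0r normrN; lra.
by rewrite sub0r normrN => /ltW; apply: le_trans; exact: ler_norm.
Qed.

End energy_static.

Section energy_flow.
Context {R : realType}.
Notation mu := (@lebesgue_measure R).
Context (l1 l2 l3 l4 l5 l6 : R) (T : \bar R) (u ut : R -> R -> R) (C C' : R) (om : R -> R).
Context (H : strong_solution l1 l2 l3 l4 l5 l6 T u ut C C' om).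
Implicit Types (t h e n : R).

Lemma time_interval_pos t : 0 < t -> (t%:E < T)%E -> time_interval T t.
Proof. by move=> t0 tT; split=> //; exact: ltW. Qed.

Lemma sol_bound t : time_interval T t -> exists2 n, 0 < n & C1_bounds C om n (u t).
Proof.
move=> Jt; have [n n0 hn] := sol_bounded H Jt; exists n => //; apply: hn.
by rewrite lexx andbT; case: Jt.
Qed.

Lemma energy_h_derive h t : h != 0 -> 0 < t -> (t%:E < T)%E ->
  is_derive t (1 : R) (fun t => energy_h h (u t))
    (2 * \int[mu]_x (ut t x * (u t x - second_quot (u t) h x))).
Proof.
move=> h0 t0 tT; have Jt := time_interval_pos t0 tT.
have [n n0 B] := sol_bound Jt; have [m m0 [_ Lg Ig]] := sol_dbounded H Jt.
have [d1 d10 hd1] := time_interior t0 tT.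
have cf := C1_bounds_cont B; have cg := sol_dcont H Jt.
have [Lf If] := C1_L2 B.
have mf := cont_meas cf; have mg := cont_meas cg.
(* Summation by parts puts both differences on [u], as the derivative of the energy pairs
   [diff_quot (u t)] with [diff_quot (ut t)]. *)
have EI : \int[mu]_x (ut t x * (u t x - second_quot (u t) h x)) =
    \int[mu]_x (u t x * ut t x + diff_quot (u t) h x * diff_quot (ut t) h x).
  have L1a := L1_mul_sqr mg mf Lg Lf.
  have mD (k : R -> R) : continuous k -> measurable_fun setT (diff_quot k h).
    move=> ck; apply: cont_meas; apply: cont_mul; last exact: cont_cst.
    by apply: cont_sub => //; exact: cont_shift.
  have LD (k : R -> R) : continuous k -> L1 (fun x => k x ^+ 2) -> L1 (fun x => diff_quot k h x ^+ 2).
    move=> ck Lk; have [E _] := energy_h_le h0 ck Lk.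
    by apply: L1_eq (L1B E Lk) => x; rewrite addrAC subrr add0r.
  have L1b : L1 (fun x => diff_quot (ut t) h x * diff_quot (u t) h x).
    by apply: L1_mul_sqr; [exact: mD|exact: mD|exact: LD|exact: LD].
  have L1c : L1 (fun x => ut t x * second_quot (u t) h x).
    apply: L1_mul_sqr => //.
      apply: cont_meas; apply: cont_mul; last exact: cont_cst.
      apply: cont_add; last exact: (@cont_shift _ (u t) (- h)).
      apply: cont_sub; first exact: cont_shift.
      by apply: cont_mul => //; exact: cont_cst.
    pose D := diff_quot (u t) h.
    have cD : continuous D.
      by apply: cont_mul; [apply: cont_sub => //; exact: cont_shift|exact: cont_cst].
    have LDD := L1_shift (- h) (LD D cD (LD _ cf Lf)).
    apply: L1_eq LDD => x; congr (_ ^+ 2); rewrite /D /diff_quot /second_quot subrK.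
    by field.
  rewrite -[RHS](eq_int (f := fun x => ut t x * u t x + diff_quot (ut t) h x * diff_quot (u t) h x));
    last by move=> x; rewrite [X in X + _]mulrC [X in _ + X]mulrC.
  rewrite (int_add L1a L1b) (int_diff_quot_prod mg mf Lg Lf h0) -(int_sub L1a L1c).
  by apply: eq_int => x; rewrite mulrBr.
rewrite EI; apply: is_derive_eps => e e0.
set c := 1 + 4 / h ^+ 2.
have c0 : 0 < c by rewrite ltr_wpDr// divr_ge0// sqr_ge0.
(* Once [e' <= 1], the error of [energy_h_increment] is at most [e' * K], hence at most [e]. *)
pose K := c * (n ^+ 2 + 1 + 2 * m ^+ 2 + 2).
have K0 : 0 < K by apply: mulr_gt0 => //; have := sqr_ge0 n; have := sqr_ge0 m; lra.
pose e' := Num.min 1 (e / K).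
have e'0 : 0 < e' by rewrite lt_min ltr01 divr_gt0.
have [d2 d20 hd2] := sol_derive H Jt e'0.
exists (Num.min (Num.min d1 d2) e'); first by rewrite 2!lt_min d10 d20 e'0.
move=> t' tt'; rewrite 2!lt_min => /andP[/andP[td1 td2] /ltW te'].
have [t'0 t'T] := hd1 t' td1; have Jt' := time_interval_pos t'0 t'T.
have [_ Lr Ir] := hd2 t' Jt' tt' td2.
have [n' _ B'] := sol_bound Jt'.
have cr : continuous (fun x => (u t' x - u t x) / (t' - t) - ut t x).
  apply: cont_sub => //; apply: cont_mul; last exact: cont_cst.
  by apply: cont_sub => //; exact: C1_bounds_cont B'.
have tt0 : t' - t != 0 by rewrite subr_eq0.
apply: (le_trans (energy_h_increment h0 e'0 cf cg cr Lf If Lg Ig Lr Ir tt0 te'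
  (fun x => erefl))).
rewrite -/c.
have e'1 : e' <= 1 by rewrite ge_min lexx.
have : e' * K <= e by rewrite -ler_pdivlMr// ge_min lexx orbT.
apply: le_trans; rewrite /K mulrCA; apply: ler_wpM2l; first exact: ltW.
apply: ler_wpM2l; first exact: ltW.
by rewrite lerD2l -[leRHS]mulr1 ler_wpM2l// expr_le1// ltW.
Qed.

Context (h13 : l1 + l3 = 0) (h14 : 2 * l1 + l4 = 0) (h26 : l2 = 2 * l6).

Lemma energy_h_rate t n h e : 0 < t -> (t%:E < T)%E -> 0 < n ->
  C1_bounds C om n (u t) -> 0 < h -> h <= e -> e <= 1 ->
  (forall y, `|y| <= h -> om y <= e) ->
  `|2 * \int[mu]_x (ut t x * (u t x - second_quot (u t) h x))|
  <= 2 * (energy_const (C * n) (4 * n ^+ 2) l1 l2 l3 l4 l5 l6 * (e + e * n)).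
Proof.
move=> t0 tT n0 B h0 he e1 ome.
have e0 : 0 < e by exact: lt_le_trans he.
have [Lf If] := C1_L2 B; have [Lf' If'] := C1_dL2 B.
have n4 : n ^+ 2 <= 4 * n ^+ 2 by have := sqr_ge0 n; lra.
have omh : om h <= e by apply: ome; rewrite ger0_norm// ltW.
have [LD ID _] := diff_quot_energy n0 (lt0r_neq0 h0) (mod_ge0 H h) omh e0 e1 B.
have fw x y : `|y| <= h -> `|derive1 (u t) (x + y) - derive1 (u t) x| <= e * n.
  move=> yh; apply: (le_trans (C1_mod B x y)).
  by apply: ler_wpM2r; [exact: ltW|exact: ome].
rewrite normrM ger0_norm// ler_wpM2l//.
have := energy_rate (C1_derive B) (C1_cont B) (C1_sup B) (C1_dsup B) h0 fw
  Lf (le_trans If n4) Lf' (le_trans If' n4) LD ID h13 h14 h26 (fun x => sol_equation H x t0 tT).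
move/le_trans; apply; apply: ler_wpM2l; last by rewrite lerD2r.
have C0 := mod_const_ge0 H.
have a1 := normr_ge0 l1; have a2 := normr_ge0 l2; have a3 := normr_ge0 l3.
have a4 := normr_ge0 l4; have a5 := normr_ge0 l5; have a6 := normr_ge0 l6.
rewrite /energy_const; apply: mulr_ge0; first by rewrite mulr_ge0// sqr_ge0.
have M0 : 0 <= C * n by rewrite mulr_ge0// ltW.
have M4 : 0 <= 4 * (C * n) by rewrite mulr_ge0.
apply: addr_ge0; last by apply: mulr_ge0; exact: addr_ge0.
apply: addr_ge0; last by apply: mulr_ge0 => //; exact: addr_ge0.
by apply: addr_ge0; apply: mulr_ge0 => //; exact: addr_ge0.
Qed.

(** The mean value theorem in time applies to the discrete energy, whose rate is of order [e'],
    while the two energies differ by order [e'] at both ends. All constants depend only on the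
    common bound [n] over [[0, t2]], so [e'] can tend to 0. *)
Lemma energy_le_pos t1 t2 : 0 < t1 -> t1 <= t2 -> (t2%:E < T)%E ->
  energy (u t2) <= energy (u t1).
Proof.
move=> t10 t12 t2T; have t20 : 0 < t2 by exact: lt_le_trans t12.
have [n n0 B] := sol_bounded H (time_interval_pos t20 t2T).
pose EC := energy_const (C * n) (4 * n ^+ 2) l1 l2 l3 l4 l5 l6.
pose K := 6 * n ^+ 2 + 2 * (EC * (1 + n)) * (t2 - t1).
apply/ler_addgt0Pr => e e0.
pose e' := Num.min 1 (e / (1 + `|K|)).
have K1 : 0 < 1 + `|K| by rewrite ltr_pwDl.
have e'0 : 0 < e' by rewrite lt_min ltr01 divr_gt0.
have e'1 : e' <= 1 by rewrite ge_min lexx.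
have e'K : e' * K <= e.
  have : e' * (1 + `|K|) <= e by rewrite -ler_pdivlMr// ge_min lexx orbT.
  by apply: le_trans; rewrite ler_wpM2l ?(ltW e'0)//; have := ler_norm K; lra.
have [h [h0 he' home]] := mod_small (mod_cvg0 H) e'0.
have omh : om h <= e' by apply: home; rewrite ger0_norm// ltW.
have sub t : t1 <= t <= t2 -> [/\ 0 < t, (t%:E < T)%E & C1_bounds C om n (u t)].
  move=> /andP[t1t tt2]; have t0 : 0 < t by exact: lt_le_trans t1t.
  split=> //; first by apply: le_lt_trans t2T; rewrite lee_fin.
  by apply: B; rewrite tt2 ltW.
have close t : t1 <= t <= t2 -> `|energy_h h (u t) - energy (u t)| <= 3 * e' * n ^+ 2.
  move=> /sub[t0 tT Bt].
  by have [] := diff_quot_energy n0 (lt0r_neq0 h0) (mod_ge0 H h) omh e'0 e'1 Bt.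
have [||c] := @MVT_segment _ (fun t => energy_h h (u t)) (fun t => 2 * \int[mu]_x (ut t x * (u t x - second_quot (u t) h x))) t1 t2 t12.
- move=> t; rewrite in_itv/= => /andP[t1t tt2].
  have [t0 tT _] := sub t (introT andP (conj (ltW t1t) (ltW tt2))).
  exact: energy_h_derive (lt0r_neq0 h0) t0 tT.
- apply: derivable_within_continuous => t; rewrite in_itv/= => /sub[t0 tT _].
  exact: is_derive_derivable (energy_h_derive (lt0r_neq0 h0) t0 tT).
rewrite in_itv/= => /sub[c0 cT Bc] E.
have := energy_h_rate c0 cT n0 Bc h0 he' e'1 home; rewrite -/EC.
set I := 2 * _ in E *; move=> hI.
have c1 : t1 <= t1 <= t2 by rewrite lexx.
have c2 : t1 <= t2 <= t2 by rewrite lexx andbT.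
have /ler_normlP[k1 _] := close _ c2.
have /ler_normlP[_ k2] := close _ c1.
have hb : I * (t2 - t1) <= 2 * (EC * (e' + e' * n)) * (t2 - t1).
  by rewrite ler_wpM2r ?subr_ge0// (le_trans (ler_norm _)).
apply: (perturbed_le k1 k2 E hb _ e'K).
by rewrite /K; ring.
Qed.

(** The equation is not given at time 0; a small time [r] is compared with 0 by continuity in
    H^s. *)
Lemma energy_le t : time_interval T t -> energy (u t) <= energy (u 0).
Proof.
move=> Jt; have [t0 tT] := Jt.
move: t0; rewrite le_eqVlt => /predU1P[<-//|t0].
have J0 : time_interval T 0 by split=> //; apply: le_lt_trans tT; rewrite lee_fin ltW.
have [n n0 B] := sol_bound J0.
apply/ler_addgt0Pr => e e0.
pose e' := Num.min 1 (e / (2 * (1 + 2 * n))).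
have K1 : 0 < 2 * (1 + 2 * n) by rewrite mulr_gt0// addr_gt0// mulr_gt0.
have e'0 : 0 < e' by rewrite lt_min ltr01 divr_gt0.
have e'1 : e' <= 1 by rewrite ge_min lexx.
have e'K : e' * (2 * (1 + 2 * n)) <= e by rewrite -ler_pdivlMr// ge_min lexx orbT.
have [d d0 hd] := sol_cont H J0 e'0.
pose r := Num.min (d / 2) t.
have r0 : 0 < r by rewrite lt_min t0 divr_gt0.
have rt : r <= t by rewrite ge_min lexx orbT.
have rd : r < d.
  have : r <= d / 2 by rewrite ge_min lexx.
  by lra.
have rT : (r%:E < T)%E by apply: le_lt_trans tT; rewrite lee_fin.
have Jr := time_interval_pos r0 rT.
have [m m0 Bm] := sol_bound Jr.
have rd' : `|r - 0| < d by rewrite subr0 ger0_norm// ltW.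
have h1 := energy_close n0 e'0 Bm B (hd r Jr rd').
apply: (le_trans (energy_le_pos r0 rt tT)).
rewrite -lerBlDl (le_trans (ler_norm _))// (le_trans h1)// (le_trans _ e'K)//.
rewrite [leRHS]mulrCA ler_wpM2l// mulrDr mulr1 [e' * (2 * n)]mulrCA lerD2r.
by rewrite expr2 ler_piMl// ltW.
Qed.

End energy_flow.

(** * Pointwise bounds *)

Section pointwise_bounds.
Context {R : realType}.
Notation mu := (@lebesgue_measure R).
Implicit Types (f g v : R -> R) (a b x y h e M N d : R).

Lemma int_itv_le f g a b : continuous f -> continuous g -> (forall x, f x <= g x) ->
  \int[mu]_(x in `[a, b]) f x <= \int[mu]_(x in `[a, b]) g x.
Proof.
move=> cf cg fg; rewrite [leLHS]Rintegral_mkcond [leRHS]Rintegral_mkcond.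
apply: le_int => [||x]; [exact: L1_trunc_itv|exact: L1_trunc_itv|].
by rewrite !patchE; case: ifP.
Qed.

Lemma int_itv_le_int f a b : continuous f -> (forall x, 0 <= f x) -> L1 f ->
  \int[mu]_(x in `[a, b]) f x <= \int[mu]_x f x.
Proof.
move=> cf f0 Lf; rewrite [leLHS]Rintegral_mkcond.
apply: le_int => [||x]; [exact: L1_trunc_itv|exact: Lf|].
by rewrite !patchE; case: ifP.
Qed.

Lemma int_itv_add f a x b : continuous f -> a <= x -> x <= b ->
  \int[mu]_(y in `[a, x]) f y + \int[mu]_(y in `[x, b]) f y = \int[mu]_(y in `[a, b]) f y.
Proof.
move=> cf ax xb.
have hi c d : mu.-integrable `[c, d] (EFin \o f).
  apply: continuous_compact_integrable; first exact: segment_compact.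
  exact: continuous_subspaceT.
have := @Rintegral_itvB _ f (BLeft a) (BRight b) x (hi a b).
rewrite !bnd_simp => /(_ ax xb) E.
have E' := @Rintegral_itv_obnd_cbnd _ x (BRight b) f.
rewrite -E'; first by rewrite -E addrC subrK.
apply: integrableS (hi x b) => //.
by apply: subset_itvr; rewrite bnd_simp.
Qed.

(** If [|f x| > e], the Lipschitz bound keeps [|f| >= e / 2] on an interval of length
    [d = e / (2 * M)], which contributes at least [e ^+ 2 / 4 * d] to the integral of [f ^+ 2]. Far
    out this exceeds the mass that is left. *)
Lemma vanish_at_infinity f M : 0 < M -> (forall a b, `|f b - f a| <= M * `|b - a|) ->
  continuous f -> L1 (fun x => f x ^+ 2) ->
  forall e, 0 < e -> exists2 N, 0 < N & forall x, N <= `|x| -> `|f x| <= e.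
Proof.
move=> M0 fM cf Lf e e0.
(* A weight equal to 1 beyond [n.+1] and tending to 0 pointwise: dominated convergence makes the
   tail of [f ^+ 2] small. *)
pose psi (n : nat) x : R := Num.min 1 (`|x| / n.+1%:R).
have psi0 n x : 0 <= psi n x by rewrite le_min ler01 divr_ge0.
have psi1 n x : psi n x <= 1 by rewrite ge_min lexx.
have mpsi n : measurable_fun setT (psi n).
  apply: measurable_minr => //; apply: cont_meas; apply: cont_mul; last exact: cont_cst.
  by apply: cont_norm; exact: cont_id.
pose d := e / (2 * M); have d0 : 0 < d by rewrite divr_gt0// mulr_gt0.
have c0 : 0 < e ^+ 2 / 4 * d by rewrite mulr_gt0// divr_gt0// exprn_gt0.
have mf2 := L1_measurable Lf.
have mfn n : measurable_fun setT (fun x => f x ^+ 2 * psi n x) by exact: measurable_funM.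
have [||||| _ cv] := @int_cvg R (fun n x => f x ^+ 2 * psi n x) (fun=> 0) (fun x => f x ^+ 2).
- exact: mfn.
- exact: measurable_cst.
- move=> x; rewrite -(mulr0 (f x ^+ 2)); apply: cvgMr.
  apply: (@squeeze_cvgr _ _ _ _ (fun=> 0) (fun n => `|x| / n.+1%:R)).
  + by apply: nearW => n; rewrite psi0 ge_min lexx orbT.
  + exact: cvg_cst.
  + rewrite -(mulr0 `|x|); apply: cvgMr; exact: cvg_harmonic.
- exact: Lf.
- move=> n x /=.
  rewrite ger0_norm; last by rewrite mulr_ge0 ?sqr_ge0.
  exact: ler_piMr (sqr_ge0 _) (psi1 n x).
have : \forall n \near \oo, `|\int[mu]_x (0 : R) - \int[mu]_x (f x ^+ 2 * psi n x)| < e ^+ 2 / 4 * d.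
  by move/cvgrPdist_lt : cv => /(_ _ c0).
move=> /filter_ex[n]; rewrite Rintegral_cst//= mul0r sub0r normrN => hn.
(* The extra [d] keeps all of [[x, x + d]] in the region where [psi n] is 1. *)
exists (n.+1%:R + d); first by rewrite addr_gt0.
move=> x xN; rewrite leNgt; apply/negP => ex.
suff : e ^+ 2 / 4 * d <= \int[mu]_y (f y ^+ 2 * psi n y).
  by rewrite leNgt (le_lt_trans (ler_norm _) hn).
have xd : x <= x + d by rewrite lerDl ltW.
have -> : e ^+ 2 / 4 * d = \int[mu]_y ((fun=> e ^+ 2 / 4) \_ `[x, x + d]) y.
  have dc y : is_derive y (1 : R) (fun y => e ^+ 2 / 4 * y) ((fun=> e ^+ 2 / 4) y).
    by refine (is_deriveE (is_derive_scale (e ^+ 2 / 4) (is_derive_x y)) _); rewrite mulr1.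
  rewrite -Rintegral_mkcond (int_deriv dc (@cont_cst R _) xd).
  by rewrite -mulrBr [x + d - x]addrAC subrr add0r.
apply: le_int.
- exact: (@L1_trunc_itv R (fun=> e ^+ 2 / 4) x (x + d) (@cont_cst R _)).
- apply: L1_le (mfn n) Lf _ => y.
  rewrite ger0_norm; last by rewrite mulr_ge0 ?sqr_ge0.
  exact: ler_piMr (sqr_ge0 _) (psi1 n y).
move=> y; rewrite patchE; case: ifPn => [|_]; last by rewrite mulr_ge0// sqr_ge0.
rewrite inE/= in_itv/= => /andP[xy yd].
have yx : `|y - x| <= d by rewrite ger0_norm ?subr_ge0// lerBlDl.
have yN : n.+1%:R <= `|y|.
  have := ler_normD (x - y) y; rewrite subrK distrC => h; lra.
have -> : psi n y = 1.
  by apply/min_idPl; rewrite ler_pdivlMr// mul1r.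
rewrite mulr1 -(real_normK (num_real (f y))).
have : e / 2 <= `|f y|.
  have h1 := fM x y; have h2 := ler_normD (f x - f y) (f y).
  rewrite subrK distrC in h2.
  have : M * `|y - x| <= e / 2.
    have -> : e / 2 = M * d by rewrite /d; field; exact: lt0r_neq0.
    by rewrite ler_pM2l.
  by lra.
move=> h; have -> : e ^+ 2 / 4 = (e / 2) ^+ 2 by field.
by rewrite lerXn2r ?nnegrE// divr_ge0// ltW.
Qed.

Lemma C1_bounds_vanish C om n f : 0 <= C -> 0 < n -> C1_bounds C om n f ->
  forall e, 0 < e -> exists2 N, 0 < N & forall x, N <= `|x| -> `|f x| <= e.
Proof.
move=> C0 n0 B; have M0 : 0 < C * n + 1 by rewrite ltr_wpDl// mulr_ge0// ltW.
apply: (vanish_at_infinity M0) => //; last by have [] := C1_L2 B.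
  apply: lipschitz_of_derive (C1_derive B) _ => x.
  by rewrite (le_trans (C1_dsup B x))// lerDl.
exact: C1_bounds_cont B.
Qed.

(** The derivative of [f ^+ 2] lies between [- (f^2 + f'^2)] and [f^2 + f'^2]. Integrating from
    either end of the line, where [f] vanishes, bounds [2 f(x)^2] by the energy; this is the 1/2 in
    [|l5| / 2]. *)
Lemma sqr_le_energy C om n f x : 0 <= C -> 0 < n -> C1_bounds C om n f ->
  f x ^+ 2 <= 2^-1 * energy f.
Proof.
move=> C0 n0 B; have cf := C1_bounds_cont B; have cf' := C1_cont B.
have [Lf _] := C1_L2 B; have [Lf' _] := C1_dL2 B.
pose g y := f y ^+ 2 + derive1 f y ^+ 2.
have cg : continuous g by apply: cont_add; exact: cont_sqr.
have g0 y : 0 <= g y by rewrite addr_ge0 ?sqr_ge0.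
have Lg : L1 g by exact: L1D.
have -> : energy f = \int[mu]_y g y by rewrite /energy int_add.
pose k y := 2 * f y * derive1 f y.
have dk y : is_derive y (1 : R) (fun y => f y ^+ 2) (k y).
  exact: is_derive_sqr (C1_derive B y).
have ck : continuous k.
  by apply: cont_mul => //; apply: cont_mul => //; exact: cont_cst.
have kg y : k y <= g y by rewrite /k /g; have := sqr_ge0 (f y - derive1 f y); nra.
have kg' y : - g y <= k y by rewrite /k /g; have := sqr_ge0 (f y + derive1 f y); nra.
apply/ler_addgt0Pr => e e0.
pose r := Num.min 1 e; have r0 : 0 < r by rewrite lt_min ltr01.
have r2 : r ^+ 2 <= e.
  have r1 : r <= 1 by rewrite ge_min lexx.
  have re : r <= e by rewrite ge_min lexx orbT.
  by apply: le_trans re; rewrite expr2 ler_piMl// ltW.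
have [N N0 hN] := C1_bounds_vanish C0 n0 B r0.
have Hsq y : N <= `|y| -> f y ^+ 2 <= e.
  move=> /hN h; apply: le_trans r2; rewrite -(real_normK (num_real (f y))).
  by rewrite lerXn2r ?nnegrE// ltW.
have nx := ler_norm x; have nx' := ler_norm (- x); rewrite normrN in nx'.
have a0 : x - (N + `|x|) <= x by lra.
have b0 : x <= x + (N + `|x|) by lra.
have ha : f (x - (N + `|x|)) ^+ 2 <= e.
  by apply: Hsq; rewrite -normrN; apply: le_trans (ler_norm _); lra.
have hb : f (x + (N + `|x|)) ^+ 2 <= e.
  by apply: Hsq; apply: le_trans (ler_norm _); lra.
have I1 := int_deriv dk ck a0; have I2 := int_deriv dk ck b0.
have J1 := int_itv_le (x - (N + `|x|)) x ck cg kg.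
have cng : continuous (fun y => - g y) by exact: cont_opp.
have J2 := int_itv_le x (x + (N + `|x|)) cng ck kg'.
have J3 := int_itv_add cg a0 b0.
have J4 := int_itv_le_int (x - (N + `|x|)) (x + (N + `|x|)) cg g0 Lg.
have J5 : \int[mu]_(y in `[x, (x + (N + `|x|))]) (- g y) =
   - \int[mu]_(y in `[x, (x + (N + `|x|))]) g y.
  rewrite [LHS]Rintegral_mkcond [in RHS]Rintegral_mkcond -int_neg; last exact: L1_trunc_itv.
  by apply: eq_int => y; rewrite !patchE; case: ifP; rewrite ?oppr0.
rewrite J5 I2 in J2; rewrite I1 in J1.
move: J1 J2 J3 J4 ha hb; clear.
by move: (Rintegral _ _ _) (Rintegral _ _ _) (Rintegral _ _ _) (Rintegral _ _ _) => p q r s; lra.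
Qed.

Lemma min_attained v x1 N : continuous v -> v x1 < 0 ->
  (forall x, N <= `|x| -> v x1 <= v x) -> exists x, forall y, v x <= v y.
Proof.
move=> cv v1 vN; set L := Num.max N `|x1|.
have L0 : - L <= L by rewrite ge0_cp// le_max normr_ge0 orbT.
have [c cL hc] := EVT_min L0 (@continuous_subspaceT _ _ `[- L, L] v cv).
exists c => y; have [yL|Ly] := leP `|y| L.
  by apply: hc; rewrite in_itv/= -ler_norml.
apply: le_trans (vN y _); last first.
  by apply: ltW; apply: le_lt_trans Ly; rewrite le_max lexx.
by apply: hc; rewrite in_itv/= -ler_norml le_max lexx orbT.
Qed.

End pointwise_bounds.

(** * Riccati inequality *)

(** The factor of the squared H^1 norm in [K0]; the maximum is that of [C1] and [C2]. *)
Definition riccati_const (R : realType) (l1 l2 l3 l4 l5 l6 : R) : R :=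
  `|l5| / 2 + Num.max
    (2^-1 * (`|l3| + `|l5| + `|l1 * l3 / (l6 - l2)| + `|l1 * l5 / (l6 - l2)|))
    (2^-1 * (`|l4| + `|l6| + `|l1 * l4 / (l6 - l2)| + `|l1 * l6 / (l6 - l2)|)).

Section riccati_at_min.
Context {R : realType}.
Notation mu := (@lebesgue_measure R).
Implicit Types (f : R -> R) (x y : R).

Context (f f' : R -> R) (M E h w l1 l2 l3 l4 l5 l6 : R).
Context (df : forall x, is_derive x (1 : R) f (f' x)) (cf' : continuous f').
Context (fM : forall x, `|f x| <= M) (f'M : forall x, `|f' x| <= M).
Context (h0 : 0 < h).
Context (fw : forall x y, `|y| <= h -> `|f' (x + y) - f' x| <= w).
Context (Lf : L1 (fun x => f x ^+ 2)) (Lf' : L1 (fun x => f' x ^+ 2)).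
Context (fE : forall x, f x ^+ 2 <= 2^-1 * E).
Context (IE : \int[mu]_x (f x ^+ 2) + \int[mu]_x (f' x ^+ 2) <= E).
Context (h26 : l2 = 2 * l6) (hne : l2 != l6).

Let F1 y := l3 * f y ^+ 2 + l4 * f' y ^+ 2.
Let F2 y := l5 * f y ^+ 2 + l6 * f' y ^+ 2.
Let b := l1 / (l6 - l2).
Let cf : continuous f := is_derive_continuous df.
Let cF1 : continuous F1 := quadratic_source_cont (a := l3) (b := l4) cf cf'.
Let cF2 : continuous F2 := quadratic_source_cont (a := l5) (b := l6) cf cf'.
Let LF1 : L1 F1 := quadratic_source_L1 l3 l4 Lf Lf'.
Let LF2 : L1 F2 := quadratic_source_L1 l5 l6 Lf Lf'.
Let F1M := quadratic_source_bound l3 l4 fM f'M.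
Let F2M := quadratic_source_bound l5 l6 fM f'M.

Let M0 : 0 <= M. Proof. exact: le_trans (fM 0). Qed.
Let w0 : 0 <= w. Proof. by apply: le_trans (fw 0 (y := 0) _); rewrite ?normr0// ltW. Qed.

Lemma int_source_le (k l : R) :
  \int[mu]_x `|k * f x ^+ 2 + l * f' x ^+ 2| <=
  `|k| * \int[mu]_x (f x ^+ 2) + `|l| * \int[mu]_x (f' x ^+ 2).
Proof.
rewrite -(int_scale _ Lf) -(int_scale _ Lf') -int_add; [|exact: L1Z|exact: L1Z].
apply: le_int => [||x].
- by apply: L1_norm; exact: quadratic_source_L1.
- exact: quadratic_source_L1.
rewrite (le_trans (ler_normD _ _))// (normrM k) (normrM l).
by rewrite [`|f x ^+ 2|]ger0_norm ?sqr_ge0// [`|f' x ^+ 2|]ger0_norm ?sqr_ge0.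
Qed.

(** The local term is bounded by [sqr_le_energy], each pressure by half the L^1 norm of its source.
    The coefficients of [int f^2] and [int f'^2] then add up to [C1] and [C2], whence the
    maximum. *)
Lemma nonlocal_le x :
  l5 * f x ^+ 2 - pressure (-1) F1 x - pressure 1 F2 x +
    b * pressure 1 F1 x + b * pressure (-1) F2 x
  <= riccati_const l1 l2 l3 l4 l5 l6 * E.
Proof.
have p1 : `|1 : R| = 1 by exact: normr1.
have m1 : `|-1 : R| = 1 by rewrite normrN normr1.
have a1 := pressure_L1_le x cF1 F1M LF1 p1.
have a2 := pressure_L1_le x cF1 F1M LF1 m1.
have a3 := pressure_L1_le x cF2 F2M LF2 p1.
have a4 := pressure_L1_le x cF2 F2M LF2 m1.
have i1 := int_source_le l3 l4; have i2 := int_source_le l5 l6.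
rewrite -/F1 in i1; rewrite -/F2 in i2.
have I0 : 0 <= \int[mu]_x (f x ^+ 2) by apply: int_ge0 => y; exact: sqr_ge0.
have I'0 : 0 <= \int[mu]_x (f' x ^+ 2) by apply: int_ge0 => y; exact: sqr_ge0.
have bE (k : R) : `|l1 * k / (l6 - l2)| = `|b| * `|k|.
  by rewrite -normrM /b; congr (`|_|); rewrite mulrAC.
rewrite /riccati_const !bE.
have b0 := normr_ge0 b.
have L5 : l5 * f x ^+ 2 <= `|l5| / 2 * E.
  apply: (@le_trans _ _ (`|l5| * f x ^+ 2)); first by rewrite ler_wpM2r ?sqr_ge0// ler_norm.
  by rewrite -mulrA ler_wpM2l.
have IE' := IE.
set I := \int[mu]_x (f x ^+ 2) in i1 i2 I0 IE' *.
set I' := \int[mu]_x (f' x ^+ 2) in i1 i2 I'0 IE' *.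
set c1 := 2^-1 * (`|l3| + _ + _ + _); set c2 := 2^-1 * (`|l4| + _ + _ + _).
have c10 : 0 <= c1 by rewrite mulr_ge0// !addr_ge0// mulr_ge0.
have mx1 : c1 <= Num.max c1 c2 by rewrite le_max lexx.
have mx2 : c2 <= Num.max c1 c2 by rewrite le_max lexx orbT.
have NL : (1 + `|b|) * (2^-1 * (\int[mu]_y `|F1 y| + \int[mu]_y `|F2 y|)) <=
    Num.max c1 c2 * E.
  apply: (@le_trans _ _ (c1 * I + c2 * I')); last first.
    apply: (@le_trans _ _ (Num.max c1 c2 * (I + I'))); last first.
      by rewrite ler_wpM2l// (le_trans c10).
    by rewrite mulrDr lerD// ler_wpM2r.
  have -> : c1 * I + c2 * I' = (1 + `|b|) * (2^-1 * ((`|l3| * I + `|l4| * I') +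
      (`|l5| * I + `|l6| * I'))) by rewrite /c1 /c2; ring.
  by rewrite ler_wpM2l ?addr_ge0// ler_wpM2l// lerD.
have tri (p q r s : R) : - p - q + b * r + b * s <= `|p| + `|q| + `|b| * `|r| + `|b| * `|s|.
  rewrite -!normrM; have := ler_norm (- p); have := ler_norm (- q).
  by have := ler_norm (b * r); have := ler_norm (b * s); rewrite !normrN; lra.
rewrite mulrDl.
have -> : l5 * f x ^+ 2 - pressure (-1) F1 x - pressure 1 F2 x +
    b * pressure 1 F1 x + b * pressure (-1) F2 x = l5 * f x ^+ 2 +
    (- pressure (-1) F1 x - pressure 1 F2 x +
    b * pressure 1 F1 x + b * pressure (-1) F2 x) by rewrite !addrA.
apply: lerD => //; apply: le_trans NL; apply: (le_trans (tri _ _ _ _)).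
set A1 := \int[mu]_y `|F1 y| in a1 a2 *; set A2 := \int[mu]_y `|F2 y| in a3 a4 *.
have -> : (1 + `|b|) * (2^-1 * (A1 + A2)) = 2^-1 * A1 + 2^-1 * A2 +
   `|b| * (2^-1 * A1) + `|b| * (2^-1 * A2) by ring.
by rewrite !lerD// ler_wpM2l.
Qed.

(** One group of summands per error in [riccati_at_min]: the square of [d - f' x], the two terms of
    order [h] from products, then [e1] and [e2], each as a coefficient of [h + w]. *)
Definition riccati_error : R :=
  2 * M * `|l6| + `|l1| * M ^+ 2 + `|l2 * b| * M ^+ 2 +
  2 * ((`|l3| + `|l4|) * M ^+ 2) + (`|l5| + `|l6|) * M ^+ 2 +
  2 * `|l5| * M ^+ 2 + 2 * `|l6| * M.

(** Applying the difference quotient to the equation produces [l2 * f x * diff_quot f' h x]; the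
    condition at [x] turns it into [l2 * f x * b * f' x], which cancels against the matching term of
    [b * g x]. *)
Lemma riccati_at_min (g : R -> R) x :
  (forall x, g x = - (l1 * f x ^+ 2 + l2 * f x * f' x + pressure 1 F1 x +
    pressure (-1) F2 x)) ->
  diff_quot f' h x = b * f' x ->
  diff_quot g h x - b * g x <=
    (l6 - l2) * (diff_quot f h x - b * f x) ^+ 2 +
    riccati_const l1 l2 l3 l4 l5 l6 * E + riccati_error * (h + w).
Proof.
move=> gE D0.
have p1 : `|1 : R| = 1 by exact: normr1.
have m1 : `|-1 : R| = 1 by rewrite normrN normr1.
have xh : x <= x + h by rewrite lerDl ltW.
have hh z : x <= z <= x + h -> `|z - x| <= h.
  by move=> /andP[xz zh]; rewrite ger0_norm ?subr_ge0// lerBlDl.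
pose d := diff_quot f h x.
have dM : `|d| <= M.
  have [z _ E1] := mean_value df xh.
  by rewrite /d /diff_quot E1 [x + h - x]addrAC subrr add0r mulfK ?lt0r_neq0.
have dw : `|d - f' x| <= w by apply: diff_quot_near => // y; exact: fw.
have [e1 e1E e1b] : exists2 e1, diff_quot (pressure 1 F1) h x = pressure (-1) F1 x + e1 &
    `|e1| <= 2 * ((`|l3| + `|l4|) * M ^+ 2) * h.
  have [z xz E1] := mean_value (fun y => pressure_derive y cF1 F1M) xh.
  exists (pressure (-1) F1 z - pressure (-1) F1 x).
    by rewrite /diff_quot E1 [x + h - x]addrAC subrr add0r mulfK ?lt0r_neq0// addrC subrK.
  have sup1 y : `|pressure 1 F1 y - F1 y| <= 2 * ((`|l3| + `|l4|) * M ^+ 2).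
    rewrite (le_trans (ler_normB _ _))// [leRHS]mulr_natl mulr2n lerD ?F1M//.
    exact (pressure_sup y cF1 F1M p1).
  have lip := lipschitz_of_derive (fun y => pressure_derive2 y cF1 F1M) sup1 x z.
  apply: (le_trans lip).
  by rewrite ler_wpM2l ?hh// !mulr_ge0// ?addr_ge0// sqr_ge0.
have [e2 e2E e2b] : exists2 e2,
    diff_quot (pressure (-1) F2) h x = pressure 1 F2 x - F2 x + e2 &
    `|e2| <= (`|l5| + `|l6|) * M ^+ 2 * h + (2 * `|l5| * M ^+ 2 * h + 2 * `|l6| * M * w).
  have [z xz E1] := mean_value (fun y => pressure_derive2 y cF2 F2M) xh.
  exists (pressure 1 F2 z - pressure 1 F2 x - (F2 z - F2 x)).
    rewrite /diff_quot E1 [x + h - x]addrAC subrr add0r mulfK ?lt0r_neq0//.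
    by move: (pressure _ _ z) (pressure _ _ x) => p q; ring.
  have sup1 y : `|pressure (-1) F2 y| <= (`|l5| + `|l6|) * M ^+ 2
    by exact (pressure_sup y cF2 F2M m1).
  rewrite (le_trans (ler_normB _ _))//; apply: lerD.
    have lip := lipschitz_of_derive (fun y => pressure_derive y cF2 F2M) sup1 x z.
    apply: (le_trans lip).
    by rewrite ler_wpM2l ?hh// mulr_ge0// ?addr_ge0// sqr_ge0.
  have -> : F2 z - F2 x = l5 * ((f z - f x) * (f z + f x)) +
     l6 * ((f' z - f' x) * (f' z + f' x)) by rewrite /F2; ring.
  have s1 : `|f z + f x| <= 2 * M.
    by rewrite (le_trans (ler_normD _ _))// mulr_natl mulr2n lerD.
  have s2 : `|f' z + f' x| <= 2 * M.
    by rewrite (le_trans (ler_normD _ _))// mulr_natl mulr2n lerD.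
  have s3 : `|f z - f x| <= M * h.
    by rewrite (le_trans (lipschitz_of_derive df f'M x z))// ler_wpM2l// hh.
  have s4 : `|f' z - f' x| <= w.
    have -> : z = x + (z - x) by rewrite addrCA subrr addr0.
    by apply: fw; exact: hh.
  rewrite (le_trans (ler_normD _ _))//; apply: lerD.
    have -> : 2 * `|l5| * M ^+ 2 * h = `|l5| * (M * h * (2 * M)) by ring.
    by rewrite !normrM ler_wpM2l// ler_pM.
  have -> : 2 * `|l6| * M * w = `|l6| * (w * (2 * M)) by ring.
  by rewrite !normrM ler_wpM2l// ler_pM.
have a0 : l6 - l2 != 0 by rewrite subr_eq0 eq_sym.
have NL := nonlocal_le x.
(* Two squares are completed. As [l2 = 2 * l6], [- l2 d f' + l6 f'^2] is
   [(l6 - l2) d^2 + l6 (d - f')^2]; as [l1 = b (l6 - l2)], the terms [- 2 l1 f d + b l1 f^2]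
   complete [(l6 - l2) d^2] to the required square. *)
have Dg : diff_quot g h x - b * g x = (l6 - l2) * (d - b * f x) ^+ 2 +
  (l5 * f x ^+ 2 - pressure (-1) F1 x - pressure 1 F2 x +
    b * pressure 1 F1 x + b * pressure (-1) F2 x) +
  (l6 * (d - f' x) ^+ 2 - l1 * h * d ^+ 2 - l2 * b * h * d * f' x - e1 - e2).
  have f1 : f (x + h) = f x + h * d by rewrite /d /diff_quot; field; exact: lt0r_neq0.
  have f1' : f' (x + h) = f' x + h * (b * f' x).
    by rewrite -D0 /diff_quot; field; exact: lt0r_neq0.
  have P1 : pressure 1 F1 (x + h) = pressure 1 F1 x + h * (pressure (-1) F1 x + e1).
    by rewrite -e1E /diff_quot; field; exact: lt0r_neq0.
  have P2 : pressure (-1) F2 (x + h) =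
      pressure (-1) F2 x + h * (pressure 1 F2 x - F2 x + e2).
    by rewrite -e2E /diff_quot; field; exact: lt0r_neq0.
  rewrite {1}/diff_quot !gE f1 f1' P1 P2 /F2 /b.
  move: (pressure _ _ _) (pressure _ _ _) (pressure _ _ _) (pressure _ _ _).
  move: (f x) (f' x) (d) a0 => q p d'.
  rewrite h26 => a0 P Q P' Q'; field.
  by rewrite a0 lt0r_neq0.
rewrite Dg -/d; clearbody d; apply: lerD; first by rewrite lerD2l.
have hw (k y : R) : 0 <= k -> `|y| <= k * h -> `|y| <= k * (h + w).
  by move=> k0 /le_trans; apply; rewrite ler_wpM2l// lerDl.
have g1 : `|l6 * (d - f' x) ^+ 2| <= 2 * M * `|l6| * (h + w).
  rewrite normrM normrX expr2 mulrCA.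
  have -> : 2 * M * `|l6| * (h + w) = 2 * M * (`|l6| * (h + w)) by ring.
  apply: ler_pM => //.
    by rewrite (le_trans (ler_normB _ _))// mulr_natl mulr2n lerD.
  by rewrite ler_wpM2l// (le_trans dw)// lerDr ltW.
have d2 : `|d| ^+ 2 <= M ^+ 2 by rewrite lerXn2r ?nnegrE.
have g2 : `|l1 * h * d ^+ 2| <= `|l1| * M ^+ 2 * (h + w).
  apply: hw; first by rewrite mulr_ge0// sqr_ge0.
  rewrite !normrM (gtr0_norm h0) -expr2 [leRHS]mulrAC.
  by apply: ler_wpM2l => //; rewrite mulr_ge0// ltW.
have g3 : `|l2 * b * h * d * f' x| <= `|l2 * b| * M ^+ 2 * (h + w).
  apply: hw; first by rewrite mulr_ge0// sqr_ge0.
  rewrite (normrM _ (f' x)) (normrM _ d) (normrM _ h) (gtr0_norm h0).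
  rewrite [leRHS]mulrAC expr2 -mulrA ler_wpM2l ?ler_pM//.
  by rewrite mulr_ge0// ltW.
have g4 : `|e1| <= 2 * ((`|l3| + `|l4|) * M ^+ 2) * (h + w).
  by apply: hw => //; rewrite mulr_ge0// mulr_ge0 ?sqr_ge0// addr_ge0.
have g5 : `|e2| <= ((`|l5| + `|l6|) * M ^+ 2 + 2 * `|l5| * M ^+ 2 + 2 * `|l6| * M) * (h + w).
  apply: (le_trans e2b); rewrite addrA [leRHS]mulrDl; apply: lerD.
    rewrite -[leLHS]mulrDl ler_wpM2l//; last by rewrite lerDl.
    by rewrite addr_ge0 ?mulr_ge0 ?addr_ge0 ?sqr_ge0.
  by rewrite ler_wpM2l ?mulr_ge0// lerDr ltW.
move: g1 g2 g3 g4 g5; rewrite /riccati_error.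
set y1 := l6 * _; set y2 := l1 * h * _; set y3 := l2 * b * h * _ * _.
have n1 := ler_norm y1; have n2 := ler_norm (- y2); have n3 := ler_norm (- y3).
have n4 := ler_norm (- e1); have n5 := ler_norm (- e2).
rewrite !normrN in n2 n3 n4 n5; move=> g1 g2 g3 g4 g5.
rewrite (le_trans (lerD (lerD (lerD (lerD (le_trans n1 g1) (le_trans n2 g2))
  (le_trans n3 g3)) (le_trans n4 g4)) (le_trans n5 g5)))//.
by rewrite le_eqVlt; apply/orP; left; apply/eqP; ring.
Qed.

End riccati_at_min.

(** * Comparison *)

Section one_variable.
Context {R : realType}.
Implicit Types (P : R -> Prop) (a b c t : R).

(* The set of [t] such that [P] holds on [[a, t]] is closed, and open to the right. *)
Lemma real_induction P a b : P a ->
  (forall t, a <= t < b -> P t -> exists2 d, 0 < d & forall t', t < t' < t + d -> P t') ->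
  (forall t, a <= t <= b ->
    (forall e, 0 < e -> exists2 t', t - e < t' <= t & a <= t' /\ P t') -> P t) ->
  forall t, a <= t <= b -> P t.
Proof.
move=> Pa op cl t /andP[at_ tb].
pose A := [set t | a <= t <= b /\ forall s, a <= s <= t -> P s].
have ab : a <= b by exact: le_trans tb.
have Aa : A a.
  split=> [|s]; first by rewrite lexx.
  by rewrite -eq_le => /eqP <-.
have supA : has_sup A.
  by split; [exists a|exists b => s [/andP[]]].
set c := sup A.
have ac : a <= c by exact: sup_upper_bound.
have cb : c <= b by apply: ge_sup; [exists a|move=> s [/andP[]]].
have Pc s : a <= s <= c -> P s.
  move=> /andP[as_ sc]; apply: cl; first by rewrite as_ (le_trans sc).
  move=> e e0; have [r [/andP[ar rb] Pr] er] := sup_adherent e0 supA.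
  rewrite -/c in er.
  have [rs|sr] := leP r s; last first.
    by exists s; [rewrite lexx andbT ltrBlDr ltrDl|split=> //; apply: Pr; rewrite as_ ltW].
  exists r; first by rewrite rs andbT (le_lt_trans _ er)// lerB.
  by split=> //; apply: Pr; rewrite ar lexx.
apply: (Pc t); rewrite at_/= leNgt; apply/negP => ct.
have cb' : a <= c < b by rewrite ac (lt_le_trans ct).
have [d d0 hd] := op c cb' (Pc c (introT andP (conj ac (lexx c)))).
pose r := Num.min b (c + d / 2).
have cr : c < r by rewrite lt_min (andP cb').2 ltrDl divr_gt0.
have Ar : A r.
  split=> [|s /andP[as_ sr]].
    by rewrite ge_min lexx (le_trans ac)// ltW.
  have [sc|cs] := leP s c; first by apply: (Pc s); rewrite as_.
  apply: hd; rewrite cs/= (le_lt_trans sr)//.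
  have : r <= c + d / 2 by rewrite ge_min lexx orbT.
  by lra.
by have := sup_upper_bound supA Ar; rewrite leNgt cr.
Qed.

Lemma is_derive_expand (F : R -> R) t (l : R) : is_derive t (1 : R) F l ->
  forall e, 0 < e -> exists2 d, 0 < d & forall t', `|t' - t| < d ->
    `|F t' - F t - l * (t' - t)| <= e * `|t' - t|.
Proof.
move=> dF e e0; have D := is_derive_derivable dF.
have : h^-1 *: (F (h *: (1 : R) + t) - F t) @[h --> (0 : R)^'] --> l.
  have <- := @derive_val _ _ _ _ _ _ _ dF.
  exact: D.
move=> /cvgrPdist_le/(_ e e0)/nbhs_ballP[d /= d0 hd].
exists d => // t' td; have [->|tt'] := eqVneq t' t.
  by rewrite !subrr mulr0 subrr normr0 mulr0.
have n0 : t' - t != 0 by rewrite subr_eq0.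
have := hd (t' - t); rewrite /ball/= sub0r normrN => /(_ td n0).
have -> : (t' - t) *: (1 : R) + t = t' by rewrite /GRing.scale/= mulr1 subrK.
rewrite /GRing.scale/= => H.
have -> : F t' - F t - l * (t' - t) = - ((l - (t' - t)^-1 * (F t' - F t)) * (t' - t)).
  by field.
by rewrite normrN normrM ler_wpM2r.
Qed.

Lemma nonpos_right (F : R -> R) t (l : R) : is_derive t (1 : R) F l ->
  F t <= 0 -> (F t = 0 -> l < 0) ->
  exists2 d, 0 < d & forall t', t < t' < t + d -> F t' <= 0.
Proof.
move=> dF F0 lF.
have near (t' d : R) : t < t' < t + d -> `|t' - t| = t' - t /\ t' - t < d.
  by move=> /andP[tt' td]; rewrite gtr0_norm ?subr_gt0//; split=> //; lra.
move: F0; rewrite le_eqVlt => /predU1P[F0|F0].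
  have l0 := lF F0.
  have [|d d0 hd] := is_derive_expand dF (e := - l); first by rewrite oppr_gt0.
  exists d => // t' tt'; have [E td] := near _ _ tt'.
  have := hd t'; rewrite E F0 subr0 => /(_ td) /ler_normlP[_].
  by rewrite mulNr; lra.
have [d d0 hd] := is_derive_expand dF ltr01.
pose k := 1 + `|l|; have k0 : 0 < k by rewrite ltr_pwDl.
(* When [F t < 0], [F] rises at rate at most [k] from [t], so it stays nonpositive for a time
   [- F t / k]. *)
exists (Num.min d (- F t / k)) => [|t' tt']; first by rewrite lt_min d0 divr_gt0// oppr_gt0.
have [E] := near _ _ tt'; rewrite lt_min => /andP[td tk].
have := hd t'; rewrite E => /(_ td) /ler_normlP[_].
have : k * (t' - t) < - F t by rewrite mulrC -ltr_pdivlMr.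
have : l * (t' - t) <= `|l| * (t' - t).
  by rewrite ler_wpM2r ?ler_norm// -E.
by rewrite /k mulrDl; lra.
Qed.

End one_variable.

Lemma scaled_bound (R : realType) (e k c : R) : 0 < e -> 0 < k -> 0 <= c ->
  k * (c * (e / 2 / (k * (c + 1)))) <= e / 2.
Proof.
move=> e0 k0 c0; have c1 : 0 < c + 1 by rewrite ltr_wpDl.
have -> : k * (c * (e / 2 / (k * (c + 1)))) = (e / 2) * (c / (c + 1)).
  by field; rewrite !lt0r_neq0.
by rewrite ler_piMr ?divr_ge0 ?(ltW e0)// ler_pdivrMr// mul1r lerDl.
Qed.

Section comparison.
Context {R : realType}.
Notation mu := (@lebesgue_measure R).
Context (l1 l2 l3 l4 l5 l6 : R) (T : \bar R) (u ut : R -> R -> R) (C C' : R) (om : R -> R).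
Context (H : strong_solution l1 l2 l3 l4 l5 l6 T u ut C C' om).
Context (h13 : l1 + l3 = 0) (h14 : 2 * l1 + l4 = 0) (h26 : l2 = 2 * l6).
Context (hlt : l6 < l2).
Implicit Types (t x h e n : R).

Let b := l1 / (l6 - l2).
Definition tilted_quot (beta h : R) (f : R -> R) x := diff_quot f h x - beta * f x.
Let v h t x := tilted_quot b h (u t) x.

Lemma sol_derive_pt t x : 0 < t -> (t%:E < T)%E ->
  is_derive t (1 : R) (fun t => u t x) (ut t x).
Proof.
move=> t0 tT; apply: is_derive_eps => e e0.
have k0 : 0 < 1 + `|C'| by rewrite ltr_pwDl.
have [d d0 hd] := sol_derive H (time_interval_pos t0 tT) (divr_gt0 e0 k0).
have [d1 d10 hd1] := time_interior t0 tT.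
exists (Num.min d d1); first by rewrite lt_min d0.
move=> t' tt'; rewrite lt_min => /andP[td td1].
have [t'0 t'T] := hd1 t' td1.
have [h _ _] := hd t' (time_interval_pos t'0 t'T) tt' td.
apply: (le_trans (h x)); rewrite mulrCA ler_piMr ?(ltW e0)//.
by rewrite ler_pdivrMr// mul1r (le_trans (ler_norm _))// lerDr.
Qed.

Lemma tilted_quot_derive h t x : 0 < t -> (t%:E < T)%E ->
  is_derive t (1 : R) (fun t => v h t x) (diff_quot (ut t) h x - b * ut t x).
Proof.
move=> t0 tT.
have d1 := is_derive_sub (sol_derive_pt (x + h) t0 tT) (sol_derive_pt x t0 tT).
have d2 := is_derive_sub (is_derive_scale h^-1 d1) (is_derive_scale b (sol_derive_pt x t0 tT)).
apply: (@is_derive_ext _ (fun t => h^-1 * (u t (x + h) - u t x) - b * u t x)).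
  by move=> s; rewrite /v /tilted_quot /diff_quot mulrC.
by refine (is_deriveE d2 _); rewrite /diff_quot mulrC.
Qed.

Lemma tilted_quot_le (f : R -> R) h x M : 0 < h -> `|f x| <= M -> `|f (x + h)| <= M ->
  `|tilted_quot b h f x| <= (2 / h + `|b|) * M.
Proof.
move=> h0 f1 f2; rewrite /tilted_quot /diff_quot.
rewrite (le_trans (ler_normB _ _))// [leRHS]mulrDl; apply: lerD.
  rewrite normrM normfV (gtr0_norm h0) ler_pdivrMr//.
  have -> : 2 / h * M * h = M + M by field; exact: lt0r_neq0.
  by rewrite (le_trans (ler_normB _ _))// lerD.
by rewrite normrM ler_wpM2l.
Qed.

(** For fixed [h] the quotient tends to 0 at infinity with [u t], so a negative value forces a
    minimum. Taking [|x| >= N + h] keeps both [x] and [x + h] beyond [N]. *)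
Lemma tilted_quot_min h t x1 : 0 < h -> time_interval T t -> v h t x1 < 0 ->
  exists x, forall y, v h t x <= v h t y.
Proof.
move=> h0 Jt v1; have [n n0 B] := sol_bound H Jt.
have k0 : 0 < 2 / h + `|b| by rewrite ltr_pwDl// divr_gt0.
have e0 : 0 < - v h t x1 / (2 / h + `|b|) by rewrite divr_gt0// oppr_gt0.
have [N N0 hN] := C1_bounds_vanish (mod_const_ge0 H) n0 B e0.
apply: (@min_attained _ _ x1 (N + h)) => //.
  have cf := C1_bounds_cont B.
  apply: cont_sub; apply: cont_mul; try exact: cont_cst; last exact: cf.
  by apply: cont_sub => //; exact: cont_shift.
move=> x xN; have f1 : `|u t x| <= - v h t x1 / (2 / h + `|b|).
  by apply: hN; lra.
have f2 : `|u t (x + h)| <= - v h t x1 / (2 / h + `|b|).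
  apply: hN; have := ler_normD (x + h) (- h); rewrite addrK normrN (gtr0_norm h0).
  by lra.
have := tilted_quot_le h0 f1 f2; rewrite mulrCA divff ?lt0r_neq0// mulr1.
by rewrite -/(v h t x) => /ler_normlP[+ _]; rewrite lerN2.
Qed.

Lemma tilted_quot_at_min t1 n h w t x : 0 < t -> t <= t1 -> (t1%:E < T)%E -> 0 < n ->
  C1_bounds C om n (u t) ->
  0 < h -> (forall y, `|y| <= h -> om y * n <= w) ->
  (forall y, v h t x <= v h t y) ->
  diff_quot (ut t) h x - b * ut t x <=
    (l6 - l2) * v h t x ^+ 2 +
    riccati_const l1 l2 l3 l4 l5 l6 * energy (u 0) +
    riccati_error (C * n) l1 l2 l3 l4 l5 l6 * (h + w).
Proof.
move=> t0 tt1 t1T n0 B h0 hw vmin.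
have tT : (t%:E < T)%E by apply: le_lt_trans t1T; rewrite lee_fin.
have Jt := time_interval_pos t0 tT.
have Et := energy_le H h13 h14 h26 Jt.
have fE y : u t y ^+ 2 <= 2^-1 * energy (u 0).
  apply: (le_trans (sqr_le_energy y (mod_const_ge0 H) n0 B)).
  by rewrite ler_wpM2l.
have hne : l2 != l6 by rewrite gt_eqF.
have fw x' y : `|y| <= h -> `|derive1 (u t) (x' + y) - derive1 (u t) x'| <= w.
  by move=> yh; apply: (le_trans (C1_mod B x' y)); exact: hw.
have [Lf _] := C1_L2 B; have [Lf' _] := C1_dL2 B.
have df := C1_derive B.
have dv y : is_derive y (1 : R) (v h t)
    (h^-1 * (derive1 (u t) (y + h) - derive1 (u t) y) - b * derive1 (u t) y).
  apply: (@is_derive_ext _ (fun y => h^-1 * (u t (y + h) - u t y) - b * u t y)).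
    by move=> s; rewrite /v /tilted_quot /diff_quot mulrC.
  exact (is_derive_sub (is_derive_scale h^-1 (is_derive_sub
    (is_derive_translate (df (y + h))) (df y))) (is_derive_scale b (df y))).
have xx : x - 1 <= x + 1 by rewrite lerD2l ge0_cp.
have xI : x \in `](x - 1), (x + 1)[%R by rewrite in_itv/= ltrDl gtrDl oppr_lt0 ltr01.
have dv0 := derive1_at_min xx (fun y _ => is_derive_derivable (dv y)) xI (fun y _ => vmin y).
(* Criticality in [x] of the discrete quotient: an exact substitute for [u_xx = b u_x] that uses
   first derivatives of [u] only. *)
have D0 : diff_quot (derive1 (u t)) h x = b * derive1 (u t) x.
  have := is_derive_derive1 dv0; rewrite (is_derive_derive1 (dv x)) => /eqP.
  by rewrite subr_eq0 => /eqP <-; rewrite /diff_quot mulrC.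
exact: (riccati_at_min df (C1_cont B) (C1_sup B) (C1_dsup B) h0 fw Lf Lf' fE Et h26 hne
  (fun x => sol_equation H x t0 tT) D0).
Qed.

(** [y] is a strict supersolution. Propagating the existence of a point with [v <= y] avoids
    differentiating the minimum of [v] in time. *)
Lemma comparison (y y' : R -> R) t0 t1 t2 n h w x0 : 0 < t0 -> t2 <= t1 ->
  (t1%:E < T)%E -> 0 < n ->
  (forall t, 0 <= t <= t1 -> C1_bounds C om n (u t)) ->
  0 < h -> (forall y, `|y| <= h -> om y * n <= w) ->
  (forall t, t0 <= t <= t2 -> [/\ y t < 0, is_derive t (1 : R) y (y' t) &
    (l6 - l2) * y t ^+ 2 +
    riccati_const l1 l2 l3 l4 l5 l6 * energy (u 0) +
    riccati_error (C * n) l1 l2 l3 l4 l5 l6 * (h + w) < y' t]) ->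
  v h t0 x0 <= y t0 ->
  forall t, t0 <= t <= t2 -> exists x, v h t x <= y t.
Proof.
move=> t00 t21 t1T n0 B h0 hw hy v0.
have tI t : t0 <= t <= t2 -> [/\ 0 < t, t <= t1, (t%:E < T)%E & C1_bounds C om n (u t)].
  move=> /andP[t0t tt2]; have tt1 : t <= t1 by exact: le_trans t21.
  have t0' : 0 < t by exact: lt_le_trans t0t.
  split=> //; first by apply: le_lt_trans t1T; rewrite lee_fin.
  by apply: B; rewrite tt1 ltW.
apply: real_induction; first by exists x0.
  move=> t /andP[t0t tt2] [x1 v1].
  have tt : t0 <= t <= t2 by rewrite t0t ltW.
  have [tp tt1 tT Bt] := tI t tt; have [y0 dy hy'] := hy t tt.
  (* The point is frozen at a minimum for time [t]. If [v = y] there, the strict inequality makes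
     [v - y] decrease; otherwise continuity suffices. *)
  have [x hx] := tilted_quot_min h0 (time_interval_pos tp tT) (le_lt_trans v1 y0).
  have vt := tilted_quot_at_min tp tt1 t1T n0 Bt h0 hw hx.
  have dphi := is_derive_sub (tilted_quot_derive h x tp tT) dy.
  have [||d d0 hd] := nonpos_right dphi.
  - by rewrite subr_le0 (le_trans (hx x1)).
  - move=> /eqP; rewrite subr_eq0 => /eqP e; rewrite subr_lt0.
    by apply: le_lt_trans hy'; rewrite -e.
  by exists d => // t' /hd; rewrite subr_le0 => ?; exists x.
move=> t tt ht; have [tp tt1 tT Bt] := tI t tt; have [y0 dy _] := hy t tt.
have Jt := time_interval_pos tp tT.
pose k := 2 / h + `|b|.
have k0 : 0 < k by rewrite ltr_pwDl// divr_gt0.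
have C0 := mod_const_ge0 H.
(* Points from slightly earlier times still serve at [t]: [v] moves by at most [e / 2] uniformly in
   [x], and [y] by at most [e / 2]. *)
have close e : 0 < e -> exists x, v h t x <= y t + e.
  move=> e0.
  have p0 : 0 < e / 2 / (k * (C + 1)).
    by rewrite !divr_gt0// mulr_gt0// ltr_wpDl.
  have [d d0 hd] := sol_cont H Jt p0.
  have [d1 d10 hd1] := is_derive_expand dy ltr01.
  pose m := 1 + `|y' t|; have m0 : 0 < m by rewrite ltr_pwDl.
  pose r := Num.min (Num.min d d1) (e / 2 / m).
  have r0 : 0 < r by rewrite /r 2!lt_min d0 d10 !divr_gt0.
  have [t' /andP[tr t't] [t0t' [x hx]]] := ht r r0.
  have [t'p _ t'T _] := tI t' (introT andP (conj t0t' (le_trans t't (andP tt).2))).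
  have tE : `|t' - t| = t - t' by rewrite distrC ger0_norm// subr_ge0.
  have : `|t' - t| < r by rewrite tE ltrBlDl -ltrBlDr.
  rewrite /r 2!lt_min => /andP[/andP[td td1] tm].
  exists x; have D := hd t' (time_interval_pos t'p t'T) td.
  have := tilted_quot_le h0 (C1_sup D x) (C1_sup D (x + h)).
  have -> : tilted_quot b h (fun x => u t' x - u t x) x = v h t' x - v h t x.
    by rewrite /v /tilted_quot /diff_quot; field; exact: lt0r_neq0.
  have cb : (2 / h + `|b|) * (C * (e / 2 / (k * (C + 1)))) <= e / 2.
    exact: scaled_bound.
  move=> /le_trans/(_ cb)/ler_normlP[A _].
  have := hd1 t' td1; rewrite mul1r => /ler_normlP[_ Y].
  have tm' : m * `|t' - t| <= e / 2 by rewrite mulrC -ler_pdivlMr// ltW.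
  have := ler_norm (y' t * (t' - t)); rewrite normrM => Z.
  by move: tm'; rewrite /m mulrDl mul1r; lra.
(* With this tolerance [v] is still negative somewhere, so its minimum is attained; that one point
   then lies below [y t + e] for every [e]. *)
have y2 : 0 < - y t / 2 by rewrite divr_gt0// oppr_gt0.
have [x1 hx1] := close _ y2.
have v1 : v h t x1 < 0 by lra.
have [x hx] := tilted_quot_min h0 Jt v1.
exists x; apply/ler_addgt0Pr => e /close[x2 hx2].
exact: le_trans (hx x2) hx2.
Qed.

End comparison.

(** * Blow-up time *)

Section riccati_explicit.
Context {R : realType}.
Implicit Types (a k z r s t : R).

(** The ratio [(y - k) / (y + k)] along a solution [y] of the Riccati equation, with value [z] at
    time [r]. *)
Definition riccati_exp a k z r t := z * expR (- (2 * a * k) * (t - r)).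

(* The solution of [y' = - a (y ^ 2 - k ^ 2)] tending to [-oo] when the
   exponential decreases to [1]. *)
Definition riccati_sol a k z r t := - k * (1 + 2 * (riccati_exp a k z r t - 1)^-1).

Lemma riccati_sol_derive a k z r t : riccati_exp a k z r t != 1 ->
  is_derive t (1 : R) (riccati_sol a k z r)
    (- a * riccati_sol a k z r t ^+ 2 + a * k ^+ 2).
Proof.
move=> z1; pose e := riccati_exp a k z r.
have d0 : is_derive t (1 : R) (fun t => - (2 * a * k) * (t - r)) (- (2 * a * k) * (1 - 0)).
  exact (is_derive_scale _ (is_derive_sub (is_derive_x t) (is_derive_c r t))).
have d1 := is_derive_scale z (is_derive_comp (is_derive_expR _) d0).
have d2 := is_derive_sub d1 (is_derive_c 1 t).
have ez : e t - 1 != 0 by rewrite subr_eq0.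
have d3 := is_deriveV (f := fun t => e t - 1) ez d2.
have d4 := is_derive_scale (- k) (is_derive_add (is_derive_c 1 t) (is_derive_scale 2 d3)).
refine (is_deriveE d4 _).
rewrite /riccati_sol -/(e t).
have -> : z * (expR (- (2 * a * k) * (t - r)) * (- (2 * a * k) * (1 - 0))) - 0 =
  - (2 * a * k) * e t by rewrite /e /riccati_exp subr0 subr0; ring.
rewrite /GRing.scale/=; move: (e t) ez => y y1.
by field.
Qed.

End riccati_explicit.

Section blowup.
Context {R : realType}.
Context (l1 l2 l3 l4 l5 l6 : R) (T : \bar R) (u ut : R -> R -> R) (C C' : R) (om : R -> R).
Context (H : strong_solution l1 l2 l3 l4 l5 l6 T u ut C C' om).
Context (h13 : l1 + l3 = 0) (h14 : 2 * l1 + l4 = 0) (h26 : l2 = 2 * l6).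
Context (hlt : l6 < l2).
Implicit Types (t x h e n : R).

Let b := l1 / (l6 - l2).
Let a := l2 - l6.
Let K0 := riccati_const l1 l2 l3 l4 l5 l6 * energy (u 0).

Let a0 : 0 < a. Proof. by rewrite subr_gt0. Qed.

(** The bound is the time the explicit solution started at [y0] takes to reach [-oo]. If [t1] came
    later, [v] would be dragged below any level before [t1], whereas the C^1 bounds keep it above
    [- M]. *)
Lemma blowup_time t0 t1 n h w k y0 x0 : 0 < t0 -> t0 <= t1 -> (t1%:E < T)%E -> 0 < n ->
  (forall t, 0 <= t <= t1 -> C1_bounds C om n (u t)) ->
  0 < h -> (forall y, `|y| <= h -> om y * n <= w) -> 0 < k ->
  K0 + riccati_error (C * n) l1 l2 l3 l4 l5 l6 * (h + w) < a * k ^+ 2 ->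
  y0 < - k -> tilted_quot b h (u t0) x0 <= y0 ->
  t1 - t0 <= ln ((y0 - k) / (y0 + k)) / (2 * a * k).
Proof.
move=> t00 t01 t1T n0 B h0 hw k0 hK yk v0.
have C0 := mod_const_ge0 H.
set z := (y0 - k) / (y0 + k).
have yk0 : y0 + k < 0 by lra.
have yk0' : y0 + k != 0 by rewrite ltr0_neq0.
have z1 : 1 < z by rewrite /z ltr_ndivlMr// mul1r; lra.
have z0 : 0 < z by exact: lt_trans z1.
have ak : 0 < 2 * a * k by rewrite !mulr_gt0.
have ak0 := lt0r_neq0 ak.
pose M := C * n * (1 + `|b|).
have M0 : 0 <= M by rewrite !mulr_ge0// ?addr_ge0// ltW.
have vM t x : 0 <= t <= t1 -> - M <= tilted_quot b h (u t) x.
  move=> /B Bt; have [c _ E] : exists2 c, x <= c <= x + h &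
      u t (x + h) - u t x = derive1 (u t) c * (x + h - x).
    by apply: mean_value; [exact: C1_derive Bt|rewrite lerDl ltW].
  rewrite /tilted_quot /diff_quot E [x + h - x]addrAC subrr add0r mulfK ?lt0r_neq0//.
  have := C1_dsup Bt c => /ler_normlP[e1 _].
  have : b * u t x <= `|b| * (C * n).
    by rewrite (le_trans (ler_norm _))// normrM ler_wpM2l// (C1_sup Bt).
  by rewrite /M; lra.
rewrite leNgt; apply/negP => tt.
(* The comparison stops while the ratio is still above 1, at a value close enough to 1 that the
   explicit solution [- k (1 + 2 / (z2 - 1))] is below [- M]. *)
pose z2 := 1 + Num.min (z - 1) (k / (M + 1)).
have M1 : 0 < M + 1 by rewrite ltr_wpDl.
have z21 : 1 < z2 by rewrite ltrDl lt_min subr_gt0 z1 divr_gt0.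
have z20 : 0 < z2 by exact: lt_trans z21.
have z2z : z2 <= z by rewrite /z2 -lerBrDl ge_min lexx.
have z2k : z2 - 1 <= k / (M + 1) by rewrite /z2 addrAC subrr add0r ge_min lexx orbT.
(* The time at which the ratio equals [z2]. *)
pose t2 := t0 + ln (z / z2) / (2 * a * k).
have zz2 : 1 <= z / z2 by rewrite ler_pdivlMr// mul1r.
have zz0 : 0 < z / z2 by exact: divr_gt0.
have t02 : t0 <= t2.
  by rewrite lerDl divr_ge0 ?ln_ge0// ltW.
have t21 : t2 <= t1.
  have : ln (z / z2) / (2 * a * k) <= ln z / (2 * a * k).
    rewrite ler_pM2r ?invr_gt0// ler_ln//.
    by rewrite ler_pdivrMr// ler_peMr// ltW.
  by rewrite /t2 -lerBrDl => /le_trans; apply; exact: ltW.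
have Z2 t : t0 <= t <= t2 -> z2 <= riccati_exp a k z t0 t.
  move=> /andP[t0t tt2].
  have -> : z2 = z * expR (- ln (z / z2)).
    by rewrite expRN lnK//; field; rewrite !lt0r_neq0.
  rewrite /riccati_exp ler_pM2l// ler_expR mulNr lerN2.
  by rewrite mulrC -ler_pdivlMr// lerBlDl.
have Z1 t : t0 <= t <= t2 -> 1 < riccati_exp a k z t0 t.
  by move=> /Z2; apply: lt_le_trans.
have y00 : riccati_sol a k z t0 t0 = y0.
  rewrite /riccati_sol /riccati_exp subrr mulr0 expR0 mulr1 /z.
  have -> : (y0 - k) / (y0 + k) - 1 = - (2 * k) / (y0 + k) by field.
  by field; rewrite yk0' lt0r_neq0.
have hy t : t0 <= t <= t2 -> [/\ riccati_sol a k z t0 t < 0,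
    is_derive t (1 : R) (riccati_sol a k z t0)
      (- a * riccati_sol a k z t0 t ^+ 2 + a * k ^+ 2) &
    (l6 - l2) * riccati_sol a k z t0 t ^+ 2 + K0 +
    riccati_error (C * n) l1 l2 l3 l4 l5 l6 * (h + w) <
      - a * riccati_sol a k z t0 t ^+ 2 + a * k ^+ 2].
  move=> /Z1 Zt; split.
  - rewrite /riccati_sol mulNr oppr_lt0 mulr_gt0// addr_gt0// mulr_gt0// invr_gt0.
    by rewrite subr_gt0.
  - by apply: riccati_sol_derive; rewrite gt_eqF.
  - by rewrite /a opprB -addrA ltrD2l.
have v00 : tilted_quot b h (u t0) x0 <= riccati_sol a k z t0 t0 by rewrite y00.
have t22 : t0 <= t2 <= t2 by rewrite lexx andbT.
have [x hx] := comparison H h13 h14 h26 hlt t00 t21 t1T n0 B h0 hw hy v00 t22.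
have t2I : 0 <= t2 <= t1 by rewrite t21 andbT (le_trans (ltW t00)).
have := le_trans (vM t2 x t2I) hx.
have -> : riccati_sol a k z t0 t2 = - k * (1 + 2 * (z2 - 1)^-1).
  rewrite /riccati_sol /riccati_exp; congr (_ * (1 + 2 * (_ - 1)^-1)).
  have -> : - (2 * a * k) * (t2 - t0) = - ln (z / z2).
    by rewrite /t2 [t0 + _ - t0]addrAC subrr add0r mulNr mulrC divfK.
  by rewrite expRN lnK//; field; rewrite !lt0r_neq0.
have : (M + 1) / k <= (z2 - 1)^-1.
  by rewrite -[X in X <= _]invf_div lef_pV2 ?posrE ?divr_gt0 ?subr_gt0.
rewrite ler_pdivrMr// => q1 q2.
by move: q2 q1; move: ((z2 - 1)^-1) => p; lra.
Qed.

End blowup.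

Section blowup_bound.
Context {R : realType}.
Context (l1 l2 l3 l4 l5 l6 : R) (T : \bar R) (u ut : R -> R -> R) (C C' : R) (om : R -> R).
Context (H : strong_solution l1 l2 l3 l4 l5 l6 T u ut C C' om).
Context (h13 : l1 + l3 = 0) (h14 : 2 * l1 + l4 = 0) (h26 : l2 = 2 * l6).
Context (hlt : l6 < l2).
Implicit Types (t x h e n : R).

Let b := l1 / (l6 - l2).
Let a := l2 - l6.
Let K0 := riccati_const l1 l2 l3 l4 l5 l6 * energy (u 0).
Let w0 x := derive1 (u 0) x - b * u 0 x.

Let a0 : 0 < a. Proof. by rewrite subr_gt0. Qed.

Lemma tilted_quot_near n e h t x : time_interval T t -> 0 < e -> 0 < h ->
  C1_bounds C om n (u 0) -> C1_bounds C om e (fun x => u t x - u 0 x) ->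
  (forall y, `|y| <= h -> om y * n <= e * n) ->
  tilted_quot b h (u t) x <= w0 x + e * (n + C * (1 + `|b|)).
Proof.
move=> Jt e0 h0 B D hn.
have fw y : `|y| <= h -> `|derive1 (u 0) (x + y) - derive1 (u 0) x| <= e * n.
  by move=> yh; apply: (le_trans (C1_mod B x y)); exact: hn.
have := diff_quot_near h0 (C1_derive B) fw => /ler_normlP[_ q1].
have [|c _ E] := mean_value (C1_derive D) (a := x) (b := x + h); first by rewrite lerDl ltW.
have -> : tilted_quot b h (u t) x = diff_quot (u 0) h x - b * u 0 x +
    (derive1 (fun x => u t x - u 0 x) c - b * (u t x - u 0 x)).
  have -> : derive1 (fun x => u t x - u 0 x) c =
      (u t (x + h) - u 0 (x + h) - (u t x - u 0 x)) / h.
    by rewrite E [x + h - x]addrAC subrr add0r mulfK ?lt0r_neq0.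
  by rewrite /tilted_quot /diff_quot; field; exact: lt0r_neq0.
have /ler_normlP[_ q2] := C1_dsup D c.
have q3 : - (b * (u t x - u 0 x)) <= `|b| * (C * e).
  rewrite (le_trans (ler_norm _))// normrN normrM ler_wpM2l//.
  exact: (C1_sup D x).
have -> : w0 x + e * (n + C * (1 + `|b|)) =
  derive1 (u 0) x - b * u 0 x + (e * n + (C * e + `|b| * (C * e))).
  by rewrite /w0; ring.
rewrite -addrA -[leRHS]addrA; move: q1 q2 q3.
by move: (b * (u t x - u 0 x)) (b * u 0 x) (`|b| * (C * e)) => p q r; lra.
Qed.

(** The two strict margins, in [K0 < a * k ^+ 2] and in [w0 x0 < y0], absorb the discretization
    error and the change of the data up to a small positive starting time. *)
Lemma blowup_perturbed t1 x0 k y0 : 0 < t1 -> (t1%:E < T)%E -> 0 < k ->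
  K0 < a * k ^+ 2 -> y0 < - k -> w0 x0 < y0 ->
  t1 <= ln ((y0 - k) / (y0 + k)) / (2 * a * k).
Proof.
move=> t10 t1T k0 hK yk wy.
have C0 := mod_const_ge0 H.
have J1 := time_interval_pos t10 t1T.
have [n n0 B] := sol_bounded H J1.
have B0 : C1_bounds C om n (u 0) by apply: B; rewrite lexx ltW.
have J0 : time_interval T 0 by split=> //; apply: le_lt_trans t1T; rewrite lee_fin ltW.
set RE := riccati_error (C * n) l1 l2 l3 l4 l5 l6.
pose m1 := (1 + n) * (1 + `|RE|); pose m2 := n + C * (1 + `|b|).
have m10 : 0 < m1 by rewrite mulr_gt0// addr_gt0// ltr_pwDl.
have m20 : 0 < m2 by rewrite ltr_pwDl// mulr_ge0// addr_ge0.
have g0 : 0 < a * k ^+ 2 - K0 by rewrite subr_gt0.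
have g1 : 0 < y0 - w0 x0 by rewrite subr_gt0.
apply/ler_addgt0Pr => d d0.
(* The first bound keeps the Riccati error within half of its margin, the second the initial value
   within the other margin. *)
pose e := Num.min ((a * k ^+ 2 - K0) / 2 / m1) ((y0 - w0 x0) / m2).
have e0 : 0 < e by rewrite lt_min !divr_gt0.
have em1 : e * m1 <= (a * k ^+ 2 - K0) / 2 by rewrite -ler_pdivlMr// ge_min lexx.
have em2 : e * m2 <= y0 - w0 x0 by rewrite -ler_pdivlMr// ge_min lexx orbT.
have [h [h0 he home]] := mod_small (mod_cvg0 H) e0.
have hw y : `|y| <= h -> om y * n <= e * n.
  by move=> yh; rewrite ler_wpM2r ?home// ltW.
have [r r0 hr] := sol_cont H J0 e0.
(* The starting time: positive so that the equation holds, close enough to 0 for the initial data,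
   and at most the loss [d] allowed in the conclusion. *)
pose s := Num.min (Num.min (r / 2) d) t1.
have s0 : 0 < s by rewrite /s 2!lt_min d0 t10 divr_gt0.
have st1 : s <= t1 by rewrite ge_min lexx orbT.
have sd : s <= d by rewrite /s 2!ge_min lexx orbT.
have sr : `|s - 0| < r.
  have : s <= r / 2 by rewrite /s 2!ge_min lexx.
  by rewrite subr0 gtr0_norm//; lra.
have sT : (s%:E < T)%E by apply: le_lt_trans t1T; rewrite lee_fin.
have Js := time_interval_pos s0 sT.
have hv : tilted_quot b h (u s) x0 <= y0.
  apply: (le_trans (tilted_quot_near x0 Js e0 h0 B0 (hr s Js sr) hw)).
  by rewrite -lerBrDl.
have hKE : K0 + RE * (h + e * n) < a * k ^+ 2.
  rewrite -ltrBrDl; apply: (@le_lt_trans _ _ (e * m1)); last first.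
    by apply: (le_lt_trans em1); rewrite ltr_pdivrMr// ltr_pMr// ltr1n.
  apply: (@le_trans _ _ (`|RE| * (e * (1 + n)))).
    have hn0 : 0 <= h + e * n by rewrite addr_ge0 ?mulr_ge0// ltW.
    apply: (@le_trans _ _ (`|RE| * (h + e * n))); first by rewrite ler_wpM2r// ler_norm.
    by rewrite ler_wpM2l// mulrDr mulr1 lerD2r.
  rewrite /m1 mulrA mulrC ler_wpM2l ?lerDr//.
  by rewrite mulr_ge0// ?addr_ge0// ltW.
have := blowup_time H h13 h14 h26 hlt s0 st1 t1T n0 B h0 hw k0 hKE yk hv.
by rewrite -/a lerBlDr => /le_trans; apply; rewrite lerD2l.
Qed.

(** The critical values [k] and [W] leave no margin in [blowup_perturbed]; it is applied to [k + e]
    and [W + e], and its bound is continuous in [e]. *)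
Lemma blowup_bound t1 x0 : 0 < t1 -> (t1%:E < T)%E -> 0 < K0 ->
  w0 x0 < - Num.sqrt (K0 / a) ->
  t1 <= 1 / (2 * Num.sqrt (a * K0)) *
    ln ((w0 x0 - Num.sqrt (K0 / a)) / (w0 x0 + Num.sqrt (K0 / a))).
Proof.
move=> t10 t1T K00; set k := Num.sqrt (K0 / a); set W := w0 x0 => Wk.
have Ka : 0 < K0 / a by rewrite divr_gt0.
have k0 : 0 < k by rewrite sqrtr_gt0.
have kE : a * k ^+ 2 = K0 by rewrite sqr_sqrtr ?ltW// mulrC divfK ?lt0r_neq0.
have -> : Num.sqrt (a * K0) = a * k.
  rewrite -kE mulrA -expr2 -exprMn sqrtr_sqr ger0_norm//.
  by rewrite mulr_ge0// ltW.
(* The perturbed bound: [e] cancels in [(W + e) - (k + e)] and doubles in [(W + e) + (k + e)]. *)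
pose F e := ln ((W - k) / (W + k + 2 * e)) / (2 * a * (k + e)).
have Wk0 : W + k < 0 by lra.
have F0 : 1 / (2 * (a * k)) * ln ((W - k) / (W + k)) = F 0.
  by rewrite /F mulr0 !addr0 mulrC mul1r mulrA.
rewrite F0 leNgt; apply/negP => Ft.
have Fc : F e @[e --> (0 : R)] --> F 0.
  have c1 : (W + k + 2 * e) @[e --> (0 : R)] --> W + k + 2 * 0.
    by apply: cvgD; [exact: cvg_cst|apply: cvgMr; exact: cvg_id].
  have c2 : (2 * a * (k + e)) @[e --> (0 : R)] --> 2 * a * (k + 0).
    by apply: cvgMr; apply: cvgD; [exact: cvg_cst|exact: cvg_id].
  have n1 : W + k + 2 * 0 != 0 by rewrite mulr0 addr0 ltr0_neq0.
  have n2 : 2 * a * (k + 0) != 0 by rewrite addr0 !mulf_neq0 ?lt0r_neq0.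
  apply: cvgM; last exact: cvgV.
  apply: continuous_cvg; last by apply: cvgMr; exact: cvgV.
  apply: continuous_ln; rewrite mulr0 addr0 nmulr_lgt0 ?invr_lt0//.
  by lra.
have Fn : nbhs (0 : R) [set e | F e < t1] by exact: (cvgr_lt (F 0) Fc t1 Ft).
move: Fn => /nbhs_ballP[d /= d0 hd].
(* The second bound keeps [W + e < - (k + e)]. *)
pose e := Num.min (d / 2) (- (W + k) / 4).
have e0 : 0 < e by rewrite lt_min !divr_gt0// oppr_gt0.
have ed : e <= d / 2 by rewrite ge_min lexx.
have eW : e <= - (W + k) / 4 by rewrite ge_min lexx orbT.
have Fe : F e < t1 by apply: hd; rewrite /ball/= sub0r normrN gtr0_norm//; lra.
have : t1 <= F e.
  have -> : F e = ln ((W + e - (k + e)) / (W + e + (k + e))) / (2 * a * (k + e)).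
    rewrite /F; congr (ln (_ / _) / _); by ring.
  apply: (@blowup_perturbed t1 x0) => //.
  - by rewrite addr_gt0.
  - by rewrite -kE ltr_pM2l// ltrXn2r ?nnegrE ?ltrDl ?addr_ge0// ltW.
  - by lra.
  - by rewrite -/W ltrDl.
by rewrite leNgt Fe.
Qed.

End blowup_bound.

(** * H^1 norm, finiteness of the lifespan and change of sign *)

Section assembly.
Context {R : realType}.
Notation mu := (@lebesgue_measure R).

Lemma Lnorm2_sqr (f : R -> R) : L1 (fun x => f x ^+ 2) ->
  fine ('N[mu]_2%:E [EFin \o f])%E ^+ 2 = \int[mu]_x (f x ^+ 2).
Proof.
move=> Lf; have n20 : 2 != 0 :> R by [].
have := poweR_Lnorm mu (EFin \o f) n20.
have -> : (\int[mu]_x `|(EFin \o f) x| `^ 2)%E = (\int[mu]_x (f x ^+ 2))%:E.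
  rewrite EFin_int//; apply: eq_integral => x _.
  by rewrite /= powR_mulrn// real_normK// num_real.
have := Lnorm_ge0 mu 2%:E (EFin \o f).
case: ('N[mu]_2%:E [EFin \o f])%E => [r|//|//] /=.
  by rewrite lee_fin => r0 []; rewrite powR_mulrn.
by rewrite (negbTE n20).
Qed.

Lemma H1_normsq_energy C om n (f : R -> R) : C1_bounds C om n f -> H1_normsq f = energy f.
Proof.
move=> B; rewrite /H1_normsq /energy.
by rewrite (Lnorm2_sqr (proj1 (C1_L2 B))) (Lnorm2_sqr (proj1 (C1_dL2 B))).
Qed.

Lemma finite_of_bound (T : \bar R) (B : R) : (0 < T)%E ->
  (forall t, 0 < t -> (t%:E < T)%E -> t <= B) -> exists2 r, T = r%:E & r <= B.
Proof.
case: T => [r|_ h|//].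
  rewrite lte_fin => r0 h; exists r => //; rewrite leNgt; apply/negP => Br.
  (* A time between [B] and [r]; the maximum with [r / 2] keeps it positive even when [B] is
     negative. *)
  pose t := Num.max (r / 2) ((B + r) / 2).
  have t0 : 0 < t by rewrite lt_max divr_gt0.
  have tr : (t%:E < r%:E)%E by rewrite lte_fin gt_max; apply/andP; split; lra.
  have Bt : B < t by rewrite lt_max; apply/orP; right; lra.
  by have := h t t0 tr; rewrite leNgt Bt.
have p : 0 < `|B| + 1 by rewrite ltr_wpDl.
have := h _ p (ltry _); have := ler_norm B; lra.
Qed.

Lemma pressure_opp (f : R -> R) M (sg : R) x : continuous f -> (forall y, `|f y| <= M) ->
  pressure sg (fun y => - f y) x = - pressure sg f x.
Proof.
move=> cf fM; have E : (fun y => - f y) = (fun y => -1 * f y).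
  by apply/funext => y; rewrite mulN1r.
by rewrite E /pressure (exp_avg_scale _ 1 _ cf fM) (exp_avg_scale _ (-1) _ cf fM); ring.
Qed.

Lemma derive1_opp C om n (f : R -> R) : C1_bounds C om n f ->
  derive1 (fun x => - f x) = fun x => - derive1 f x.
Proof.
move=> B; apply/funext => x; apply: is_derive_derive1.
exact: is_derive_opp (C1_derive B x).
Qed.

Lemma C1_bounds_opp C om n (f : R -> R) : C1_bounds C om n f ->
  C1_bounds C om n (fun x => - f x).
Proof.
move=> B; have E := derive1_opp B.
have Es (g : R -> R) : (fun x => (- g x) ^+ 2) = (fun x => g x ^+ 2).
  by apply/funext => x; rewrite sqrrN.
split.
- by move=> x; rewrite E; exact: is_derive_opp (C1_derive B x).
- by rewrite E; apply: cont_opp; exact: C1_cont B.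
- by move=> x; rewrite normrN; exact: C1_sup B x.
- by move=> x; rewrite E normrN; exact: C1_dsup B x.
- by move=> x h; rewrite E -opprD normrN; exact: C1_mod B x h.
- by rewrite Es; exact: C1_L2 B.
- by rewrite E Es; exact: C1_dL2 B.
move=> h h0; have E2 : (fun x => ((- f (x + h) - - f x) / h - derive1 (fun x => - f x) x) ^+ 2)
   = (fun x => ((f (x + h) - f x) / h - derive1 f x) ^+ 2).
  by apply/funext => x; rewrite E; field.
by rewrite E2; exact: C1_quot B h h0.
Qed.

Lemma strong_solution_opp (l1 l2 l3 l4 l5 l6 : R) T u ut C C' om :
  strong_solution l1 l2 l3 l4 l5 l6 T u ut C C' om ->
  strong_solution (- l1) (- l2) (- l3) (- l4) (- l5) (- l6) T
    (fun t x => - u t x) (fun t x => - ut t x) C C' om.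
Proof.
move=> H; split.
- exact: mod_const_ge0 H.
- exact: mod_ge0 H.
- exact: mod_cvg0 H.
- move=> t1 /(sol_bounded H)[n n0 B]; exists n => // t /B; exact: C1_bounds_opp.
- move=> t e Jt e0; have [d d0 hd] := sol_cont H Jt e0; exists d => // t' Jt' td.
  have E : (fun x => - u t' x - - u t x) = (fun x => - (u t' x - u t x)).
    by apply/funext => x; rewrite opprD.
  by rewrite E; apply: C1_bounds_opp; exact: hd.
- by move=> t Jt; apply: cont_opp; exact (sol_dcont H Jt).
- move=> t Jt; have [n n0 [h1 h2 h3]] := sol_dbounded H Jt; exists n => //.
  have E : (fun x => (- ut t x) ^+ 2) = (fun x => ut t x ^+ 2).
    by apply/funext => x; rewrite sqrrN.
  by split; [move=> x; rewrite normrN|rewrite E|rewrite E].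
- move=> t e Jt e0; have [d d0 hd] := sol_derive H Jt e0; exists d => // t' Jt' tt' td.
  have [h1 h2 h3] := hd t' Jt' tt' td.
  have E x : (- u t' x - - u t x) / (t' - t) - - ut t x =
     - ((u t' x - u t x) / (t' - t) - ut t x) by ring.
  have E2 : (fun x => ((- u t' x - - u t x) / (t' - t) - - ut t x) ^+ 2) =
     (fun x => ((u t' x - u t x) / (t' - t) - ut t x) ^+ 2).
    by apply/funext => x; rewrite E sqrrN.
  by split; [move=> x; rewrite E normrN|rewrite E2|rewrite E2].
move=> t x t0 tT; have Jt := time_interval_pos t0 tT.
have [n n0 B] := sol_bound H Jt.
have cf := C1_bounds_cont B; have cf' := C1_cont B.
have src (p q : R) : (fun y => - p * (- u t y) ^+ 2 + - q * derive1 (fun x => - u t x) y ^+ 2)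
   = (fun y => - (p * u t y ^+ 2 + q * derive1 (u t) y ^+ 2)).
  by apply/funext => y; rewrite (derive1_opp B) !sqrrN; ring.
rewrite !src (derive1_opp B) (sol_equation H x t0 tT).
rewrite (pressure_opp _ _ (quadratic_source_cont cf cf')
  (quadratic_source_bound _ _ (C1_sup B) (C1_dsup B))).
rewrite (pressure_opp _ _ (quadratic_source_cont cf cf')
  (quadratic_source_bound _ _ (C1_sup B) (C1_dsup B))).
by move: (pressure _ _ _) (pressure _ _ _) => p q; ring.
Qed.

Lemma riccati_const_opp (l1 l2 l3 l4 l5 l6 : R) :
  riccati_const (- l1) (- l2) (- l3) (- l4) (- l5) (- l6) =
  riccati_const l1 l2 l3 l4 l5 l6.
Proof.
have E (x y : R) : `|- x * - y / (- l6 - - l2)| = `|x * y / (l6 - l2)|.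
  by rewrite mulrNN -opprD invrN mulrN normrN.
by rewrite /riccati_const !E !normrN.
Qed.

(** The two hypotheses exclude [l6 = 0], and [|l6|] occurs in the second argument of the maximum. *)
Lemma riccati_const_gt0 (l1 l2 l3 l4 l5 l6 : R) : l2 = 2 * l6 -> l2 != l6 ->
  0 < riccati_const l1 l2 l3 l4 l5 l6.
Proof.
move=> h26 hne; have l60 : 0 < `|l6|.
  by rewrite normr_gt0; apply: contraNneq hne => l60; rewrite h26 l60 mulr0.
rewrite /riccati_const ltr_wpDl ?divr_ge0// lt_max; apply/orP; right.
apply: mulr_gt0 => //; apply: ltr_pwDl => //; apply: ltr_pwDl => //.
exact: ltr_wpDl.
Qed.

End assembly.

Section lifespan.
Context {R : realType}.
Implicit Types (f : R -> R) (x : R).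

(** Without energy [f] would vanish identically by [sqr_le_energy], and so would the negative
    quantity. This makes [K0] positive. *)
Lemma energy_gt0 C om n f (beta x : R) : 0 <= C -> 0 < n -> C1_bounds C om n f ->
  derive1 f x - beta * f x < 0 -> 0 < energy f.
Proof.
move=> C0 n0 B hw; rewrite ltNge; apply/negP => e0; move: hw.
have f0 : f = fun=> 0.
  apply/funext => y; apply/eqP; rewrite -sqrf_eq0 eq_le sqr_ge0 andbT.
  by apply: (le_trans (sqr_le_energy y C0 n0 B)); rewrite pmulr_rle0.
by rewrite f0 mulr0 subr0 (is_derive_derive1 (is_derive_c 0 x)) ltxx.
Qed.

Lemma energy_opp C om n f : C1_bounds C om n f -> energy (fun x => - f x) = energy f.
Proof.
move=> B; rewrite /energy (derive1_opp B).
by congr (_ + _); apply: eq_int => x; rewrite sqrrN.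
Qed.

Lemma lifespan_le (l1 l2 l3 l4 l5 l6 : R) T u ut C C' om x0 :
  let K0 := riccati_const l1 l2 l3 l4 l5 l6 * energy (u 0) in
  let w := derive1 (u 0) x0 - l1 / (l6 - l2) * u 0 x0 in
  strong_solution l1 l2 l3 l4 l5 l6 T u ut C C' om -> (0 < T)%E ->
  l1 + l3 = 0 -> 2 * l1 + l4 = 0 -> l2 = 2 * l6 -> l6 < l2 ->
  w < - Num.sqrt (K0 / (l2 - l6)) ->
  exists2 r, T = r%:E & r <= 1 / (2 * Num.sqrt ((l2 - l6) * K0)) *
    ln ((w - Num.sqrt (K0 / (l2 - l6))) / (w + Num.sqrt (K0 / (l2 - l6)))).
Proof.
move=> K0 w H T0 h13 h14 h26 hlt hw.
have J0 : time_interval T 0 by split.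
have [n n0 B] := sol_bound H J0.
have K00 : 0 < K0.
  apply: mulr_gt0; first by apply: riccati_const_gt0 => //; rewrite gt_eqF.
  apply: (energy_gt0 (mod_const_ge0 H) n0 B (beta := l1 / (l6 - l2)) (x := x0)).
  by apply: lt_le_trans hw _; rewrite oppr_le0 sqrtr_ge0.
apply: finite_of_bound => // t t0 tT.
exact: (blowup_bound H h13 h14 h26 hlt t0 tT K00 hw).
Qed.

End lifespan.

Theorem theorem9 (R : realType) (l1 l2 l3 l4 l5 l6 : R)
    (h13 : l1 + l3 = 0) (h14 : 2 * l1 + l4 = 0) (h26 : l2 = 2 * l6)
    (hne : l2 != l6) (s : R) (hs : 3 / 2 < s) (u0 : R -> R)
    (hu0 : sobolev s u0) :
  let C1 := 2^-1 * (`|l3| + `|l5| + `|l1 * l3 / (l6 - l2)|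
                    + `|l1 * l5 / (l6 - l2)|) in
  let C2 := 2^-1 * (`|l4| + `|l6| + `|l1 * l4 / (l6 - l2)|
                    + `|l1 * l6 / (l6 - l2)|) in
  let K0 := (`|l5| / 2 + Num.max C1 C2) * H1_normsq u0 in
  let w0 := fun x : R => derive1 u0 x - l1 / (l6 - l2) * u0 x in
  forall x0 : R,
  (l6 < l2 -> w0 x0 < - Num.sqrt (K0 / (l2 - l6))) ->
  (l2 < l6 -> Num.sqrt (K0 / (l6 - l2)) < w0 x0) ->
  forall (T : \bar R) (u : R -> R -> R),
  is_maximal_solution l1 l2 l3 l4 l5 l6 s u0 T u ->
  exists Tstar : R,
    [/\ T = Tstar%:E,
        l6 < l2 ->
          Tstar <= 1 / (2 * Num.sqrt ((l2 - l6) * K0)) *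
            ln ((w0 x0 - Num.sqrt (K0 / (l2 - l6))) /
                (w0 x0 + Num.sqrt (K0 / (l2 - l6)))) &
        l2 < l6 ->
          Tstar <= 1 / (2 * Num.sqrt ((l6 - l2) * K0)) *
            ln ((w0 x0 + Num.sqrt (K0 / (l6 - l2))) /
                (w0 x0 - Num.sqrt (K0 / (l6 - l2))))].
Proof.
move=> C1 C2 K0 w0 x0 hlt hgt T u [sol _].
have [ut [C [C' [om H]]]] := strong_solution_exists hs sol.
have [T0 _ uu0 _] := sol.
have J0 : time_interval T 0 by split.
have [n _ B] := sol_bound H J0; rewrite uu0 in B.
have K0E : K0 = riccati_const l1 l2 l3 l4 l5 l6 * energy u0.
  by rewrite /K0 (H1_normsq_energy B).
have [l62|l26|/eqP] := ltgtP l6 l2; last by rewrite eq_sym (negbTE hne).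
  have := @lifespan_le _ l1 l2 l3 l4 l5 l6 T u ut C C' om x0 H T0 h13 h14 h26 l62.
  rewrite uu0 -K0E -/(w0 x0) => /(_ (hlt l62))[r Tr hr].
  by exists r; split.
have H' := strong_solution_opp H.
have h13' : - l1 + - l3 = 0 by rewrite -opprD h13 oppr0.
have h14' : 2 * - l1 + - l4 = 0 by rewrite mulrN -opprD h14 oppr0.
have h26' : - l2 = 2 * - l6 by rewrite h26 mulrN.
have l62' : - l6 < - l2 by rewrite ltrN2.
have := lifespan_le (x0 := x0) H' T0 h13' h14' h26' l62'.
rewrite uu0 (energy_opp B) riccati_const_opp -K0E (derive1_opp B).
(* The quotient [l1 / (l6 - l2)] is invariant under reversal of the coefficients, so [w0] only
   changes sign along with [u0]. *)
have -> : - derive1 u0 x0 - - l1 / (- l6 - - l2) * - u0 x0 = - w0 x0.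
  have -> : - l6 - - l2 = - (l6 - l2) by rewrite opprD.
  by rewrite invrN mulrNN mulrN /w0 opprD.
have -> : - l2 - - l6 = l6 - l2 by rewrite opprK addrC.
rewrite ltrN2 => /(_ (hgt l26))[r Tr hr]; exists r; split=> // _.
apply: (le_trans hr); rewrite -opprD.
have -> : - w0 x0 + Num.sqrt (K0 / (l6 - l2)) = - (w0 x0 - Num.sqrt (K0 / (l6 - l2))).
  by rewrite [RHS]opprB addrC.
by rewrite invrN mulrNN.
Qed.
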